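(* The following model checking problem is \textsc{PSpace}-complete: given an ISRL $IS$ (all components given explicitly, regular expressions as expressions), a formula $\varphi$ of the $BDE$ fragment of EHS$^{+}$, and an interval $I$ of the model of $IS$ (each state given as its sequence of configurations), decide whether $IS,I\models\varphi$.
   Context: **Regular expressions.** For a finite alphabet $X$, $RE_X$ is the set of regular expressions $e ::= \emptyset \mid \epsilon \mid s \mid e;e \mid e+e \mid e^*$ with $s\in X$. $L(e)$ denotes the standard language of $e$. **ISRL.** Fix agents $A=\{0,\dots,m\}$ and a finite set $\mathit{Var}$ of propositional variables. An ISRL is $IS=(\{L_i\},\{l_i^0\},\{ACT_i\},\{P_i\},\{t_i\},\lambda)$ where, for each $i\in A$: - $L_i$ is a finite set of local states and $l_i^0\in L_i$; - $ACT_i$ is a finite set of actions and $P_i:L_i\to 2^{ACT_i}$; - $t_i\subseteq L_i\times ACT\times L_i$, with $ACT=ACT_0\times\dots\times ACT_m$; - $\lambda:\mathit{Var}\to RE_G$, where $G=L_0\times\dots\times L_m$. $t^G((l_0,\dots,l_m),(l'_0,\dots,l'_m))$ holds iff some $(a_0,\dots,a_m)\in ACT$ has $a_i\in P_i(l_i)$ and $(l_i,(a_0,\dots,a_m),l'_i)\in t_i$ for all $i$. **Model of $IS$.** - States $S$ are the nonempty sequences $g_0\dots g_k$ with $g_0=(l_0^0,\dots,l_m^0)$ and $t^G(g_j,g_{j+1})$ for all $j<k$. - $t(g_0\dots g_k,g'_0\dots g'_l)$ iff $l=k+1$ and $g_j=g'_j$ for all $j\le k$. - $g_0\dots g_k\sim_i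 g'_0\dots g'_l$ iff $g_k,g'_l$ have the same $i$-th component. - $\mathrm{g}(g_0\dots g_k)=g_k$. **Intervals.** An interval is a nonempty sequence $I=s_1\dots s_n$ of states with $t(s_j,s_{j+1})$; $|I|=n$, $\mathrm{g}(I)=\mathrm{g}(s_1)\dots\mathrm{g}(s_n)$, and $\mathit{pi}(I)$ iff $n=1$. **Indistinguishability.** $I=s_1\dots s_k\sim_i s'_1\dots s'_l$ iff $k=l$ and $s_j\sim_i s'_j$ for all $j$; $\sim_\Gamma$ is the transitive closure of $\bigcup_{i\in\Gamma}\sim_i$. **Relations used** (juxtaposition is concatenation of sequences): - $I R_B I'$ iff $I=I'I_1$ for some interval $I_1$; - $I R_D I'$ iff $I=I_1I'I_2$ for some intervals $I_1,I_2$; - $I R_E I'$ iff $I=I_1I'$ for some interval $I_1$. **$BDE$ fragment of EHS$^{+}$.** Syntax: $\varphi::=\mathit{pi}\mid p\mid\neg\varphi\mid\varphi\wedge\varphi\mid K_i\varphi\mid C_\Gamma\varphi\mid\langle B\rangle\varphi\mid\langle D\rangle\varphi\mid\langle E\rangle\varphi$, with $p\in\mathit{Var}$, $i\in A$, $\Gamma\subseteq A$. Semantics: - $M,I\models\mathit{pi}$ iff $|I|=1$; - $M,I\models p$ iff $\mathrm{g}(I)\in L(\lambda(p))$; - Boolean connectives as usual; - $K_i\varphi$ holds iff $\varphi$ holds on all $I'\sim_i I$; - $C_\Gamma\varphi$ holds iff $\varphi$ holds on all $I'\sim_\Gamma I$; - $\langle X\rangle\varphi$ holds iff $\varphi$ holds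 on some $I'$ with $I R_X I'$. $IS,I\models\varphi$ refers to the model of $IS$. *)

(* Defs.v *)
From Stdlib Require Import List Arith Bool Relations.
Import ListNotations.

Inductive re (X : Type) : Type :=
| ReEmpty : re X
| ReEps : re X
| ReSym : X -> re X
| ReSeq : re X -> re X -> re X
| ReAlt : re X -> re X -> re X
| ReStar : re X -> re X.
Arguments ReEmpty {X}. Arguments ReEps {X}. Arguments ReSym {X} _.
Arguments ReSeq {X} _ _. Arguments ReAlt {X} _ _. Arguments ReStar {X} _.

Inductive lang {X : Type} : re X -> list X -> Prop :=
| lang_eps : lang ReEps []
| lang_sym x : lang (ReSym x) [x]
| lang_seq e1 e2 u v : lang e1 u -> lang e2 v -> lang (ReSeq e1 e2) (u ++ v)
| lang_altl e1 e2 u : lang e1 u -> lang (ReAlt e1 e2) u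
| lang_altr e1 e2 u : lang e2 u -> lang (ReAlt e1 e2) u
| lang_star0 e : lang (ReStar e) []
| lang_starS e u v : lang e u -> lang (ReStar e) v -> lang (ReStar e) (u ++ v).

Fixpoint re_syms {X : Type} (e : re X) : list X :=
  match e with
  | ReEmpty | ReEps => []
  | ReSym x => [x]
  | ReSeq e1 e2 | ReAlt e1 e2 => re_syms e1 ++ re_syms e2
  | ReStar e1 => re_syms e1
  end.

(* ISRLs (given explicitly).  Agent i has local states {0..nloc-1},   *)
(* actions {0..nact-1}; protocol P_i(l) = nth l prot; t_i = trans.    *)
(* Agents are A = {0,..,m} with m+1 = length is_agents,               *)
(* Var = {0,..,length is_lambda - 1}.                                 *)
Record agent := mkAgent {
  ag_nloc : nat;
  ag_init : nat;
  ag_nact : nat;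
  ag_prot : list (list nat);
  ag_trans : list (nat * list nat * nat) }.

Definition gstate := list nat.          (* global state (l_0,...,l_m) *)
Definition mstate := list gstate.       (* model state g_0 ... g_k *)
Definition interval := list mstate.

Record isrl := mkISRL {
  is_agents : list agent;
  is_lambda : list (re gstate) }.

Definition dflt_agent : agent := mkAgent 0 0 0 [] [].

Definition valid_gstate (IS : isrl) (g : gstate) : Prop :=
  Forall2 (fun l a => l < ag_nloc a) g (is_agents IS).

Definition valid_joint (IS : isrl) (a : list nat) : Prop :=
  Forall2 (fun x ag => x < ag_nact ag) a (is_agents IS).

Definition wf_agent (IS : isrl) (ag : agent) : Prop :=
  ag_init ag < ag_nloc ag /\
  length (ag_prot ag) = ag_nloc ag /\
  Forall (Forall (fun x => x < ag_nact ag)) (ag_prot ag) /\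
  Forall (fun t => match t with (l, a, l') =>
            l < ag_nloc ag /\ valid_joint IS a /\ l' < ag_nloc ag end)
         (ag_trans ag).

Definition wf_isrl (IS : isrl) : Prop :=
  is_agents IS <> [] /\
  Forall (wf_agent IS) (is_agents IS) /\
  Forall (fun e => Forall (valid_gstate IS) (re_syms e)) (is_lambda IS).

Definition agent_of (IS : isrl) (i : nat) : agent := nth i (is_agents IS) dflt_agent.

Definition tG (IS : isrl) (g g' : gstate) : Prop :=
  valid_gstate IS g /\ valid_gstate IS g' /\
  exists a, valid_joint IS a /\
    forall i, i < length (is_agents IS) ->
      In (nth i a 0) (nth (nth i g 0) (ag_prot (agent_of IS i)) []) /\
      In (nth i g 0, a, nth i g' 0) (ag_trans (agent_of IS i)).

Definition init_g (IS : isrl) : gstate := map ag_init (is_agents IS).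

Definition is_mstate (IS : isrl) (s : mstate) : Prop :=
  s <> [] /\ hd [] s = init_g IS /\
  forall j, S j < length s -> tG IS (nth j s []) (nth (S j) s []).

Definition tM (IS : isrl) (s s' : mstate) : Prop :=
  is_mstate IS s /\ is_mstate IS s' /\ exists g, s' = s ++ [g].

Definition gof (s : mstate) : gstate := last s [].

Definition simS (i : nat) (s s' : mstate) : Prop := nth i (gof s) 0 = nth i (gof s') 0.

Definition is_interval (IS : isrl) (I : interval) : Prop :=
  I <> [] /\ Forall (is_mstate IS) I /\
  forall j, S j < length I -> tM IS (nth j I []) (nth (S j) I []).

Definition simI (i : nat) (I I' : interval) : Prop :=
  length I = length I' /\ forall j, j < length I -> simS i (nth j I []) (nth j I' []).

Definition simGstep (IS : isrl) (Gam : list nat) (I I' : interval) : Prop :=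
  is_interval IS I /\ is_interval IS I' /\ exists i, In i Gam /\ simI i I I'.

Inductive fml : Type :=
| FPi : fml
| FVar : nat -> fml
| FNeg : fml -> fml
| FAnd : fml -> fml -> fml
| FK : nat -> fml -> fml
| FC : list nat -> fml -> fml
| FB : fml -> fml
| FD : fml -> fml
| FE : fml -> fml.

Fixpoint wf_fml (IS : isrl) (f : fml) : Prop :=
  match f with
  | FPi => True
  | FVar p => p < length (is_lambda IS)
  | FNeg f1 | FB f1 | FD f1 | FE f1 => wf_fml IS f1
  | FAnd f1 f2 => wf_fml IS f1 /\ wf_fml IS f2
  | FK i f1 => i < length (is_agents IS) /\ wf_fml IS f1
  | FC G f1 => Forall (fun i => i < length (is_agents IS)) G /\ wf_fml IS f1
  end.

Fixpoint sat (IS : isrl) (f : fml) (I : interval) : Prop :=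
  match f with
  | FPi => length I = 1
  | FVar p => lang (nth p (is_lambda IS) ReEmpty) (map gof I)
  | FNeg f1 => ~ sat IS f1 I
  | FAnd f1 f2 => sat IS f1 I /\ sat IS f2 I
  | FK i f1 => forall I', is_interval IS I' -> simI i I I' -> sat IS f1 I'
  | FC G f1 => forall I', clos_trans interval (simGstep IS G) I I' -> sat IS f1 I'
  | FB f1 => exists I' I1, I' <> [] /\ I1 <> [] /\ I = I' ++ I1 /\ sat IS f1 I'
  | FD f1 => exists I1 I' I2, I1 <> [] /\ I' <> [] /\ I2 <> [] /\
               I = I1 ++ I' ++ I2 /\ sat IS f1 I'
  | FE f1 => exists I1 I', I1 <> [] /\ I' <> [] /\ I = I1 ++ I' /\ sat IS f1 I'
  end.

(* Encoding of instances as bit strings (balanced-parenthesis          *)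
(* s-expressions: true = "(", false = ")"; naturals in unary, which is *)
(* polynomially equivalent since all sets are given explicitly).       *)
Definition enc_nat (n : nat) : list bool :=
  true :: concat (repeat [true; false] n) ++ [false].
Definition enc_list {A : Type} (f : A -> list bool) (l : list A) : list bool :=
  true :: concat (map f l) ++ [false].
Definition enc_node (tag : nat) (ch : list (list bool)) : list bool :=
  true :: enc_nat tag ++ concat ch ++ [false].

Fixpoint enc_re {X : Type} (f : X -> list bool) (e : re X) : list bool :=
  match e with
  | ReEmpty => enc_node 0 []
  | ReEps => enc_node 1 []
  | ReSym x => enc_node 2 [f x]
  | ReSeq e1 e2 => enc_node 3 [enc_re f e1; enc_re f e2]
  | ReAlt e1 e2 => enc_node 4 [enc_re f e1; enc_re f e2]
  | ReStar e1 => enc_node 5 [enc_re f e1]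
  end.

Definition enc_gstate (g : gstate) : list bool := enc_list enc_nat g.

Definition enc_trans (t : nat * list nat * nat) : list bool :=
  match t with (l, a, l') => enc_list id [enc_nat l; enc_list enc_nat a; enc_nat l'] end.

Definition enc_agent (ag : agent) : list bool :=
  enc_list id [enc_nat (ag_nloc ag); enc_nat (ag_init ag); enc_nat (ag_nact ag);
               enc_list (enc_list enc_nat) (ag_prot ag);
               enc_list enc_trans (ag_trans ag)].

Definition enc_isrl (IS : isrl) : list bool :=
  enc_list id [enc_list enc_agent (is_agents IS);
               enc_list (enc_re enc_gstate) (is_lambda IS)].

Fixpoint enc_fml (f : fml) : list bool :=
  match f with
  | FPi => enc_node 0 []
  | FVar p => enc_node 1 [enc_nat p]
  | FNeg f1 => enc_node 2 [enc_fml f1]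
  | FAnd f1 f2 => enc_node 3 [enc_fml f1; enc_fml f2]
  | FK i f1 => enc_node 4 [enc_nat i; enc_fml f1]
  | FC G f1 => enc_node 5 [enc_list enc_nat G; enc_fml f1]
  | FB f1 => enc_node 6 [enc_fml f1]
  | FD f1 => enc_node 7 [enc_fml f1]
  | FE f1 => enc_node 8 [enc_fml f1]
  end.

Definition enc_interval (I : interval) : list bool :=
  enc_list (enc_list enc_gstate) I.

Definition enc_instance (IS : isrl) (f : fml) (I : interval) : list bool :=
  enc_list id [enc_isrl IS; enc_fml f; enc_interval I].

Definition MC_BDE (w : list bool) : Prop :=
  exists IS f I, w = enc_instance IS f I /\
    wf_isrl IS /\ wf_fml IS f /\ is_interval IS I /\ sat IS f I.

(* Deterministic one-tape Turing machines (tape infinite to the right; *)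
(* moving left on the first cell stays).  Symbols 0..nsym-1, 0 = blank,*)
(* 1 = bit false, 2 = bit true.                                        *)
Inductive move := MoveL | MoveR | MoveS.

Record TM := mkTM {
  tm_nstates : nat;
  tm_nsym : nat;
  tm_start : nat;
  tm_accept : nat;
  tm_reject : nat;
  tm_delta : nat -> nat -> nat * nat * move }.

Definition wf_TM (M : TM) : Prop :=
  3 <= tm_nsym M /\ tm_start M < tm_nstates M /\ tm_accept M < tm_nstates M /\
  tm_reject M < tm_nstates M /\ tm_accept M <> tm_reject M /\
  forall q a, q < tm_nstates M -> a < tm_nsym M ->
    match tm_delta M q a with
    | (q', b, _) => q' < tm_nstates M /\ b < tm_nsym M
    end.

(* configuration: state, cells left of head (nearest first), cells from head on *)
Record config := mkCfg { cf_state : nat; cf_left : list nat; cf_right : list nat }.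

Definition halted (M : TM) (c : config) : Prop :=
  cf_state c = tm_accept M \/ cf_state c = tm_reject M.

Definition step (M : TM) (c : config) : config :=
  let q := cf_state c in
  if orb (q =? tm_accept M) (q =? tm_reject M) then c else
  let a := hd 0 (cf_right c) in
  match tm_delta M q a with
  | (q', b, mv) =>
    let r := b :: tl (cf_right c) in
    match mv with
    | MoveS => mkCfg q' (cf_left c) r
    | MoveR => mkCfg q' (b :: cf_left c) (tl (cf_right c))
    | MoveL => match cf_left c with
               | [] => mkCfg q' [] r
               | x :: l => mkCfg q' l (x :: r)
               end
    end
  end.

Definition run (M : TM) (c : config) (n : nat) : config := Nat.iter n (step M) c.

Definition sym_of_bool (b : bool) : nat := if b then 2 else 1.

Definition init_cfg (M : TM) (w : list bool) : config :=
  mkCfg (tm_start M) [] (map sym_of_bool w).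

Definition cfg_space (c : config) : nat := length (cf_left c) + length (cf_right c) + 1.

Definition poly (c k n : nat) : nat := c * n ^ k + c.

Definition decides_in_space (M : TM) (L : list bool -> Prop) (s : nat -> nat) : Prop :=
  forall w, exists n,
    halted M (run M (init_cfg M w) n) /\
    (cf_state (run M (init_cfg M w) n) = tm_accept M <-> L w) /\
    forall j, j <= n -> cfg_space (run M (init_cfg M w) j) <= s (length w).

Definition in_PSPACE (L : list bool -> Prop) : Prop :=
  exists M c k, wf_TM M /\ decides_in_space M L (poly c k).

Fixpoint bits_prefix (t : list nat) : list bool :=
  match t with
  | 1 :: t' => false :: bits_prefix t'
  | 2 :: t' => true :: bits_prefix t'
  | _ => []
  end.

Definition tape_output (c : config) : list bool :=
  bits_prefix (rev (cf_left c) ++ cf_right c).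

Definition poly_time_computable (g : list bool -> list bool) : Prop :=
  exists M c k, wf_TM M /\ forall w, exists n,
    n <= poly c k (length w) /\ halted M (run M (init_cfg M w) n) /\
    tape_output (run M (init_cfg M w) n) = g w.

Definition poly_reduces (L1 L2 : list bool -> Prop) : Prop :=
  exists g, poly_time_computable g /\ forall w, L1 w <-> L2 (g w).

Definition PSPACE_hard (L : list bool -> Prop) : Prop :=
  forall L', in_PSPACE L' -> poly_reduces L' L.

Definition PSPACE_complete (L : list bool -> Prop) : Prop :=
  in_PSPACE L /\ PSPACE_hard L.

(* Main.v *)
(* Membership.  Whether a formula holds at an interval depends only on the sequence of global
   states of the interval, so K and C quantify over paths of the global transition relation
   that start in a reachable state and have the length of the given interval.  Model checking
   is then a recursive boolean procedure of polynomial depth: existential choices are guessed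
   one symbol at a time, reachability of a global state and the transitive closure for C are
   decided by repeated squaring, and <D> is the composition of <E> and <B>.  Evaluating such a
   procedure depth first takes polynomial space.

   Hardness.  The cells of a machine working in space n become agents, whose local states are
   symbols paired with an optional control state.  The joint action of a step is idle except
   at the agent under the head.  On acceptance all agents may move to the blank local state.
   The last agent is a cell that is never visited, so its knowledge operator, evaluated at the
   initial state, quantifies over all reachable global states.

   Machines.  Removing the outermost opening parenthesis from the encoding of an instance
   leaves the prefix code of a binary tree.  Functions on trees are programmed with four
   stacks of bits, and such programs run on a one-tape machine whose tape has four tracks. *)

Require Import Defs.
From Stdlib Require Import List Arith Bool Relations Lia Classical.
Import ListNotations.

(** For membership the length of an evaluation is never estimated: [exec] and [ev] are inductive, so
    a derivation is already a halting run, and only stack height and nesting depth need bounds. The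
    obstacle is that the evaluator must return a definite value, within the depth bound, for every
    tree that a guess can produce, and most of these code nothing. Hence the specifications [W]
    speak of arbitrary trees wherever a guess may arrive, the property decided includes being a
    code, and a conjunct may rely on the conjuncts evaluated before it.

    One number, the budget [n], serves three purposes. Guesses of [n] moves reach every tree of size
    at most [n]; there are fewer than [2 ^ (S n)] such trees, so squaring can stop at level [S n];
    and [n] is quadratic in the input, so that the code of any path as long as the given interval
    fits.

    In the reduction the number of cells is the space bound plus one. This single extra cell is the
    one that the head never visits. *)

Definition poly_bounded (f : nat -> nat) : Prop := exists c k, forall n, f n <= poly c k n.

Lemma poly_bounded_le f g : poly_bounded g -> (forall n, f n <= g n) -> poly_bounded f.
Proof. intros [c [k H]] Hf. exists c, k. intros n. specialize (H n); specialize (Hf n); lia. Qed.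

Lemma pb_const a : poly_bounded (fun _ => a).
Proof. exists a, 0. intros n. unfold poly. lia. Qed.

Lemma pb_id : poly_bounded (fun n => n).
Proof. exists 1, 1. intros n. unfold poly. simpl. lia. Qed.

(** The [+ 1] is for [n = 0], where [0 ^ 0 = 1] exceeds [0 ^ j]. *)
Lemma pow_le_S n k j : k <= j -> n ^ k <= n ^ j + 1.
Proof.
  intros H. destruct n as [|n].
  - destruct k; simpl; [|rewrite Nat.pow_0_l by lia]; lia.
  - pose proof (Nat.pow_le_mono_r (S n) k j). lia.
Qed.

Lemma pb_add f g : poly_bounded f -> poly_bounded g -> poly_bounded (fun n => f n + g n).
Proof.
  intros [c [k Hf]] [d [j Hg]]. exists (2 * c + 2 * d), (k + j). intros n.
  specialize (Hf n); specialize (Hg n). unfold poly in *.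
  pose proof (pow_le_S n k (k + j)). pose proof (pow_le_S n j (k + j)).
  assert (c * n ^ k <= c * (n ^ (k + j) + 1)) by (apply Nat.mul_le_mono_l; lia).
  assert (d * n ^ j <= d * (n ^ (k + j) + 1)) by (apply Nat.mul_le_mono_l; lia).
  nia.
Qed.

Lemma pb_mul f g : poly_bounded f -> poly_bounded g -> poly_bounded (fun n => f n * g n).
Proof.
  intros [c [k Hf]] [d [j Hg]]. exists (4 * c * d), (k + j). intros n.
  specialize (Hf n); specialize (Hg n). unfold poly in *.
  pose proof (pow_le_S n k (k + j)). pose proof (pow_le_S n j (k + j)).
  assert (f n * g n <= (c * (n ^ k + 1)) * (d * (n ^ j + 1))) by (apply Nat.mul_le_mono; lia).
  (* For positive [n] each factor is at most twice its power, and for [n = 0] each is at most 2;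
     hence the 4. *)
  assert ((n ^ k + 1) * (n ^ j + 1) <= 4 * n ^ (k + j) + 4).
  { rewrite Nat.pow_add_r in *. nia. }
  nia.
Qed.

Lemma pb_pow f k : poly_bounded f -> poly_bounded (fun n => f n ^ k).
Proof.
  intros H. induction k; simpl. apply pb_const. apply pb_mul; auto.
Qed.

Lemma poly_mono c k n m : n <= m -> poly c k n <= poly c k m.
Proof.
  intros H. unfold poly. pose proof (Nat.pow_le_mono_l n m k H). nia.
Qed.

Lemma pb_poly c k f : poly_bounded f -> poly_bounded (fun n => poly c k (f n)).
Proof.
  intros H. unfold poly. apply pb_add. apply pb_mul. apply pb_const. apply pb_pow; auto.
  apply pb_const.
Qed.

Definition mono (f : nat -> nat) : Prop := forall n m, n <= m -> f n <= f m.

(** Composition evaluates a bound at an upper estimate of a size, which is sound only for monotone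
    bounds. *)
Lemma pb_mono f : poly_bounded f -> exists g, poly_bounded g /\ mono g /\ forall n, f n <= g n.
Proof.
  intros [c [k H]]. exists (poly c k). repeat split; auto.
  - exists c, k. auto.
  - intros n m. apply poly_mono.
Qed.

Lemma pb_comp f g : mono f -> poly_bounded f -> poly_bounded g -> poly_bounded (fun n => f (g n)).
Proof.
  intros Hm [c [k H]] Hg. eapply poly_bounded_le. apply (pb_poly c k g Hg). intros n. apply H.
Qed.

(** * Binary trees and their prefix code *)

Inductive tree : Type := Lf | Nd (a b : tree).

Fixpoint enc (t : tree) : list bool :=
  match t with Lf => [false] | Nd a b => true :: enc a ++ enc b end.

Fixpoint sz (t : tree) : nat :=
  match t with Lf => 1 | Nd a b => 1 + sz a + sz b end.

Lemma enc_length t : length (enc t) = sz t.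
Proof. induction t; simpl; auto. rewrite length_app; lia. Qed.

Lemma sz_pos t : 1 <= sz t.
Proof. destruct t; simpl; lia. Qed.

(** Prefix-freeness of the code. The arbitrary continuations [x] and [y] let the induction pass from
    the first subtree to the second. *)
Lemma enc_inj_app t : forall u x y, enc t ++ x = enc u ++ y -> t = u /\ x = y.
Proof.
  induction t; intros [|u1 u2] x y H; simpl in H; try discriminate.
  - inversion H; auto.
  - inversion H. rewrite <- !app_assoc in H1. apply IHt1 in H1 as [-> H1].
    apply IHt2 in H1 as [-> ->]. auto.
Qed.

Lemma enc_inj t u : enc t = enc u -> t = u.
Proof.
  intros H. destruct (enc_inj_app t u [] []); auto. now rewrite H.
Qed.

(** * Programs over four stacks of bits *)

Inductive trk := tA | tB | tC | tD.

Record stk := mk { sA : list bool; sB : list bool; sC : list bool; sD : list bool }.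

Definition get (i : trk) (s : stk) : list bool :=
  match i with tA => sA s | tB => sB s | tC => sC s | tD => sD s end.

Definition set (i : trk) (l : list bool) (s : stk) : stk :=
  match s with mk a b c d =>
    match i with
    | tA => mk l b c d | tB => mk a l c d | tC => mk a b l d | tD => mk a b c l
    end
  end.

Definition height (s : stk) : nat :=
  length (sA s) + length (sB s) + length (sC s) + length (sD s).

Inductive cmd : Type :=
| Skip : cmd
| Push : trk -> bool -> cmd
| Seq : cmd -> cmd -> cmd
| Pop : trk -> cmd -> cmd -> cmd -> cmd
| For : trk -> cmd -> cmd -> cmd.

(* [exec M c s t s']: [c] runs from [s] to [s'] in [t] instructions (jumps of the
   compiled code included) while the total stack height stays at most [M]. *)
Inductive exec (M : nat) : cmd -> stk -> nat -> stk -> Prop :=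
| ex_skip s : height s <= M -> exec M Skip s 0 s
| ex_push i b s : height s < M -> exec M (Push i b) s 1 (set i (b :: get i s) s)
| ex_seq c d s s1 s2 t u : exec M c s t s1 -> exec M d s1 u s2 -> exec M (Seq c d) s (t + u) s2
| ex_popE i e c d s s' t : get i s = [] -> height s <= M -> exec M e s t s' ->
    exec M (Pop i e c d) s (2 + t) s'
| ex_pop0 i e c d s s' t l : get i s = false :: l -> height s <= M -> exec M c (set i l s) t s' ->
    exec M (Pop i e c d) s (2 + t) s'
| ex_pop1 i e c d s s' t l : get i s = true :: l -> height s <= M -> exec M d (set i l s) t s' ->
    exec M (Pop i e c d) s (1 + t) s'
| ex_forE i c d s : get i s = [] -> height s <= M -> exec M (For i c d) s 1 s
| ex_for0 i c d s s1 s2 t u l : get i s = false :: l -> height s <= M -> exec M c (set i l s) t s1 ->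
    exec M (For i c d) s1 u s2 -> exec M (For i c d) s (2 + t + u) s2
| ex_for1 i c d s s1 s2 t u l : get i s = true :: l -> height s <= M -> exec M d (set i l s) t s1 ->
    exec M (For i c d) s1 u s2 -> exec M (For i c d) s (2 + t + u) s2.

Lemma exec_le M M' c s t s' : exec M c s t s' -> M <= M' -> exec M' c s t s'.
Proof.
  intros H L. induction H; try (econstructor; eauto; lia).
Qed.

Lemma set_get_height i s l : height (set i l s) + length (get i s) = height s + length l.
Proof. destruct s, i; unfold height; simpl; lia. Qed.

Lemma exec_height M c s t s' : exec M c s t s' -> height s <= M /\ height s' <= M.
Proof.
  induction 1; try (split; lia); try tauto.
  pose proof (set_get_height i s (b :: get i s)). simpl in *. lia.
Qed.

(** * Compilation to jump code *)

Inductive instr : Type :=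
| IPush : trk -> bool -> instr
| IPop : trk -> nat -> nat -> nat -> instr
| IJmp : nat -> instr
| IAcc | IRej | IOut.

Fixpoint csize (c : cmd) : nat :=
  match c with
  | Skip => 0
  | Push _ _ => 1
  | Seq c d => csize c + csize d
  | Pop _ e c d => 3 + csize e + csize c + csize d
  | For _ c d => 3 + csize c + csize d
  end.

(** The last branch of [Pop] falls through to the end while the other two leave by a jump; this is
    the difference between [1 + t] and [2 + t] in [exec]. *)
Fixpoint comp (b : nat) (c : cmd) : list instr :=
  match c with
  | Skip => []
  | Push i x => [IPush i x]
  | Seq c d => comp b c ++ comp (b + csize c) d
  | Pop i e c d =>
      let a0 := b + 2 + csize e in
      let a1 := a0 + 1 + csize c in
      let z := a1 + csize d in
      IPop i (b + 1) a0 a1 :: comp (b + 1) e ++ IJmp z :: comp a0 c ++ IJmp z :: comp a1 d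
  | For i c d =>
      let a1 := b + 2 + csize c in
      let z := a1 + csize d + 1 in
      IPop i z (b + 1) a1 :: comp (b + 1) c ++ IJmp b :: comp a1 d ++ [IJmp b]
  end.

Lemma comp_length c : forall b, length (comp b c) = csize c.
Proof.
  induction c; intros ?; simpl; repeat (rewrite ?length_app; simpl);
  rewrite ?IHc1, ?IHc2, ?IHc3; simpl; lia.
Qed.

Definition istep (C : list instr) (pc : nat) (s : stk) : option (nat * stk) :=
  match nth_error C pc with
  | Some (IPush i b) => Some (S pc, set i (b :: get i s) s)
  | Some (IPop i je j0 j1) =>
      match get i s with
      | [] => Some (je, s)
      | false :: l => Some (j0, set i l s)
      | true :: l => Some (j1, set i l s)
      end
  | Some (IJmp j) => Some (j, s)
  | _ => None
  end.

(** Program counters stay within [length C], so that the machine states coding them are in range.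
    Equality is allowed because a run may end just behind the code. *)
Inductive runs (C : list instr) (M : nat) : nat -> stk -> nat -> nat -> stk -> Prop :=
| runs_0 pc s : height s <= M -> runs C M pc s 0 pc s
| runs_S pc s pc1 s1 t pc2 s2 : height s <= M -> istep C pc s = Some (pc1, s1) ->
    pc1 <= length C -> runs C M pc1 s1 t pc2 s2 -> runs C M pc s (S t) pc2 s2.

Lemma runs_trans C M pc s t pc1 s1 u pc2 s2 :
  runs C M pc s t pc1 s1 -> runs C M pc1 s1 u pc2 s2 -> runs C M pc s (t + u) pc2 s2.
Proof. intros H; revert u pc2 s2; induction H; simpl; eauto using runs_S. Qed.

Definition code_at (C : list instr) (b : nat) (c : list instr) : Prop :=
  exists pre post, C = pre ++ c ++ post /\ length pre = b.

Lemma code_at_app C b c d : code_at C b (c ++ d) ->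
  code_at C b c /\ code_at C (b + length c) d.
Proof.
  intros (pre & post & -> & <-). split.
  - exists pre, (d ++ post). now rewrite <- app_assoc.
  - exists (pre ++ c), post. rewrite length_app, <- !app_assoc. auto.
Qed.

Lemma code_at_cons C b i d : code_at C b (i :: d) ->
  nth_error C b = Some i /\ code_at C (b + 1) d.
Proof.
  intros H. apply (code_at_app C b [i] d) in H as [(pre & post & -> & <-) H].
  split; auto. rewrite nth_error_app2, Nat.sub_diag by lia. reflexivity.
Qed.

Lemma code_at_len C b c : code_at C b c -> b + length c <= length C.
Proof. intros (pre & post & -> & <-). rewrite !length_app. lia. Qed.

Lemma runs_1 C M pc s pc1 s1 : height s <= M -> height s1 <= M -> istep C pc s = Some (pc1, s1) ->
  pc1 <= length C -> runs C M pc s 1 pc1 s1.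
Proof. intros. eapply runs_S; eauto using runs_0. Qed.

Ltac splitcode :=
  repeat match goal with
  | H : code_at _ _ (_ :: _) |- _ => apply code_at_cons in H as [? ?]
  | H : code_at _ _ (_ ++ _) |- _ => apply code_at_app in H as [? ?]
  end.

Lemma runs_eq C M pc s t pc' s' t1 pc1' :
  runs C M pc s t pc' s' -> t = t1 -> pc' = pc1' -> runs C M pc s t1 pc1' s'.
Proof. intros; subst; auto. Qed.

Ltac learn_height H :=
  match type of H with exec _ _ ?s _ ?s' =>
    let A := fresh in pose proof (exec_height _ _ _ _ _ H) as A; destruct A; revert H end.

Lemma code_at_eq C b b' c : code_at C b c -> b = b' -> code_at C b' c.
Proof. intros; subst; auto. Qed.

Ltac fetch :=
  unfold istep;
  match goal with
  | H : nth_error ?C ?x = Some _ |- context [nth_error ?C ?y] =>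
      replace y with x by lia; rewrite H
  end.

(** Induction on the execution rather than on the command: the rest of a loop is again an execution
    of the same [For], at the same address. *)
Lemma comp_ok C M c s t s' : exec M c s t s' -> forall b, code_at C b (comp b c) ->
  runs C M b s t (b + csize c) s'.
Proof.
  intros H; induction H; intros b0 HC;
    pose proof (code_at_len _ _ _ HC) as HL; rewrite comp_length in HL;
    pose proof HC as HC0; simpl in HC, HL |- *; splitcode; rewrite ?comp_length in *;
    repeat match goal with H : exec _ _ _ _ _ |- _ => learn_height H end; intros.
  - eapply runs_eq. apply runs_0; auto. all: lia.
  - eapply runs_eq.
    + eapply runs_1; [lia| |fetch; reflexivity|lia].
      pose proof (set_get_height i s (b :: get i s)). simpl in *. lia.
    + lia.
    + lia.
  - eapply runs_eq. eapply runs_trans. apply IHexec1; eauto. apply IHexec2; eauto. all: lia.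
  - eapply runs_eq.
    + eapply runs_S; [lia|fetch; rewrite H; reflexivity|lia|].
      eapply runs_trans. apply IHexec; eauto.
      eapply runs_1; [lia|lia|fetch; reflexivity|lia].
    + lia.
    + lia.
  - eapply runs_eq.
    + eapply runs_S; [lia|fetch; rewrite H; reflexivity|lia|].
      eapply runs_trans. apply IHexec. eapply code_at_eq; [eassumption|lia].
      eapply runs_1; [lia|lia|fetch; reflexivity|lia].
    + lia.
    + lia.
  - eapply runs_eq.
    + eapply runs_S; [lia|fetch; rewrite H; reflexivity|lia|].
      apply IHexec. eapply code_at_eq; [eassumption|lia].
    + lia.
    + lia.
  - eapply runs_eq.
    + eapply runs_1; [lia|lia|fetch; rewrite H; reflexivity|lia].
    + lia.
    + lia.
  - eapply runs_eq.
    + eapply runs_S; [lia|fetch; rewrite H; reflexivity|lia|].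
      eapply runs_trans. apply IHexec1. eapply code_at_eq; [eassumption|lia].
      eapply runs_S; [lia|fetch; reflexivity|lia|].
      apply IHexec2; eauto.
    + lia.
    + simpl. lia.
  - eapply runs_eq.
    + eapply runs_S; [lia|fetch; rewrite H; reflexivity|lia|].
      eapply runs_trans. apply IHexec1. eapply code_at_eq; [eassumption|lia].
      eapply runs_S; [lia|fetch; reflexivity|lia|].
      apply IHexec2; eauto.
    + lia.
    + simpl. lia.
Qed.

(** * Four tracks in one tape symbol *)

Definition dig (o : option bool) : nat :=
  match o with None => 0 | Some false => 1 | Some true => 2 end.

(* Track B is the least significant digit, so the raw input symbols 1 and 2 read as
   a bit on track B and blank on the other tracks. *)
Definition sym (f : bool) (b a c d : option bool) : nat :=
  dig b + 3 * dig a + 9 * dig c + 27 * dig d + 81 * (if f then 1 else 0).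

Definition weight (i : trk) : nat := match i with tB => 1 | tA => 3 | tC => 9 | tD => 27 end.

Definition getd (i : trk) (x : nat) : nat := (x / weight i) mod 3.
Definition setd (i : trk) (v x : nat) : nat := x - weight i * getd i x + weight i * v.

(** The bottom of a stack lies at cell 0, so a push or pop changes a single cell and shifts
    nothing. *)
Definition cell_bit (l : list bool) (j : nat) : option bool := nth_error (rev l) j.

(** Cell 0 alone carries the flag, by which the head recognizes the left end. *)
Definition cell (s : stk) (j : nat) : nat :=
  sym (j =? 0) (cell_bit (sB s) j) (cell_bit (sA s) j) (cell_bit (sC s) j) (cell_bit (sD s) j).

Lemma getd_sym f b a c d i : getd i (sym f b a c d) =
  dig (match i with tA => a | tB => b | tC => c | tD => d end).
Proof.
  destruct f, b as [[]|], a as [[]|], c as [[]|], d as [[]|], i; reflexivity.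
Qed.

Lemma setd_sym f b a c d i v : setd i (dig v) (sym f b a c d) =
  match i with
  | tA => sym f b v c d | tB => sym f v a c d | tC => sym f b a v d | tD => sym f b a c v
  end.
Proof.
  unfold setd. rewrite getd_sym.
  destruct i; unfold sym, weight; lia.
Qed.

Lemma flag_sym f b a c d : (81 <=? sym f b a c d) = f.
Proof. destruct f, b as [[]|], a as [[]|], c as [[]|], d as [[]|]; reflexivity. Qed.

Lemma sym_lt f b a c d : sym f b a c d < 162.
Proof.
  destruct f, b as [[]|], a as [[]|], c as [[]|], d as [[]|]; unfold sym, dig; lia.
Qed.

Lemma getd_cell i s j : getd i (cell s j) = dig (cell_bit (get i s) j).
Proof. unfold cell. rewrite getd_sym. destruct i; reflexivity. Qed.

Lemma cell_bit_cons b l j : cell_bit (b :: l) j = if j =? length l then Some b else cell_bit l j.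
Proof.
  unfold cell_bit. simpl. destruct (Nat.eqb_spec j (length l)) as [->|Hn].
  - rewrite nth_error_app2; rewrite length_rev; [|lia]. now rewrite Nat.sub_diag.
  - destruct (Nat.lt_ge_cases j (length l)).
    + rewrite nth_error_app1; auto. now rewrite length_rev.
    + rewrite nth_error_app2; rewrite length_rev; [|lia].
      replace (nth_error (rev l) j) with (@None bool)
        by (symmetry; apply nth_error_None; rewrite length_rev; lia).
      destruct (j - length l) eqn:E; [lia|]. simpl. destruct n; auto.
Qed.

Lemma cell_bit_None l j : length l <= j -> cell_bit l j = None.
Proof. intros. apply nth_error_None. rewrite length_rev; lia. Qed.

Lemma cell_bit_Some l j : j < length l -> exists b, cell_bit l j = Some b.
Proof.
  intros. unfold cell_bit. destruct (nth_error (rev l) j) eqn:E; eauto.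
  apply nth_error_None in E. rewrite length_rev in E. lia.
Qed.

Definition upd (f : nat -> nat) (h b : nat) : nat -> nat := fun j => if j =? h then b else f j.

Lemma upd_push i b s : forall j,
  upd (cell s) (length (get i s)) (setd i (S (Nat.b2n b)) (cell s (length (get i s)))) j
  = cell (set i (b :: get i s) s) j.
Proof.
  intros j. unfold upd. replace (S (Nat.b2n b)) with (dig (Some b)) by (destruct b; auto).
  destruct s as [a1 b1 c1 d1], i; unfold cell; rewrite setd_sym; cbn [get set sA sB sC sD]; rewrite cell_bit_cons;
  match goal with |- context [j =? ?n] => destruct (Nat.eqb_spec j n) end; subst; auto.
Qed.

Lemma upd_pop i b l s : get i s = b :: l -> forall j,
  upd (cell s) (length l) (setd i 0 (cell s (length l))) j = cell (set i l s) j.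
Proof.
  intros E j. unfold upd. change 0 with (dig None) at 1.
  destruct s as [a1 b1 c1 d1], i; simpl in E; subst; unfold cell; rewrite setd_sym; cbn [get set sA sB sC sD];
  rewrite ?cell_bit_cons;
  match goal with |- context [j =? ?n] => destruct (Nat.eqb_spec j n) end; subst; auto;
  rewrite (cell_bit_None l) by lia; auto.
Qed.

(** * Simulation by a one-tape machine *)

(** States 0 and 1 accept and reject, 2 sets the flag of cell 0, and 3 writes track B out as plain
    symbols. The others come in threes per instruction: run right to the end of a stack, erase its
    top, return to cell 0. *)
Definition qseek (pc : nat) := 4 + 3 * pc.
Definition qact (pc : nat) := 5 + 3 * pc.
Definition qret (pc : nat) := 6 + 3 * pc.

Definition delta0 (C : list instr) (q a : nat) : nat * nat * move :=
  if q <? 2 then (q, a, MoveS) else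
  if q =? 2 then (qseek 0, a + 81, MoveS) else
  if q =? 3 then match getd tB a with 0 => (0, 0, MoveS) | d => (3, d, MoveR) end else
  let pc := (q - 4) / 3 in
  match (q - 4) mod 3 with
  | 0 =>
    match nth_error C pc with
    | Some (IPush i b) =>
        if getd i a =? 0 then (qret (S pc), setd i (S (Nat.b2n b)) a, MoveS) else (q, a, MoveR)
    | Some (IPop i je j0 j1) =>
        if getd i a =? 0 then
          if 81 <=? a then (qseek je, a, MoveS) else (qact pc, a, MoveL)
        else (q, a, MoveR)
    | Some (IJmp j) => (qseek j, a, MoveS)
    | Some IAcc => (0, a, MoveS)
    | Some IRej => (1, a, MoveS)
    | Some IOut => (3, a, MoveS)
    | None => (1, a, MoveS)
    end
  | 1 =>
    match nth_error C pc with
    | Some (IPop i je j0 j1) =>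
        (qret (if getd i a =? 1 then j0 else j1), setd i 0 a, MoveS)
    | _ => (1, a, MoveS)
    end
  | _ => if 81 <=? a then (qseek pc, a, MoveS) else (q, a, MoveL)
  end.

(* Clamping makes the machine well formed for free; it never triggers on actual runs. *)
Definition mdelta (C : list instr) (q a : nat) : nat * nat * move :=
  let '(q', b, mv) := delta0 C q a in
  (if q' <? 7 + 3 * length C then q' else 1, if b <? 162 then b else 0, mv).

Definition mach (C : list instr) : TM := mkTM (7 + 3 * length C) 162 2 0 1 (mdelta C).

Lemma mach_wf C : wf_TM (mach C).
Proof.
  unfold wf_TM; simpl; repeat split; try lia.
  intros q a Hq Ha. unfold mdelta. destruct (delta0 C q a) as [[q' b] mv].
  destruct (Nat.ltb_spec q' (7 + 3 * length C)), (Nat.ltb_spec b 162); lia.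
Qed.

Lemma q_split pc r : r < 3 -> (3 * pc + r) / 3 = pc /\ (3 * pc + r) mod 3 = r.
Proof.
  intros H. split.
  - symmetry. apply (Nat.div_unique _ 3 pc r); lia.
  - symmetry. apply (Nat.mod_unique _ 3 pc r); lia.
Qed.

Lemma delta_seek C pc a : delta0 C (qseek pc) a =
    match nth_error C pc with
    | Some (IPush i b) =>
        if getd i a =? 0 then (qret (S pc), setd i (S (Nat.b2n b)) a, MoveS) else (qseek pc, a, MoveR)
    | Some (IPop i je j0 j1) =>
        if getd i a =? 0 then
          if 81 <=? a then (qseek je, a, MoveS) else (qact pc, a, MoveL)
        else (qseek pc, a, MoveR)
    | Some (IJmp j) => (qseek j, a, MoveS)
    | Some IAcc => (0, a, MoveS)
    | Some IRej => (1, a, MoveS)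
    | Some IOut => (3, a, MoveS)
    | None => (1, a, MoveS)
    end.
Proof.
  unfold delta0. replace (qseek pc <? 2) with false by reflexivity.
  replace (qseek pc =? 2) with false by reflexivity.
  replace (qseek pc =? 3) with false by reflexivity. cbv zeta.
  replace (qseek pc - 4) with (3 * pc + 0) by (unfold qseek; lia).
  destruct (q_split pc 0 ltac:(lia)) as [-> ->]. reflexivity.
Qed.

Lemma delta_act C pc a : delta0 C (qact pc) a =
    match nth_error C pc with
    | Some (IPop i je j0 j1) =>
        (qret (if getd i a =? 1 then j0 else j1), setd i 0 a, MoveS)
    | _ => (1, a, MoveS)
    end.
Proof.
  unfold delta0. replace (qact pc <? 2) with false by reflexivity.
  replace (qact pc =? 2) with false by reflexivity.
  replace (qact pc =? 3) with false by reflexivity. cbv zeta.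
  replace (qact pc - 4) with (3 * pc + 1) by (unfold qact; lia).
  destruct (q_split pc 1 ltac:(lia)) as [-> ->]. reflexivity.
Qed.

Lemma delta_ret C pc a : delta0 C (qret pc) a =
    if 81 <=? a then (qseek pc, a, MoveS) else (qret pc, a, MoveL).
Proof.
  unfold delta0. replace (qret pc <? 2) with false by reflexivity.
  replace (qret pc =? 2) with false by reflexivity.
  replace (qret pc =? 3) with false by reflexivity. cbv zeta.
  replace (qret pc - 4) with (3 * pc + 2) by (unfold qret; lia).
  destruct (q_split pc 2 ltac:(lia)) as [-> ->]. reflexivity.
Qed.

Definition rep (c : config) (q h : nat) (f : nat -> nat) : Prop :=
  cf_state c = q /\ length (cf_left c) = h /\
  forall j, nth j (rev (cf_left c) ++ cf_right c) 0 = f j.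

Definition sp (c : config) : nat := length (cf_left c) + length (cf_right c).

Lemma rep_ext c q h f g : rep c q h f -> (forall j, f j = g j) -> rep c q h g.
Proof. intros (? & ? & H) E. repeat split; auto. intros j. now rewrite <- E. Qed.

Definition mvh (mv : move) (h : nat) : nat :=
  match mv with MoveL => h - 1 | MoveR => S h | MoveS => h end.

(** Stated for an arbitrary machine, since the hardness proof describes the steps of the given
    machine in the same terms. *)
Lemma step_gen Mc c q h f q' b mv : rep c q h f -> q <> tm_accept Mc -> q <> tm_reject Mc ->
  tm_delta Mc q (f h) = (q', b, mv) ->
  rep (step Mc c) q' (mvh mv h) (upd f h b) /\ sp (step Mc c) <= Nat.max (sp c) (S h).
Proof.
  intros (<- & <- & Hf) Ha Hr Hd.
  assert (Ea : hd 0 (cf_right c) = f (length (cf_left c))).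
  { rewrite <- Hf, app_nth2; rewrite length_rev; [|lia]. rewrite Nat.sub_diag.
    now destruct (cf_right c). }
  unfold step. destruct (Nat.eqb_spec (cf_state c) (tm_accept Mc)) as [E|_]; [tauto|].
  destruct (Nat.eqb_spec (cf_state c) (tm_reject Mc)) as [E|_]; [tauto|].
  simpl (_ || _). cbv iota zeta. rewrite Ea, Hd.
  assert (U : forall j, nth j (rev (cf_left c) ++ b :: tl (cf_right c)) 0 = upd f (length (cf_left c)) b j).
  { intros j. unfold upd. destruct (Nat.eqb_spec j (length (cf_left c))) as [->|Hn].
    - rewrite app_nth2; rewrite length_rev; [|lia]. now rewrite Nat.sub_diag.
    - rewrite <- Hf. destruct (Nat.lt_ge_cases j (length (cf_left c))).
      + rewrite !app_nth1; auto; now rewrite length_rev.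
      + rewrite !app_nth2; rewrite ?length_rev; try lia.
        destruct (j - length (cf_left c)) eqn:E; [lia|]. simpl.
        destruct (cf_right c); simpl; destruct n; auto. }
  unfold rep, sp. destruct c as [q l r]; simpl in *.
  destruct mv; simpl.
  - destruct l as [|x l]; simpl in *.
    + repeat split; auto. destruct r; simpl; lia.
    + repeat split; try lia.
      * intros j. rewrite <- U, <- !app_assoc. reflexivity.
      * destruct r; simpl; lia.
  - repeat split; auto.
    + intros j. rewrite <- U, <- !app_assoc. reflexivity.
    + destruct r; simpl; lia.
  - repeat split; auto. destruct r; simpl; lia.
Qed.

Lemma step_rep C c q h f q' b mv : rep c q h f -> 2 <= q ->
  delta0 C q (f h) = (q', b, mv) -> q' < 7 + 3 * length C -> b < 162 ->
  rep (step (mach C) c) q' (mvh mv h) (upd f h b) /\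
  sp (step (mach C) c) <= Nat.max (sp c) (S h).
Proof.
  intros Hr Hq Hd Hq' Hb. eapply step_gen; eauto; try (simpl; lia).
  cbn [tm_delta mach]. unfold mdelta. rewrite Hd.
  destruct (Nat.ltb_spec q' (7 + 3 * length C)); [|lia].
  destruct (Nat.ltb_spec b 162); [auto|lia].
Qed.

Inductive tr (Mc : TM) (K : nat) : config -> nat -> config -> Prop :=
| tr_0 c : sp c <= K -> tr Mc K c 0 c
| tr_S c t c' : sp c <= K -> tr Mc K (step Mc c) t c' -> tr Mc K c (S t) c'.

Lemma tr_trans Mc K c t c1 u c2 : tr Mc K c t c1 -> tr Mc K c1 u c2 -> tr Mc K c (t + u) c2.
Proof. induction 1; simpl; eauto using tr. Qed.

Lemma tr_run Mc K c t c' : tr Mc K c t c' ->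
  run Mc c t = c' /\ forall j, j <= t -> cfg_space (run Mc c j) <= K + 1.
Proof.
  unfold run. induction 1 as [c H|c t c' H H0 [IH1 IH2]].
  - split; auto. intros j Hj. replace j with 0 by lia. simpl. unfold cfg_space, sp in *. lia.
  - split. now rewrite Nat.iter_succ_r.
    intros [|j] Hj. simpl. unfold cfg_space, sp in *. lia.
    rewrite Nat.iter_succ_r. apply IH2. lia.
Qed.

Lemma tr_step C K c q h f q' b mv : rep c q h f -> 2 <= q -> sp c <= K -> S h <= K ->
  delta0 C q (f h) = (q', b, mv) -> q' < 7 + 3 * length C -> b < 162 ->
  exists c', tr (mach C) K c 1 c' /\ rep c' q' (mvh mv h) (upd f h b) /\ sp c' <= K.
Proof.
  intros. destruct (step_rep C c q h f q' b mv) as [Hr Hs]; auto.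
  exists (step (mach C) c). split; [|split; auto; lia].
  apply tr_S; auto. apply tr_0. lia.
Qed.

Lemma upd_same f h j : upd f h (f h) j = f j.
Proof. unfold upd. destruct (Nat.eqb_spec j h); subst; auto. Qed.

Lemma cell_lt s j : cell s j < 162.
Proof. apply sym_lt. Qed.

Lemma setd_lt i v s j : v < 3 -> setd i v (cell s j) < 162.
Proof.
  intros H. assert (exists o, v = dig o) as [o ->].
  { destruct v as [|[|[|]]]; [exists None|exists (Some false)|exists (Some true)|]; auto; lia. }
  unfold cell. rewrite setd_sym. destruct i; apply sym_lt.
Qed.

Lemma seek_right C K pc i s : pc <= length C ->
  (match nth_error C pc with Some (IPush i' _) | Some (IPop i' _ _ _) => i' = i | _ => False end) ->
  length (get i s) + 1 <= K ->
  forall n h c, h + n = length (get i s) -> rep c (qseek pc) h (cell s) -> sp c <= K ->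
  exists c', tr (mach C) K c n c' /\ rep c' (qseek pc) (length (get i s)) (cell s) /\ sp c' <= K.
Proof.
  intros Hpc Hi HK. induction n; intros h c E Hr Hs.
  - exists c. replace (length (get i s)) with h by lia. repeat split; auto using tr_0; apply Hr.
  - destruct (tr_step C K c (qseek pc) h (cell s) (qseek pc) (cell s h) MoveR) as (c1 & T1 & R1 & S1);
      auto using cell_lt; try (unfold qseek; lia).
    { rewrite delta_seek. destruct (nth_error C pc) as [[]|]; try tauto; subst;
      rewrite getd_cell; destruct (cell_bit_Some (get i s) h) as [[] ->]; auto; lia. }
    destruct (IHn (S h) c1) as (c2 & T2 & R2 & S2); auto; try lia.
    { eapply rep_ext. exact R1. apply upd_same. }
    exists c2. split; auto. exact (tr_trans _ _ _ 1 _ _ _ T1 T2).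
Qed.

Lemma ret_left C K pc s : pc <= length C ->
  forall h c, S h <= K -> rep c (qret pc) h (cell s) -> sp c <= K ->
  exists c', tr (mach C) K c (S h) c' /\ rep c' (qseek pc) 0 (cell s) /\ sp c' <= K.
Proof.
  intros Hpc. induction h; intros c HK Hr Hs.
  - destruct (tr_step C K c (qret pc) 0 (cell s) (qseek pc) (cell s 0) MoveS) as (c1 & T1 & R1 & S1);
      auto using cell_lt; try (unfold qseek, qret; lia).
    { rewrite delta_ret. unfold cell. now rewrite flag_sym. }
    exists c1. repeat split; auto; try apply R1. intros j. destruct R1 as (_ & _ & ->). apply upd_same.
  - destruct (tr_step C K c (qret pc) (S h) (cell s) (qret pc) (cell s (S h)) MoveL) as (c1 & T1 & R1 & S1);
      auto using cell_lt; try (unfold qseek, qret; lia).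
    { rewrite delta_ret. unfold cell. now rewrite flag_sym. }
    simpl in R1. rewrite Nat.sub_0_r in R1.
    destruct (IHh c1) as (c2 & T2 & R2 & S2); auto; try lia.
    { eapply rep_ext. exact R1. apply upd_same. }
    exists c2. split; auto. exact (tr_trans _ _ _ 1 _ _ _ T1 T2).
Qed.

Lemma get_le i s : length (get i s) <= height s.
Proof. destruct i, s; unfold height; simpl; lia. Qed.

(** The head rests on cell 0 between instructions, so an instruction costs at most one sweep to the
    end of a stack and back. The extra cell in [M + 1] is the blank one above a full stack. *)
Lemma istep_sim C M K pc s pc1 s1 c : istep C pc s = Some (pc1, s1) ->
  pc1 <= length C -> height s <= M -> M + 1 <= K ->
  rep c (qseek pc) 0 (cell s) -> sp c <= K ->
  exists t c', t <= 2 * M + 3 /\ tr (mach C) K c t c' /\ rep c' (qseek pc1) 0 (cell s1) /\ sp c' <= K.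
Proof.
  unfold istep. intros E Hpc1 HM HK Hr Hs.
  destruct (nth_error C pc) as [[i b|i je j0 j1|j| | |]|] eqn:EI; try discriminate.
  - inversion E; subst; clear E. pose proof (get_le i s).
    assert (HP : pc < length C) by (apply nth_error_Some; congruence).
    destruct (seek_right C K pc i s ltac:(lia) ltac:(rewrite EI; auto) ltac:(lia)
      (length (get i s)) 0 c) as (c1 & T1 & R1 & S1); auto.
    destruct (tr_step C K c1 _ _ _ (qret (S pc)) (setd i (S (Nat.b2n b)) (cell s (length (get i s)))) MoveS R1)
      as (c2 & T2 & R2 & S2); auto; try (unfold qseek, qret; lia).
    { rewrite delta_seek, EI, getd_cell, cell_bit_None by lia. reflexivity. }
    { apply setd_lt. destruct b; simpl; lia. }
    destruct (ret_left C K (S pc) (set i (b :: get i s) s) ltac:(lia) (length (get i s)) c2)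
      as (c3 & T3 & R3 & S3); auto; try lia.
    { eapply rep_ext. exact R2. apply upd_push. }
    exists (length (get i s) + (1 + S (length (get i s)))), c3.
    repeat split; auto; try apply R3. lia.
    eapply tr_trans; eauto. eapply tr_trans; eauto.
  - pose proof (get_le i s).
    assert (HP : pc < length C) by (apply nth_error_Some; congruence).
    destruct (seek_right C K pc i s ltac:(lia) ltac:(rewrite EI; auto) ltac:(lia)
      (length (get i s)) 0 c) as (c1 & T1 & R1 & S1); auto.
    destruct (get i s) as [|b l] eqn:EG.
    + inversion E; subst; clear E.
      destruct (tr_step C K c1 _ _ _ (qseek pc1) (cell s1 0) MoveS R1)
        as (c2 & T2 & R2 & S2); auto using cell_lt; try (unfold qseek, qret; simpl; lia).
      { rewrite delta_seek, EI, getd_cell, EG, cell_bit_None by (simpl; lia). unfold cell. now rewrite flag_sym. }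
      exists (0 + 1), c2. repeat split; auto; try apply R2. lia.
      eapply tr_trans; eauto.
      intros j. destruct R2 as (_ & _ & ->). apply upd_same.
    + simpl in R1, H.
      destruct (tr_step C K c1 _ _ _ (qact pc) (cell s (S (length l))) MoveL R1)
        as (c2 & T2 & R2 & S2); auto using cell_lt; try (unfold qseek, qact; simpl; lia).
      { rewrite delta_seek, EI, getd_cell, EG, cell_bit_None by (simpl; lia). unfold cell. now rewrite flag_sym. }
      simpl in R2. rewrite Nat.sub_0_r in R2.
      assert (R2' : rep c2 (qact pc) (length l) (cell s)).
      { eapply rep_ext. exact R2. apply upd_same. }
      set (jj := if b then j1 else j0).
      assert (Ej : jj = pc1 /\ set i l s = s1) by (unfold jj; destruct b; inversion E; auto).
      destruct Ej as [Ej <-].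
      destruct (tr_step C K c2 _ _ _ (qret jj) (setd i 0 (cell s (length l))) MoveS R2')
        as (c3 & T3 & R3 & S3); auto; try (unfold qact, qret; simpl; lia).
      { rewrite delta_act, EI, getd_cell, EG, cell_bit_cons, Nat.eqb_refl. unfold jj. destruct b; reflexivity. }
      { apply setd_lt. lia. }
      subst jj. rewrite Ej in *.
      destruct (ret_left C K pc1 (set i l s) ltac:(lia) (length l) c3)
        as (c4 & T4 & R4 & S4); auto; try lia.
      { eapply rep_ext. exact R3. eapply upd_pop; eauto. }
      exists (length (b :: l) + (1 + (1 + S (length l)))), c4.
      repeat split; auto; try apply R4. simpl. lia.
      eapply tr_trans; eauto. eapply tr_trans; eauto. eapply tr_trans; eauto.
  - inversion E; subst; clear E.
    destruct (tr_step C K c _ _ _ (qseek pc1) (cell s1 0) MoveS Hr)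
      as (c2 & T2 & R2 & S2); auto using cell_lt; try (unfold qseek, qret; simpl; lia).
    { rewrite delta_seek, EI. reflexivity. }
    exists 1, c2. repeat split; auto; try apply R2. lia.
    intros j. destruct R2 as (_ & _ & ->). apply upd_same.
Qed.

Lemma runs_sim C M K pc s t pc1 s1 : runs C M pc s t pc1 s1 -> M + 1 <= K ->
  forall c, rep c (qseek pc) 0 (cell s) -> sp c <= K ->
  exists t' c', t' <= t * (2 * M + 3) /\ tr (mach C) K c t' c' /\
    rep c' (qseek pc1) 0 (cell s1) /\ sp c' <= K.
Proof.
  intros H HK; induction H as [pc s H|pc s pc1 s1 t pc2 s2 H E Hp H1 IH]; intros c Hr Hs.
  - exists 0, c. repeat split; auto using tr_0; apply Hr.
  - destruct (istep_sim C M K pc s pc1 s1 c) as (t1 & c1 & L1 & T1 & R1 & S1); auto.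
    destruct (IH c1) as (t2 & c2 & L2 & T2 & R2 & S2); auto.
    exists (t1 + t2), c2. repeat split; try apply R2; auto. simpl; lia.
    eapply tr_trans; eauto.
Qed.

(** * Input, verdict and output of compiled programs *)

Definition tbit (b : bool) : tree := if b then Nd Lf Lf else Lf.

Definition tL {A : Type} (f : A -> tree) (l : list A) : tree :=
  fold_right (fun a t => Nd (f a) t) Lf l.

Definition tbits (w : list bool) : tree := tL tbit w.

(** The raw input, seen as stack B, has its last bit on top. The list of bits is therefore built
    from its end, each round prefixing the code of the list with the code of one more element. *)
Definition load : cmd :=
  Seq (Push tA false)
    (For tB (Seq (Push tA false) (Push tA true))
            (Seq (Push tA false) (Seq (Push tA false) (Seq (Push tA true) (Push tA true))))).

Ltac height_lia := unfold height; cbn [sA sB sC sD length get set];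
  rewrite ?length_app, ?length_rev, ?enc_length; cbn [length]; try lia.

Lemma load_ok w : exists t, t <= 6 * length w + 2 /\
  exec (6 * length w + 6) load (mk [] (rev w) [] []) t (mk (enc (tbits w)) [] [] []).
Proof.
  assert (G : forall u v, exists t, t <= 6 * length u + 1 /\
    exec (sz (tbits v) + 5 * length u + 4)
      (For tB (Seq (Push tA false) (Push tA true))
            (Seq (Push tA false) (Seq (Push tA false) (Seq (Push tA true) (Push tA true)))))
      (mk (enc (tbits v)) u [] []) t (mk (enc (tbits (rev u ++ v))) [] [] [])).
  { induction u as [|[] u IH]; intros v.
    - exists 1. split. simpl; lia. apply ex_forE; auto. simpl. height_lia.
    - destruct (IH (true :: v)) as (t & L & E). exists (2 + (1 + (1 + (1 + 1))) + t). split. simpl; lia.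
      eapply ex_for1; [reflexivity|height_lia| |].
      + cbn [set get sA sB sC sD].
        repeat (eapply ex_seq; [apply ex_push; simpl; height_lia|]; cbn [set get sA sB sC sD]).
        apply ex_push; height_lia.
      + simpl rev. rewrite <- app_assoc. simpl app. eapply exec_le. exact E. simpl. lia.
    - destruct (IH (false :: v)) as (t & L & E). exists (2 + (1 + 1) + t). split. simpl; lia.
      eapply ex_for0; [reflexivity|height_lia| |].
      + cbn [set get sA sB sC sD].
        repeat (eapply ex_seq; [apply ex_push; simpl; height_lia|]; cbn [set get sA sB sC sD]).
        apply ex_push; height_lia.
      + simpl rev. rewrite <- app_assoc. simpl app. eapply exec_le. exact E. simpl. lia. }
  destruct (G (rev w) []) as (t & L & E). rewrite length_rev in *.
  exists (1 + t). split. lia. unfold load. eapply ex_seq.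
  - apply ex_push. height_lia.
  - rewrite rev_involutive, app_nil_r in E. eapply exec_le. exact E. simpl. lia.
Qed.

Lemma init_sim C K w : length w + 1 <= K ->
  exists c, tr (mach C) K (init_cfg (mach C) w) 1 c /\
    rep c (qseek 0) 0 (cell (mk [] (rev w) [] [])) /\ sp c <= K.
Proof.
  intros HK.
  set (s := mk [] (rev w) [] []).
  set (f := fun j => nth j (map sym_of_bool w) 0).
  assert (Ef : forall j, f j = dig (nth_error w j)).
  { intros j. unfold f. destruct (nth_error w j) eqn:E.
    - assert (j < length w) by (apply nth_error_Some; congruence).
      rewrite (nth_indep _ 0 (sym_of_bool false)) by (now rewrite length_map).
      rewrite map_nth, (nth_error_nth _ _ _ E). now destruct b.
    - rewrite nth_overflow; auto. rewrite length_map. now apply nth_error_None. }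
  assert (Es : forall j, cell s j = f j + 81 * (if j =? 0 then 1 else 0)).
  { intros j. unfold cell, s; simpl. unfold cell_bit at 1. rewrite rev_involutive, Ef.
    unfold cell_bit; simpl. rewrite nth_error_nil. unfold sym. simpl. lia. }
  destruct (tr_step C K (init_cfg (mach C) w) 2 0 f (qseek 0) (f 0 + 81) MoveS)
    as (c & T & R & S); auto; try (unfold qseek; simpl; lia).
  - repeat split.
  - unfold sp; simpl. rewrite length_map. lia.
  - rewrite Ef. destruct (nth_error w 0) as [[]|]; simpl; lia.
  - exists c. repeat split; auto; try apply R. intros j. destruct R as (_ & _ & ->).
    unfold upd. rewrite Es. destruct (Nat.eqb_spec j 0); subst; lia.
Qed.

Lemma prog_sim c tail M w t s : length w <= M ->
  exec M c (mk [] (rev w) [] []) t s ->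
  exists t' c', t' <= t * (2 * M + 3) + 1 /\
    tr (mach (comp 0 c ++ tail)) (M + 1) (init_cfg (mach (comp 0 c ++ tail)) w) t' c' /\
    rep c' (qseek (csize c)) 0 (cell s) /\ sp c' <= M + 1.
Proof.
  intros HM E. set (C := comp 0 c ++ tail).
  destruct (init_sim C (M + 1) w) as (c1 & T1 & R1 & S1); [lia|].
  destruct (runs_sim C M (M + 1) 0 (mk [] (rev w) [] []) t (0 + csize c) s) with (c := c1)
    as (t2 & c2 & L2 & T2 & R2 & S2); auto.
  { apply comp_ok; auto. exists [], tail. auto. }
  exists (1 + t2), c2. repeat split; try apply R2; auto. lia. eapply tr_trans; eauto.
Qed.

(** The time [t] is unrestricted: the execution is finite by itself, and space depends on its height
    only. *)
Lemma in_PSPACE_intro L c P : poly_bounded P ->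
  (forall w, exists y t, exec (P (length w)) c (mk (enc (tbits w)) [] [] []) t (mk (enc y) [] [] [])
     /\ (y <> Lf <-> L w)) -> in_PSPACE L.
Proof.
  intros HP H.
  set (m := csize (Seq load c)).
  (* The codes of [Lf] and of a node differ in their first bit, so one [Pop] decides. *)
  set (tail := [IPop tA (m + 1) (m + 1) (m + 2); IRej; IAcc]).
  set (C := comp 0 (Seq load c) ++ tail).
  destruct (pb_add _ _ HP (pb_add _ _ (pb_mul _ _ (pb_const 6) pb_id) (pb_const 8))) as (a & k & Hb).
  exists (mach C), a, k. split. apply mach_wf. intros w.
  destruct (H w) as (y & t & E & Hy). destruct (load_ok w) as (t0 & L0 & E0).
  set (M := P (length w) + 6 * length w + 6).
  destruct (prog_sim (Seq load c) tail M w (t0 + t) (mk (enc y) [] [] [])) as (t1 & c1 & L1 & T1 & R1 & S1).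
  { lia. }
  { eapply ex_seq; eapply exec_le; eauto; lia. }
  fold C in T1. fold m in R1.
  assert (HC : length C = m + 3).
  { unfold C. rewrite length_app, comp_length. reflexivity. }
  assert (HN : forall j, nth_error C (m + j) = nth_error tail j).
  { intros j. unfold C. rewrite nth_error_app2; rewrite comp_length; [|lia]. f_equal. lia. }
  pose proof (exec_height _ _ _ _ _ E) as [_ HS]. unfold height in HS; simpl in HS. rewrite enc_length in HS.
  assert (exists b l, enc y = b :: l /\ (b = true <-> y <> Lf)) as (b & l & Ey & Hby).
  { destruct y; simpl; eexists _, _; split; eauto; split; congruence. }
  rewrite Ey in R1.
  destruct (istep_sim C M (M + 1) m (mk (b :: l) [] [] []) (if b then m + 2 else m + 1) (mk l [] [] []) c1)
    as (t2 & c2 & L2 & T2 & R2 & S2); auto.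
  { unfold istep. replace m with (m + 0) at 1 by lia. rewrite HN. simpl. destruct b; auto. }
  { destruct b; lia. }
  { rewrite <- Ey. unfold height; simpl. rewrite enc_length. lia. }
  destruct (tr_step C (M + 1) c2 _ _ _ (if b then 0 else 1) (cell (mk l [] [] []) 0) MoveS R2)
    as (c3 & T3 & R3 & S3); auto using cell_lt; try (unfold qseek; destruct b; simpl; lia).
  { rewrite delta_seek. destruct b; rewrite HN; reflexivity. }
  pose proof (tr_trans _ _ _ _ _ _ _ T1 (tr_trans _ _ _ _ _ _ _ T2 T3)) as T.
  destruct (tr_run _ _ _ _ _ T) as [Er Hsp].
  exists (t1 + (t2 + 1)). rewrite Er. destruct R3 as (Q3 & _). repeat split.
  - unfold halted. rewrite Q3. simpl. destruct b; auto.
  - rewrite Q3. simpl. intros. apply Hy, Hby. destruct b; auto; discriminate.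
  - rewrite Q3. simpl. intros HL. apply Hy, Hby in HL. now rewrite HL.
  - intros j Hj. specialize (Hsp j Hj). specialize (Hb (length w)). unfold M in *. lia.
Qed.

Lemma bits_prefix_nth w : forall l, (forall j, j < length w -> nth j l 0 = sym_of_bool (nth j w false)) ->
  nth (length w) l 0 = 0 -> bits_prefix l = w.
Proof.
  induction w as [|b w IH]; intros l H H0; simpl in *.
  - destruct l as [|[] l]; simpl in *; auto; discriminate.
  - destruct l as [|a l].
    + specialize (H 0 ltac:(lia)). destruct b; simpl in H; discriminate.
    + rewrite <- (IH l); auto.
      * specialize (H 0 ltac:(lia)). simpl in H. subst. destruct b; reflexivity.
      * intros j Hj. apply (H (S j)). lia.
Qed.

Lemma out_sim C K u : length u + 2 <= K ->
  forall n h c, h + n = length u ->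
  rep c 3 h (fun j => if j <? h then sym_of_bool (nth j u false) else cell (mk [] (rev u) [] []) j) ->
  sp c <= K ->
  exists t c', t = n + 1 /\ tr (mach C) K c t c' /\ cf_state c' = 0 /\ tape_output c' = u.
Proof.
  intros HK. induction n; intros h c E Hr Hs.
  - destruct (tr_step C K c 3 h _ 0 0 MoveS Hr) as (c1 & T1 & R1 & S1); auto; try lia.
    { rewrite Nat.ltb_irrefl. unfold delta0. simpl. rewrite getd_cell. simpl.
      rewrite cell_bit_None by (rewrite length_rev; lia). reflexivity. }
    exists 1, c1. repeat split; auto. apply R1.
    unfold tape_output. destruct R1 as (_ & _ & R1). apply bits_prefix_nth.
    + intros j Hj. rewrite R1. unfold upd. destruct (Nat.eqb_spec j h); [lia|].
      destruct (Nat.ltb_spec j h); [auto|lia].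
    + rewrite R1. unfold upd. replace (length u) with h by lia. now rewrite Nat.eqb_refl.
  - set (b := nth h u false).
    destruct (tr_step C K c 3 h _ 3 (sym_of_bool b) MoveR Hr) as (c1 & T1 & R1 & S1);
      auto; try lia.
    { rewrite Nat.ltb_irrefl. unfold delta0. simpl. rewrite getd_cell. simpl.
      unfold cell_bit. rewrite rev_involutive, (nth_error_nth' u false) by lia. fold b.
      destruct b; reflexivity. }
    { destruct b; simpl; lia. }
    destruct (IHn (S h) c1) as (t & c2 & -> & T2 & R2); auto; try lia.
    { eapply rep_ext. exact R1. intros j. unfold upd. destruct (Nat.eqb_spec j h) as [->|Hn].
      - destruct (Nat.ltb_spec h (S h)); [auto|lia].
      - destruct (Nat.ltb_spec j h), (Nat.ltb_spec j (S h)); auto; lia. }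
    exists (S n + 1), c2. split; auto. split; auto.
    exact (tr_trans _ _ _ 1 _ _ _ T1 T2).
Qed.

(** The first [true] restores the outermost opening parenthesis, which tree codes leave out.
    Transferring A to B bit by bit then lays the code out in reading order from the left end of
    track B. *)
Definition outc : cmd := Seq (Push tB true) (For tA (Push tB false) (Push tB true)).

Lemma outc_ok u : exists t, t <= 3 * length u + 2 /\
  exec (length u + 1) outc (mk u [] [] []) t (mk [] (rev (true :: u)) [] []).
Proof.
  assert (G : forall u v, exists t, t <= 3 * length u + 1 /\
    exec (length u + length v) (For tA (Push tB false) (Push tB true)) (mk u v [] []) t
      (mk [] (rev u ++ v) [] [])).
  { clear u. induction u as [|b u IH]; intros v.
    - exists 1. split. simpl; lia. apply ex_forE; auto. height_lia.
    - destruct (IH (b :: v)) as (t & L & E). exists (2 + 1 + t). split. simpl; lia.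
      simpl rev. rewrite <- app_assoc.
      destruct b.
      + eapply ex_for1; [reflexivity|height_lia| |].
        * apply ex_push; height_lia.
        * eapply exec_le; [exact E|simpl; lia].
      + eapply ex_for0; [reflexivity|height_lia| |].
        * apply ex_push; height_lia.
        * eapply exec_le; [exact E|simpl; lia]. }
  destruct (G u [true]) as (t & L & E). exists (1 + t). split. lia.
  eapply ex_seq. apply ex_push. height_lia. simpl. eapply exec_le. exact E. simpl; lia.
Qed.

Lemma poly_time_intro f c P : poly_bounded P ->
  (forall w, exists t, t <= P (length w) /\
     exec (P (length w)) c (mk (enc (tbits w)) [] [] []) t (mk (enc (f (tbits w))) [] [] [])) ->
  poly_time_computable (fun w => true :: enc (f (tbits w))).
Proof.
  intros HP H.
  set (p := Seq load (Seq c outc)). set (m := csize p).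
  set (C := comp 0 p ++ [IOut]).
  assert (HB : poly_bounded (fun n => (5 * P n + 6 * n + 8) * (2 * (P n + 6 * n + 8) + 5) + 20)).
  { apply pb_add; [apply pb_mul|apply pb_const]; repeat (apply pb_add || apply pb_mul || apply pb_const || apply pb_id || exact HP). }
  destruct HB as (a & k & Hb).
  exists (mach C), a, k. split. apply mach_wf. intros w.
  destruct (H w) as (t & Lt & E). destruct (load_ok w) as (t0 & L0 & E0).
  destruct (outc_ok (enc (f (tbits w)))) as (t1 & L1 & E1).
  set (M := P (length w) + 6 * length w + 6).
  pose proof (exec_height _ _ _ _ _ E) as [_ HS]. unfold height in HS; simpl in HS. rewrite enc_length in HS.
  rewrite enc_length in L1, E1.
  destruct (prog_sim p [IOut] M w (t0 + (t + t1)) (mk [] (rev (true :: enc (f (tbits w)))) [] []))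
    as (t2 & c2 & L2 & T2 & R2 & S2).
  { lia. }
  { eapply ex_seq; [|eapply ex_seq]; eapply exec_le; eauto; lia. }
  fold C in T2. fold m in R2.
  destruct (tr_step C (M + 1) c2 _ _ _ 3 (cell (mk [] (rev (true :: enc (f (tbits w)))) [] []) 0) MoveS R2)
    as (c3 & T3 & R3 & S3); auto using cell_lt; try (unfold qseek; simpl; lia).
  { rewrite delta_seek. unfold C. rewrite nth_error_app2; rewrite comp_length; fold m; [|lia].
    rewrite Nat.sub_diag. reflexivity. }
  destruct (out_sim C (M + 1) (true :: enc (f (tbits w)))) with (n := S (sz (f (tbits w)))) (h := 0) (c := c3)
    as (t4 & c4 & -> & T4 & Q4 & O4); auto.
  { simpl. rewrite enc_length. unfold M. lia. }
  { simpl. rewrite enc_length. reflexivity. }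
  { eapply rep_ext. exact R3. intros j. simpl. apply upd_same. }
  pose proof (tr_trans _ _ _ _ _ _ _ T2 (tr_trans _ _ _ _ _ _ _ T3 T4)) as T.
  destruct (tr_run _ _ _ _ _ T) as [Er _].
  exists (t2 + (1 + (S (sz (f (tbits w))) + 1))). rewrite Er. repeat split; auto.
  - specialize (Hb (length w)).
    assert ((t0 + (t + t1)) * (2 * M + 3) <= (5 * P (length w) + 6 * length w + 8) * (2 * (P (length w) + 6 * length w + 8) + 5)).
    { apply Nat.mul_le_mono; unfold M; lia. }
    nia.
  - left. rewrite Q4. reflexivity.
Qed.

Ltac cbs := cbn [set get sA sB sC sD].
Ltac sl := unfold height; cbs; repeat rewrite ?length_app, ?length_rev, ?enc_length in *; cbn [length sz enc] in *;
  repeat rewrite ?length_app, ?length_rev, ?enc_length in *; try lia.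

(** * Moving encoded trees between stacks *)

Inductive dst := dN | dB | dD.

Definition emit (o : dst) (b : bool) : cmd :=
  match o with dN => Skip | dB => Push tB b | dD => Push tD b end.
Definition onB (o : dst) (u b : list bool) : list bool :=
  match o with dB => rev u ++ b | _ => b end.
Definition onD (o : dst) (u d : list bool) : list bool :=
  match o with dD => rev u ++ d | _ => d end.

(* Stack C counts, in unary, the trees that remain to be read off stack A. *)
Definition walk_loop (o : dst) : cmd :=
  For tC Skip (Pop tA Skip (emit o false)
    (Seq (emit o true) (Seq (Push tC true) (Push tC true)))).

Definition walk (o : dst) : cmd := Seq (Push tC true) (walk_loop o).

Lemma onB_app o u v b : onB o v (onB o u b) = onB o (u ++ v) b.
Proof. destruct o; simpl; auto. now rewrite rev_app_distr, app_assoc. Qed.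
Lemma onD_app o u v b : onD o v (onD o u b) = onD o (u ++ v) b.
Proof. destruct o; simpl; auto. now rewrite rev_app_distr, app_assoc. Qed.
Lemma on_len o u b d : length (onB o u b) + length (onD o u d) <= length u + length b + length d.
Proof. destruct o; simpl; rewrite ?length_app, ?length_rev; lia. Qed.

Lemma emit_ok o x a b c d M : length a + length b + length c + length d < M ->
  exists t, t <= 1 /\ exec M (emit o x) (mk a b c d) t (mk a (onB o [x] b) c (onD o [x] d)).
Proof.
  intros H. destruct o; simpl.
  - exists 0. split; auto. apply ex_skip. sl.
  - exists 1. split; auto. apply ex_push with (s := mk a b c d). sl.
  - exists 1. split; auto. apply ex_push with (s := mk a b c d). sl.
Qed.

(** In continuation form: an execution of the rest of the loop is extended backwards by one tree, so
    that the derivation of the loop never has to be cut. *)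
Lemma walk_loop_ok o x : forall R b K d M t s',
  exec M (walk_loop o) (mk R (onB o (enc x) b) K (onD o (enc x) d)) t s' ->
  2 * sz x + length R + length b + length K + length d + 2 <= M ->
  exists t', t' <= t + 8 * sz x /\ exec M (walk_loop o) (mk (enc x ++ R) b (true :: K) d) t' s'.
Proof.
  induction x as [|x1 IH1 x2 IH2]; intros R b K d M t s' H HM.
  - simpl in *. destruct (emit_ok o false R b K d M) as (t1 & L1 & E1). lia.
    exists (2 + (2 + t1) + t). split. lia.
    eapply ex_for1; [reflexivity|sl| |exact H].
    eapply ex_pop0; [reflexivity|sl|]. exact E1.
  - simpl in HM. cbn [enc] in *.
    pose proof (on_len o [true] b d). cbn [length] in *.
    destruct (emit_ok o true ((enc x1 ++ enc x2) ++ R) b K d M) as (t1 & L1 & E1). sl.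
    destruct (IH2 R (onB o (true :: enc x1) b) K (onD o (true :: enc x1) d) M t s') as (t2 & L2 & E2).
    { rewrite onB_app, onD_app. exact H. }
    { pose proof (on_len o (true :: enc x1) b d). sl. }
    destruct (IH1 (enc x2 ++ R) (onB o [true] b) (true :: K) (onD o [true] d) M t2 s') as (t3 & L3 & E3).
    { rewrite onB_app, onD_app. exact E2. }
    { sl. }
    exists (2 + (1 + (t1 + (1 + 1))) + t3). split. simpl; lia.
    eapply ex_for1; [reflexivity|sl| |].
    + eapply ex_pop1; [reflexivity|sl|]. cbs. eapply ex_seq. exact E1.
      eapply ex_seq; apply ex_push; sl.
    + cbs. rewrite <- app_assoc. exact E3.
Qed.

Lemma walk_ok o x R b d M : 2 * sz x + length R + length b + length d + 4 <= M ->
  exists t, t <= 8 * sz x + 2 /\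
  exec M (walk o) (mk (enc x ++ R) b [] d) t (mk R (onB o (enc x) b) [] (onD o (enc x) d)).
Proof.
  intros HM. pose proof (on_len o (enc x) b d).
  destruct (walk_loop_ok o x R b [] d M 1 (mk R (onB o (enc x) b) [] (onD o (enc x) d))) as (t & L & E).
  - apply ex_forE; auto. sl.
  - simpl. lia.
  - exists (1 + t). split. lia. eapply ex_seq; [apply ex_push; sl|exact E].
Qed.

Definition pourBA : cmd := For tB (Push tA false) (Push tA true).
Definition pourDA : cmd := For tD (Push tA false) (Push tA true).
Definition pourDB : cmd := For tD (Push tB false) (Push tB true).
Definition pourBAD : cmd :=
  For tB (Seq (Push tA false) (Push tD false)) (Seq (Push tA true) (Push tD true)).


Lemma pourBA_ok u : forall a d M, length a + length u + length d <= M ->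
  exists t, t <= 3 * length u + 1 /\ exec M pourBA (mk a u [] d) t (mk (rev u ++ a) [] [] d).
Proof.
  induction u as [|x u IH]; intros a d M HM.
  - exists 1. split. simpl; lia. apply ex_forE; auto. sl.
  - destruct (IH (x :: a) d M) as (t & L & E). simpl in *; lia.
    exists (2 + 1 + t). split. simpl; lia. simpl rev. rewrite <- app_assoc.
    destruct x; [eapply ex_for1|eapply ex_for0]; try reflexivity; try exact E; try (apply ex_push); sl.
Qed.

Lemma pourDA_ok u : forall a b M, length a + length u + length b <= M ->
  exists t, t <= 3 * length u + 1 /\ exec M pourDA (mk a b [] u) t (mk (rev u ++ a) b [] []).
Proof.
  induction u as [|x u IH]; intros a d M HM.
  - exists 1. split. simpl; lia. apply ex_forE; auto. sl.
  - destruct (IH (x :: a) d M) as (t & L & E). simpl in *; lia.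
    exists (2 + 1 + t). split. simpl; lia. simpl rev. rewrite <- app_assoc.
    destruct x; [eapply ex_for1|eapply ex_for0]; try reflexivity; try exact E; try (apply ex_push); sl.
Qed.

Lemma pourDB_ok u : forall a b M, length a + length u + length b <= M ->
  exists t, t <= 3 * length u + 1 /\ exec M pourDB (mk a b [] u) t (mk a (rev u ++ b) [] []).
Proof.
  induction u as [|x u IH]; intros a b M HM.
  - exists 1. split. simpl; lia. apply ex_forE; auto. sl.
  - destruct (IH a (x :: b) M) as (t & L & E). simpl in *; lia.
    exists (2 + 1 + t). split. simpl; lia. simpl rev. rewrite <- app_assoc.
    destruct x; [eapply ex_for1|eapply ex_for0]; try reflexivity; try exact E; try (apply ex_push); sl.
Qed.

Lemma pourBAD_ok u : forall a d M, length a + 2 * length u + length d <= M ->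
  exists t, t <= 4 * length u + 1 /\ exec M pourBAD (mk a u [] d) t (mk (rev u ++ a) [] [] (rev u ++ d)).
Proof.
  induction u as [|x u IH]; intros a d M HM.
  - exists 1. split. simpl; lia. apply ex_forE; auto. sl.
  - destruct (IH (x :: a) (x :: d) M) as (t & L & E). simpl in *; lia.
    exists (2 + (1 + 1) + t). split. simpl; lia. simpl rev. rewrite <- !app_assoc.
    destruct x; [eapply ex_for1|eapply ex_for0]; try reflexivity; try exact E; try sl;
    (eapply ex_seq; apply ex_push; sl).
Qed.

Definition dup : cmd := Seq (walk dB) (Seq pourBAD (Seq pourDB pourBA)).
Definition swap : cmd := Seq (walk dB) (Seq (walk dD) (Seq pourBA pourDA)).
Definition drop : cmd := walk dN.

Lemma drop_ok x R M : 2 * sz x + length R + 4 <= M ->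
  exists t, t <= 8 * sz x + 2 /\ exec M drop (mk (enc x ++ R) [] [] []) t (mk R [] [] []).
Proof. intros. apply (walk_ok dN x R [] [] M). simpl; lia. Qed.

Lemma dup_ok x R M : 4 * sz x + length R + 4 <= M ->
  exists t, t <= 20 * sz x + 8 /\
  exec M dup (mk (enc x ++ R) [] [] []) t (mk (enc x ++ enc x ++ R) [] [] []).
Proof.
  intros HM.
  destruct (walk_ok dB x R [] [] M) as (t1 & L1 & E1). simpl; lia.
  destruct (pourBAD_ok (rev (enc x)) R [] M) as (t2 & L2 & E2). sl.
  destruct (pourDB_ok (enc x) (enc x ++ R) [] M) as (t3 & L3 & E3). sl.
  destruct (pourBA_ok (rev (enc x)) (enc x ++ R) [] M) as (t4 & L4 & E4). sl.
  exists (t1 + (t2 + (t3 + t4))). split. sl.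
  simpl in E1. rewrite !rev_involutive, ?app_nil_r in *.
  eapply ex_seq; eauto. eapply ex_seq; eauto. eapply ex_seq; eauto.
Qed.

Lemma swap_ok x y R M : 2 * sz x + 2 * sz y + length R + 4 <= M ->
  exists t, t <= 11 * (sz x + sz y) + 8 /\
  exec M swap (mk (enc x ++ enc y ++ R) [] [] []) t (mk (enc y ++ enc x ++ R) [] [] []).
Proof.
  intros HM.
  destruct (walk_ok dB x (enc y ++ R) [] [] M) as (t1 & L1 & E1). sl.
  destruct (walk_ok dD y R (rev (enc x)) [] M) as (t2 & L2 & E2). sl.
  destruct (pourBA_ok (rev (enc x)) R (rev (enc y)) M) as (t3 & L3 & E3). sl.
  destruct (pourDA_ok (rev (enc y)) (enc x ++ R) [] M) as (t4 & L4 & E4). sl.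
  exists (t1 + (t2 + (t3 + t4))). split. sl.
  simpl in E1, E2. rewrite !rev_involutive, ?app_nil_r in *.
  eapply ex_seq; eauto. eapply ex_seq; eauto. eapply ex_seq; eauto.
Qed.

(** * Computing functions on trees *)

(** The quantified rest [R] of stack A acts as a frame: programs run above saved intermediate
    results, whose length is added to the height [M]. *)
Definition computes (c : cmd) (x y : tree) (T M : nat) : Prop :=
  forall R, exists t, t <= T /\
  exec (M + length R) c (mk (enc x ++ R) [] [] []) t (mk (enc y ++ R) [] [] []).

Lemma computes_le c x y T M T' M' : computes c x y T M -> T <= T' -> M <= M' -> computes c x y T' M'.
Proof.
  intros H ? ? R. destruct (H R) as (t & L & E). exists t. split. lia.
  eapply exec_le. exact E. lia.
Qed.

Lemma computes_sz c x y T M : computes c x y T M -> sz x <= M /\ sz y <= M.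
Proof.
  intros H. destruct (H []) as (t & _ & E). apply exec_height in E as [E1 E2].
  unfold height in *; simpl in *. rewrite app_nil_r, enc_length in *. lia.
Qed.

Lemma computes_id x : computes Skip x x 0 (sz x).
Proof. intros R. exists 0. split; auto. apply ex_skip. sl. Qed.

Lemma computes_seq c d x y z T M T' M' : computes c x y T M -> computes d y z T' M' ->
  computes (Seq c d) x z (T + T') (M + M').
Proof.
  intros H1 H2 R. destruct (H1 R) as (t & L & E). destruct (H2 R) as (u & L' & E').
  exists (t + u). split. lia. eapply ex_seq; eapply exec_le; eauto; lia.
Qed.

Definition nilc : cmd := Seq drop (Push tA false).

Lemma computes_nil x : computes nilc x Lf (8 * sz x + 3) (2 * sz x + 4).
Proof.
  intros R. destruct (drop_ok x R (2 * sz x + 4 + length R)) as (t & L & E). lia.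
  exists (t + 1). split. lia. eapply ex_seq. exact E. apply ex_push. sl.
Qed.

Definition hd' (t : tree) := match t with Lf => Lf | Nd a _ => a end.
Definition tl' (t : tree) := match t with Lf => Lf | Nd _ b => b end.

Definition hdc : cmd := Pop tA Skip (Push tA false) (Seq (walk dB) (Seq drop pourBA)).
Definition tlc : cmd := Pop tA Skip (Push tA false) drop.

Lemma computes_hd x : computes hdc x (hd' x) (12 * sz x + 10) (2 * sz x + 6).
Proof.
  intros R. destruct x as [|a b].
  - exists (2 + 1). split. lia. eapply ex_pop0; [reflexivity|sl|]. apply ex_push. sl.
  - set (M := 2 * sz (Nd a b) + 6 + length R).
    destruct (walk_ok dB a (enc b ++ R) [] [] M) as (t1 & L1 & E1). unfold M; sl.
    destruct (walk_ok dN b R (rev (enc a)) [] M) as (t2 & L2 & E2). unfold M; sl.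
    destruct (pourBA_ok (rev (enc a)) R [] M) as (t3 & L3 & E3). unfold M; sl.
    exists (1 + (t1 + (t2 + t3))). split. simpl sz in *. sl.
    simpl in E1, E2. rewrite !rev_involutive, ?app_nil_r in *.
    eapply ex_pop1 with (l := enc a ++ enc b ++ R); [cbs; cbn [enc app]; now rewrite <- app_assoc|unfold M; sl|].
    cbs.
    eapply ex_seq; eauto. eapply ex_seq; eauto.
Qed.

Lemma computes_tl x : computes tlc x (tl' x) (12 * sz x + 10) (2 * sz x + 6).
Proof.
  intros R. destruct x as [|a b].
  - exists (2 + 1). split. lia. eapply ex_pop0; [reflexivity|sl|]. apply ex_push. sl.
  - set (M := 2 * sz (Nd a b) + 6 + length R).
    destruct (drop_ok a (enc b ++ R) M) as (t1 & L1 & E1). unfold M; sl.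
    exists (1 + t1). split. simpl sz in *. lia.
    eapply ex_pop1 with (l := enc a ++ enc b ++ R); [cbs; cbn [enc app]; now rewrite <- app_assoc|unfold M; sl|].
    exact E1.
Qed.

(** Two adjacent codes become the code of a node by one further [true]; the swap puts them in the
    right order. *)
Definition pairc (p q : cmd) : cmd := Seq dup (Seq q (Seq swap (Seq p (Push tA true)))).

Lemma computes_pair p q x y z T1 T2 M1 M2 : computes p x y T1 M1 -> computes q x z T2 M2 ->
  computes (pairc p q) x (Nd y z) (T1 + T2 + 40 * (M1 + M2) + 20) (4 * (M1 + M2) + 8).
Proof.
  intros Hp Hq R.
  destruct (computes_sz _ _ _ _ _ Hp), (computes_sz _ _ _ _ _ Hq).
  set (M := 4 * (M1 + M2) + 8 + length R).
  destruct (dup_ok x R M) as (t1 & L1 & E1). unfold M; lia.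
  destruct (Hq (enc x ++ R)) as (t2 & L2 & E2). rewrite length_app, enc_length in E2.
  destruct (swap_ok z x R M) as (t3 & L3 & E3). unfold M; lia.
  destruct (Hp (enc z ++ R)) as (t4 & L4 & E4). rewrite length_app, enc_length in E4.
  exists (t1 + (t2 + (t3 + (t4 + 1)))). split. lia.
  eapply ex_seq. exact E1. eapply ex_seq. eapply exec_le. exact E2. unfold M; lia.
  eapply ex_seq. exact E3. eapply ex_seq. eapply exec_le. exact E4. unfold M; lia.
  change (enc (Nd y z) ++ R) with (true :: (enc y ++ enc z) ++ R). rewrite <- app_assoc.
  apply ex_push with (s := mk (enc y ++ enc z ++ R) [] [] []). unfold M. sl.
Qed.

Definition tif (c x y : tree) : tree := match c with Lf => y | Nd _ _ => x end.

Definition testc (c p q : cmd) : cmd :=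
  Seq dup (Seq c (Pop tA Skip q (Seq drop (Seq drop p)))).


Lemma test_ok c p q x y T M' R M u s' : computes c x y T M' ->
  6 * M' + 10 + length R <= M ->
  exec M (match y with Lf => q | Nd _ _ => p end) (mk (enc x ++ R) [] [] []) u s' ->
  exists t, t <= u + T + 40 * M' + 20 /\
  exec M (testc c p q) (mk (enc x ++ R) [] [] []) t s'.
Proof.
  intros Hc HM E. destruct (computes_sz _ _ _ _ _ Hc) as [Hx Hy].
  destruct (dup_ok x R M) as (t1 & L1 & E1). lia.
  destruct (Hc (enc x ++ R)) as (t2 & L2 & E2). rewrite length_app, enc_length in E2.
  destruct y as [|a b].
  - exists (t1 + (t2 + (2 + u))). split. lia.
    eapply ex_seq. exact E1. eapply ex_seq. eapply exec_le. exact E2. lia.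
    eapply ex_pop0; [reflexivity|sl|]. exact E.
  - destruct (drop_ok a (enc b ++ enc x ++ R) M) as (t3 & L3 & E3). sl.
    destruct (drop_ok b (enc x ++ R) M) as (t4 & L4 & E4). sl.
    exists (t1 + (t2 + (1 + (t3 + (t4 + u))))). split. simpl in *; lia.
    eapply ex_seq. exact E1. eapply ex_seq. eapply exec_le. exact E2. lia.
    eapply ex_pop1 with (l := enc a ++ enc b ++ enc x ++ R);
      [cbs; cbn [enc app]; now rewrite <- app_assoc|sl|].
    eapply ex_seq. exact E3. eapply ex_seq; eauto.
Qed.

Lemma computes_if c p q x y z T1 M1 T2 M2 : computes c x y T1 M1 ->
  computes (match y with Lf => q | Nd _ _ => p end) x z T2 M2 ->
  computes (testc c p q) x z (T1 + T2 + 40 * M1 + 20) (M2 + 6 * M1 + 10).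
Proof.
  intros Hc H R. destruct (H R) as (u & L & E).
  destruct (test_ok c p q x y T1 M1 R (M2 + 6 * M1 + 10 + length R) u (mk (enc z ++ R) [] [] []))
    as (t & L' & E'); auto; try lia.
  { eapply exec_le. exact E. lia. }
  exists t. split; auto. lia.
Qed.

(** A single token on stack C turns [For] into a while loop, the body putting it back when the test
    succeeds. The token is popped before test and body run, which thus find C empty, as [walk]
    requires. *)
Definition whilec (c p : cmd) : cmd :=
  Seq (Push tC true) (For tC Skip (testc c (Seq p (Push tC true)) Skip)).

Inductive loop (c p : cmd) (T M1 : nat) : tree -> nat -> tree -> Prop :=
| loop_0 x : computes c x Lf T M1 -> loop c p T M1 x 0 x
| loop_S x a b x1 k y : computes c x (Nd a b) T M1 -> computes p x x1 T M1 -> loop c p T M1 x1 k y ->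
    loop c p T M1 x (S k) y.

(** The height does not depend on the number [k] of rounds. This is what permits exponentially long
    loops in polynomial space. *)
Lemma computes_while c p T M1 x k y : loop c p T M1 x k y ->
  computes (whilec c p) x y ((k + 1) * (2 * T + 40 * M1 + 30)) (6 * M1 + 12).
Proof.
  intros H R. set (M := 6 * M1 + 12 + length R).
  assert (G : exists t, t <= k * (2 * T + 40 * M1 + 30) + T + 40 * M1 + 25 /\
    exec M (For tC Skip (testc c (Seq p (Push tC true)) Skip))
      (mk (enc x ++ R) [] [true] []) t (mk (enc y ++ R) [] [] [])).
  { induction H as [x Hc|x a b x1 k y Hc Hp H IH].
    - destruct (computes_sz _ _ _ _ _ Hc).
      destruct (test_ok c (Seq p (Push tC true)) Skip x Lf T M1 R M 0 (mk (enc x ++ R) [] [] []))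
        as (t & L & E); auto; try (unfold M; lia).
      { apply ex_skip. unfold M. sl. }
      exists (2 + t + 1). split. lia.
      eapply ex_for1; [reflexivity|unfold M; sl|exact E|]. apply ex_forE; auto. unfold M; sl.
    - destruct (computes_sz _ _ _ _ _ Hc). destruct (computes_sz _ _ _ _ _ Hp).
      destruct (Hp R) as (u & L & E).
      destruct IH as (t' & L' & E').
      destruct (test_ok c (Seq p (Push tC true)) Skip x (Nd a b) T M1 R M (u + 1) (mk (enc x1 ++ R) [] [true] []))
        as (t & L2 & E2); auto; try (unfold M; lia).
      { eapply ex_seq. eapply exec_le. exact E. unfold M; lia. apply ex_push. unfold M; sl. }
      exists (2 + t + t'). split. lia.
      eapply ex_for1; [reflexivity|unfold M; sl|exact E2|exact E']. }
  destruct G as (t & L & E). exists (1 + t). split. lia.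
  eapply ex_seq; [|exact E]. apply ex_push.
  apply exec_height in E as [E _]. unfold height in *; simpl in *. lia.
Qed.

(** * Polynomial-time functions on trees *)

Definition FP (f : tree -> tree) : Prop :=
  exists c P, poly_bounded P /\ mono P /\ forall x, computes c x (f x) (P (sz x)) (P (sz x)).

Ltac pbs := repeat first [assumption | apply pb_const | apply pb_id | apply pb_add | apply pb_mul | apply pb_comp].

Lemma mono_add f g : mono f -> mono g -> mono (fun n => f n + g n).
Proof. intros Hf Hg n m H. specialize (Hf n m H); specialize (Hg n m H). simpl; lia. Qed.
Lemma mono_mul f g : mono f -> mono g -> mono (fun n => f n * g n).
Proof. intros Hf Hg n m H. apply Nat.mul_le_mono; auto. Qed.
Lemma mono_const a : mono (fun _ => a).
Proof. intros n m H. auto. Qed.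
Lemma mono_id : mono (fun n => n).
Proof. intros n m H. auto. Qed.
Lemma mono_comp f g : mono f -> mono g -> mono (fun n => f (g n)).
Proof. intros Hf Hg n m H. apply Hf, Hg, H. Qed.

Ltac monos := repeat first [assumption | apply mono_const | apply mono_id | apply mono_add | apply mono_mul | apply mono_comp].

Lemma FP_intro f c P : poly_bounded P -> (forall x, computes c x (f x) (P (sz x)) (P (sz x))) -> FP f.
Proof.
  intros HP H. destruct (pb_mono P HP) as (Q & HQ & HM & L). exists c, Q. repeat split; auto.
  intros x. eapply computes_le; eauto.
Qed.

Lemma FP_ext f g : FP f -> (forall x, f x = g x) -> FP g.
Proof. intros (c & P & H1 & H2 & H) E. exists c, P. repeat split; auto. intros x. rewrite <- E. auto. Qed.

Lemma FP_size f : FP f -> exists P, poly_bounded P /\ mono P /\ forall x, sz (f x) <= P (sz x).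
Proof.
  intros (c & P & H1 & H2 & H). exists P. repeat split; auto.
  intros x. now destruct (computes_sz _ _ _ _ _ (H x)).
Qed.

Lemma FP_id : FP (fun x => x).
Proof. apply FP_intro with Skip (fun n => n). apply pb_id. intros x. eapply computes_le. apply computes_id. all: lia. Qed.

Lemma FP_comp f g : FP f -> FP g -> FP (fun x => f (g x)).
Proof.
  intros (c & P & H1 & H2 & H) (d & Q & H3 & H4 & H').
  apply FP_intro with (Seq d c) (fun n => Q n + P (Q n)). pbs.
  intros x. pose proof (H' x) as A. pose proof (H (g x)) as B.
  destruct (computes_sz _ _ _ _ _ A) as [_ A']. specialize (H2 _ _ A').
  eapply computes_le. eapply computes_seq; eauto. all: lia.
Qed.

Lemma FP_hd0 : FP hd'.
Proof.
  apply FP_intro with hdc (fun n => 12 * n + 10). pbs.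
  intros x. eapply computes_le. apply computes_hd. all: lia.
Qed.

Lemma FP_tl0 : FP tl'.
Proof.
  apply FP_intro with tlc (fun n => 12 * n + 10). pbs.
  intros x. eapply computes_le. apply computes_tl. all: lia.
Qed.

Lemma FP_hd f : FP f -> FP (fun x => hd' (f x)).
Proof. apply (FP_comp hd' f FP_hd0). Qed.
Lemma FP_tl f : FP f -> FP (fun x => tl' (f x)).
Proof. apply (FP_comp tl' f FP_tl0). Qed.

Lemma FP_nd f g : FP f -> FP g -> FP (fun x => Nd (f x) (g x)).
Proof.
  intros (c & P & H1 & H2 & H) (d & Q & H3 & H4 & H').
  apply FP_intro with (pairc c d) (fun n => 41 * (P n + Q n) + 20). pbs.
  intros x. eapply computes_le. eapply computes_pair; eauto. all: lia.
Qed.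

Lemma FP_lf : FP (fun _ => Lf).
Proof.
  apply FP_intro with nilc (fun n => 8 * n + 4). pbs.
  intros x. eapply computes_le. apply computes_nil. all: lia.
Qed.

Lemma FP_const t : FP (fun _ => t).
Proof. induction t. apply FP_lf. now apply FP_nd. Qed.

Lemma FP_if c f g : FP c -> FP f -> FP g -> FP (fun x => tif (c x) (f x) (g x)).
Proof.
  intros (c0 & P0 & H01 & H02 & H0) (c1 & P1 & H11 & H12 & H1) (c2 & P2 & H21 & H22 & H2).
  apply FP_intro with (testc c0 c1 c2) (fun n => 41 * P0 n + P1 n + P2 n + 20). pbs.
  intros x. eapply computes_le with (T := P0 (sz x) + (P1 (sz x) + P2 (sz x)) + 40 * P0 (sz x) + 20).
  eapply computes_if with (M2 := P1 (sz x) + P2 (sz x)). apply H0.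
  destruct (c x); simpl; (eapply computes_le; [apply H1 || apply H2| |]); lia.
  all: lia.
Qed.

Inductive iterates (cc st : tree -> tree) (M : nat) : tree -> nat -> tree -> Prop :=
| wl_0 x : cc x = Lf -> sz x <= M -> iterates cc st M x 0 x
| wl_S x k y : cc x <> Lf -> sz x <= M -> iterates cc st M (st x) k y -> iterates cc st M x (S k) y.

Lemma while_core cc st : FP cc -> FP st -> exists c P, poly_bounded P /\ mono P /\
  forall M x k y, iterates cc st M x k y -> computes c x y ((k + 1) * P M) (P M).
Proof.
  intros (c0 & P0 & H01 & H02 & H0) (c1 & P1 & H11 & H12 & H1).
  exists (whilec c0 c1), (fun n => 42 * (P0 n + P1 n) + 30). split; [pbs|]. split; [monos|].
  intros M x k y H.
  assert (L : loop c0 c1 (P0 M + P1 M) (P0 M + P1 M) x k y).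
  { induction H as [x E Hs|x k y E Hs H IH].
    - apply loop_0. rewrite <- E. specialize (H02 _ _ Hs). eapply computes_le. apply H0. all: lia.
    - destruct (cc x) eqn:Ex; [tauto|].
      specialize (H02 _ _ Hs). specialize (H12 _ _ Hs).
      eapply loop_S; [|eapply computes_le; [apply H1|lia|lia]|exact IH].
      rewrite <- Ex. eapply computes_le; [apply H0|lia|lia]. }
  eapply computes_le. apply computes_while. exact L. all: try lia.
Qed.

Lemma FP_while cc st i f Q : FP cc -> FP st -> FP i -> poly_bounded Q ->
  (forall x, exists k, k <= Q (sz x) /\ iterates cc st (Q (sz x)) (i x) k (f x)) -> FP f.
Proof.
  intros Hc Hs (c0 & P0 & H01 & H02 & H0) HQ H.
  destruct (while_core cc st Hc Hs) as (c & P & HP & HM & HC).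
  apply FP_intro with (Seq c0 c) (fun n => P0 n + (Q n + 1) * P (Q n)). pbs.
  intros x. destruct (H x) as (k & L & W). eapply computes_le. eapply computes_seq; [apply H0|eapply HC; exact W].
  apply Nat.add_le_mono_l, Nat.mul_le_mono_r. lia. nia.
Qed.

(* Syntactic on purpose: plain unification would unfold the functions under consideration. *)
Ltac fp_base := lazymatch goal with
  | |- FP (fun x => x) => apply FP_id
  | |- FP (fun _ => ?t) => apply (FP_const t)
  | |- FP (fun x => Nd (@?f x) (@?g x)) => apply (FP_nd f g)
  | |- FP (fun x => tif (@?c x) (@?f x) (@?g x)) => apply (FP_if c f g)
  | |- FP (fun x => hd' (@?f x)) => apply (FP_hd f)
  | |- FP (fun x => tl' (@?f x)) => apply (FP_tl f)
  | |- FP hd' => exact FP_hd0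
  | |- FP tl' => exact FP_tl0
  | H : FP ?h |- FP ?h => exact H
  end.

Ltac fp := repeat fp_base.

(** * Folds over lists *)

Fixpoint foldT (f : tree -> tree) (e l acc : tree) : tree :=
  match l with Lf => acc | Nd a l' => foldT f e l' (f (Nd e (Nd a acc))) end.

(** The accumulator grows additively; a constant factor per element would already be exponential
    over the whole fold. *)
Definition grows (f : tree -> tree) : Prop :=
  exists G, poly_bounded G /\ mono G /\ forall e a acc, sz (f (Nd e (Nd a acc))) <= sz acc + G (sz e + sz a).

Lemma FP_foldT f e l a : FP f -> grows f -> FP e -> FP l -> FP a ->
  FP (fun x => foldT f (e x) (l x) (a x)).
Proof.
  intros Hf (G & HG & HM & Hg) He Hl Ha.
  set (cc := fun s => hd' (tl' s)).
  set (st := fun s => Nd (hd' s) (Nd (tl' (hd' (tl' s)))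
     (f (Nd (hd' s) (Nd (hd' (hd' (tl' s))) (tl' (tl' s))))))).
  assert (W : forall e l acc M, sz e + sz l + sz acc + 2 + sz l * G (sz e + sz l) <= M ->
        exists k, k <= sz l /\ iterates cc st M (Nd e (Nd l acc)) k (Nd e (Nd Lf (foldT f e l acc)))).
  { clear - Hg HM. intros e l; induction l as [|x _ l IH]; intros acc M HL.
    - exists 0. split. lia. apply wl_0. reflexivity. simpl in *; lia.
    - cbn [sz foldT] in *. specialize (Hg e x acc).
      pose proof (HM (sz e + sz x) (sz e + S (sz x + sz l)) ltac:(lia)).
      pose proof (HM (sz e + sz l) (sz e + S (sz x + sz l)) ltac:(lia)).
      set (g := G (sz e + S (sz x + sz l))) in *.
      assert (sz l * G (sz e + sz l) <= sz l * g) by (apply Nat.mul_le_mono_l; lia).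
      assert (g + sz l * g <= (1 + sz x + sz l) * g) by nia.
      change (S (sz x + sz l)) with (1 + sz x + sz l) in *.
      destruct (IH (f (Nd e (Nd x acc))) M) as (k & L & W1). lia.
      exists (S k). split. lia. apply wl_S. discriminate. simpl; nia. exact W1. }
  destruct (FP_size _ He) as (Pe & He1 & He2 & He3).
  destruct (FP_size _ Hl) as (Pl & Hl1 & Hl2 & Hl3).
  destruct (FP_size _ Ha) as (Pa & Ha1 & Ha2 & Ha3).
  apply FP_ext with (fun x => tl' (tl' (Nd (e x) (Nd Lf (foldT f (e x) (l x) (a x)))))); [|reflexivity].
  apply FP_tl, FP_tl.
  apply FP_while with cc st (fun x => Nd (e x) (Nd (l x) (a x)))
    (fun n => Pe n + Pl n + Pa n + 2 + Pl n * G (Pe n + Pl n)); unfold cc, st.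
  - fp.
  - fp. apply FP_comp; auto. fp.
  - fp.
  - pbs.
  - intros x. specialize (He3 x); specialize (Hl3 x); specialize (Ha3 x).
    destruct (W (e x) (l x) (a x) (Pe (sz x) + Pl (sz x) + Pa (sz x) + 2 + Pl (sz x) * G (Pe (sz x) + Pl (sz x)))) as (k & L & H).
    { assert (sz (l x) * G (sz (e x) + sz (l x)) <= Pl (sz x) * G (Pe (sz x) + Pl (sz x))).
      { apply Nat.mul_le_mono; auto. apply HM. lia. }
      lia. }
    exists k. split; auto. nia.
Qed.

Definition foldrT (f : tree -> tree) (e l acc : tree) : tree :=
  (fix go l := match l with Lf => acc | Nd a l' => f (Nd e (Nd a (go l'))) end) l.

(** On a fold argument [Nd e (Nd a acc)] the tail is [a] consed onto [acc], so folding with [consf]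
    reverses a list. *)
Definition consf (p : tree) : tree := tl' p.

Lemma FP_consf : FP consf.
Proof. exact FP_tl0. Qed.

Lemma foldT_rev f e l : forall r acc,
  foldT f e (foldT consf Lf l r) acc = foldT f e r (foldrT f e l acc).
Proof.
  induction l as [|a _ l IH]; intros r acc; simpl; auto.
Qed.

Lemma FP_foldrT f e l a : FP f -> grows f -> FP e -> FP l -> FP a ->
  FP (fun x => foldrT f (e x) (l x) (a x)).
Proof.
  intros Hf Hg He Hl Ha.
  (* A right fold is a left fold over the reversed list. *)
  apply FP_ext with (fun x => foldT f (e x) (foldT consf Lf (l x) Lf) (a x)).
  - apply FP_foldT; auto. apply FP_foldT; fp. exact FP_consf.
    exists (fun n => n + 1). split; [pbs|]. split; [monos|]. intros. simpl. lia.
  - intros x. now rewrite foldT_rev.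
Qed.

Definition appT (l1 l2 : tree) : tree := foldrT consf Lf l1 l2.
Definition mapT (g : tree -> tree) (e l : tree) : tree :=
  foldrT (fun p => Nd (g (Nd (hd' p) (hd' (tl' p)))) (tl' (tl' p))) e l Lf.
Definition flatT (g : tree -> tree) (e l : tree) : tree :=
  foldrT (fun p => appT (g (Nd (hd' p) (hd' (tl' p)))) (tl' (tl' p))) e l Lf.

Lemma appT_sz l1 l2 : sz (appT l1 l2) <= sz l1 + sz l2.
Proof. induction l1 as [|a _ l1 IH]; simpl in *; unfold appT in *; simpl in *; lia. Qed.

Lemma FP_appT f g : FP f -> FP g -> FP (fun x => appT (f x) (g x)).
Proof.
  intros. apply FP_foldrT; fp. exact FP_consf.
  exists (fun n => n + 1). split; [pbs|]. split; [monos|]. intros. simpl. lia.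
Qed.

Lemma FP_mapT g e l : FP g -> FP e -> FP l -> FP (fun x => mapT g (e x) (l x)).
Proof.
  intros Hg He Hl. apply FP_foldrT; fp.
  - apply FP_comp; auto. fp.
  - destruct (FP_size _ Hg) as (P & H1 & H2 & H3).
    exists (fun n => P (n + 1) + 1). split; [pbs|]. split; [monos|].
    intros. simpl. specialize (H3 (Nd e0 a)). simpl in H3.
    replace (sz e0 + sz a + 1) with (S (sz e0 + sz a)) by lia. lia.
Qed.

Lemma FP_flatT g e l : FP g -> FP e -> FP l -> FP (fun x => flatT g (e x) (l x)).
Proof.
  intros Hg He Hl. apply FP_foldrT; fp.
  - apply FP_appT; fp. apply FP_comp; auto. fp.
  - destruct (FP_size _ Hg) as (P & H1 & H2 & H3).
    exists (fun n => P (n + 1) + 1). split; [pbs|]. split; [monos|].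
    intros. simpl. specialize (H3 (Nd e0 a)). simpl in H3.
    pose proof (appT_sz (g (Nd e0 a)) acc).
    replace (sz e0 + sz a + 1) with (S (sz e0 + sz a)) by lia. lia.
Qed.

Lemma appT_tL {A} (f : A -> tree) l1 l2 : appT (tL f l1) (tL f l2) = tL f (l1 ++ l2).
Proof. induction l1; simpl; auto. unfold appT in *. simpl. now rewrite IHl1. Qed.

Lemma mapT_tL {A} g e (f : A -> tree) l : mapT g e (tL f l) = tL (fun a => g (Nd e (f a))) l.
Proof. induction l; simpl; auto. unfold mapT in *. simpl. now rewrite IHl. Qed.

Lemma flatT_tL {A B} g e (f : A -> tree) (h : A -> list B) k l :
  (forall a, In a l -> g (Nd e (f a)) = tL k (h a)) ->
  flatT g e (tL f l) = tL k (flat_map h l).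
Proof.
  intros H. induction l; simpl; auto. unfold flatT in *. simpl.
  rewrite IHl, H, appT_tL; simpl; auto. intros. apply H. now right.
Qed.

Lemma tL_ext {A} (f g : A -> tree) l : (forall a, In a l -> f a = g a) -> tL f l = tL g l.
Proof. induction l; simpl; auto. intros H. rewrite IHl, H; auto. Qed.

Lemma tL_map {A B} (f : B -> tree) (g : A -> B) l : tL f (map g l) = tL (fun a => f (g a)) l.
Proof. induction l; simpl; auto. now rewrite IHl. Qed.

(** * Recursive boolean procedures of polynomial depth run in polynomial space *)

(* Encodings as trees of the terms to be evaluated: false, true, the call of a position and the
   conditional. *)
Definition rF : tree := Lf.
Definition rT : tree := Nd Lf Lf.
Definition rP (p : tree) : tree := Nd (Nd Lf Lf) p.
Definition rI (a b c : tree) : tree := Nd (Nd (Nd Lf Lf) Lf) (Nd a (Nd b c)).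
Definition rB (b : bool) : tree := if b then rT else rF.

(* [ev step e d r b]: [r] evaluates to [b] with calls nested at most [d] deep, where a call of [p]
   in the environment [e] is unfolded to [step e p]. *)
Inductive ev (step : tree -> tree -> tree) (e : tree) : nat -> tree -> bool -> Prop :=
| ev_B d b : ev step e d (rB b) b
| ev_I d a b c x y : ev step e d a x -> ev step e d (if x then b else c) y ->
    ev step e d (rI a b c) y
| ev_P d p x : ev step e d (step e p) x -> ev step e (S d) (rP p) x.

(** Bounds the arguments of the pending calls in a term, and not the term itself: only arguments are
    carried on from one level of calls to the next. *)
Inductive okr (m : nat) : tree -> Prop :=
| ok_F : okr m rF
| ok_T : okr m rT
| ok_I a b c : okr m a -> okr m b -> okr m c -> okr m (rI a b c)
| ok_P p : sz p <= m -> okr m (rP p).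

Section Dfs.
Variables (stp : tree -> tree -> tree) (C : nat) (G : nat -> nat).
Hypothesis stp_FP : FP (fun x => stp (hd' x) (tl' x)).
Hypothesis stp_ok : forall e p, okr (sz p + C * (sz e + 1)) (stp e p).
Hypothesis G_mono : mono G.
Hypothesis stp_sz : forall e p, sz (stp e p) <= G (sz e + sz p + 1).

Definition dfs_busy (s : tree) : tree :=
  let cur := hd' (tl' s) in tif (hd' cur) rT (tl' (tl' s)).

(** A stack of pending pairs of branches accompanies the current term. Its kind is read off [hd']:
    [Lf] for a value, a node with [hd'] equal to [Lf] for a call, any other node for a
    conditional. *)
Definition dfs_step (s : tree) : tree :=
  let e := hd' s in let cur := hd' (tl' s) in let stk := tl' (tl' s) in
  tif (hd' cur)
    (tif (hd' (hd' cur))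
       (Nd e (Nd (hd' (tl' cur)) (Nd (tl' (tl' cur)) stk)))
       (Nd e (Nd (stp e (tl' cur)) stk)))
    (Nd e (Nd (tif cur (hd' (hd' stk)) (tl' (hd' stk))) (tl' stk))).

Inductive steps (M : nat) : tree -> tree -> Prop :=
| steps_0 s : steps M s s
| steps_S s s' : dfs_busy s <> Lf -> sz s <= M -> steps M (dfs_step s) s' -> steps M s s'.

Lemma steps_trans M s s1 s2 : steps M s s1 -> steps M s1 s2 -> steps M s s2.
Proof. induction 1; eauto using steps. Qed.

Lemma steps_wl M s s' : steps M s s' -> dfs_busy s' = Lf -> sz s' <= M ->
  exists k, iterates dfs_busy dfs_step M s k s'.
Proof.
  induction 1 as [s|s s' H1 H2 H IH]; intros.
  - exists 0. now apply wl_0.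
  - destruct IH as [k Hk]; auto. exists (S k). now apply wl_S.
Qed.

(** A conditional only moves parts of the current term to the stack. New material enters by a call
    alone, at most [G] of its argument; arguments gain [C * (sz e + 1)] per level and there are [d]
    levels, which gives the summand [d * G (..)]. *)
Lemma dfs_steps e d r b : ev stp e d r b -> forall m stk M, okr m r ->
  sz e + sz r + sz stk + d * G (m + d * (C * (sz e + 1)) + sz e + 1) + 4 <= M ->
  steps M (Nd e (Nd r stk)) (Nd e (Nd (rB b) stk)).
Proof.
  intros H; induction H as [d b|d a b c x y H1 IH1 H2 IH2|d p x H IH]; intros m stk M Hm HM.
  - apply steps_0.
  - set (U := d * G (m + d * (C * (sz e + 1)) + sz e + 1)) in *.
    inversion Hm as [| |? ? ? Ha Hb Hc|]; subst. simpl in HM.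
    apply steps_S. discriminate. simpl; lia.
    change (dfs_step (Nd e (Nd (rI a b c) stk))) with (Nd e (Nd a (Nd (Nd b c) stk))).
    eapply steps_trans. apply (IH1 m (Nd (Nd b c) stk) M Ha). fold U. simpl; lia.
    apply steps_S. destruct x; discriminate. destruct x; simpl; lia.
    replace (dfs_step (Nd e (Nd (rB x) (Nd (Nd b c) stk)))) with (Nd e (Nd (if x then b else c) stk))
      by (destruct x; reflexivity).
    apply (IH2 m). destruct x; auto. fold U. destruct x; lia.
  - inversion Hm; subst. simpl in HM.
    pose proof (stp_ok e p) as Ho. pose proof (stp_sz e p) as Hs.
    apply steps_S. discriminate. simpl. lia.
    change (dfs_step (Nd e (Nd (rP p) stk))) with (Nd e (Nd (stp e p) stk)).
    assert (Ho' : okr (m + C * (sz e + 1)) (stp e p)).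
    { clear - Ho H1. induction Ho; constructor; auto; lia. }
    apply (IH _ _ _ Ho').
    set (E := C * (sz e + 1)) in *.
    assert (sz (stp e p) <= G (m + (E + d * E) + sz e + 1)).
    { etransitivity. exact Hs. apply G_mono. lia. }
    replace (m + E + d * E + sz e + 1) with (m + (E + d * E) + sz e + 1) by lia.
    lia.
Qed.

Lemma FP_dfs_busy : FP dfs_busy.
Proof. unfold dfs_busy; cbv zeta; fp. Qed.

Lemma FP_dfs_step : FP dfs_step.
Proof.
  unfold dfs_step; cbv zeta. fp.
  apply (FP_comp _ (fun x => Nd (hd' x) (tl' (hd' (tl' x)))) stp_FP). fp.
Qed.

Theorem dfs_pspace (dom L : tree -> Prop) e r D : poly_bounded G -> poly_bounded D -> FP e -> FP r ->
  (forall x, okr (sz (r x)) (r x)) ->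
  (forall x, dom x -> exists b, ev stp (e x) (D (sz x)) (r x) b /\ (b = true <-> L x)) ->
  exists c P, poly_bounded P /\ forall x, dom x -> exists y T, computes c x y T (P (sz x)) /\ (y <> Lf <-> L x).
Proof.
  intros HG HD He Hr Hok H.
  destruct (while_core dfs_busy dfs_step FP_dfs_busy FP_dfs_step) as (c & P & HP & HM & HC).
  assert (Hi : FP (fun x => Nd (e x) (Nd (r x) Lf))) by fp.
  destruct Hi as (c0 & P0 & H01 & H02 & H0).
  assert (Ho : FP (fun s => hd' (tl' s))) by fp.
  destruct Ho as (c1 & P1 & H11 & H12 & H1).
  destruct (FP_size _ He) as (Pe & He1 & He2 & He3).
  destruct (FP_size _ Hr) as (Pr & Hr1 & Hr2 & Hr3).
  set (Q := fun n => Pe n + Pr n + D n * G (Pr n + D n * (C * (Pe n + 1)) + Pe n + 1) + 7).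
  assert (HQ : poly_bounded Q) by (unfold Q; pbs).
  exists (Seq c0 (Seq c c1)), (fun n => P0 n + (P (Q n) + P1 (Q n))). split; [pbs|].
  intros x Hx. destruct (H x Hx) as (b & E & Hb).
  specialize (He3 x); specialize (Hr3 x).
  assert (HB : sz (e x) + sz (r x) + 1 + D (sz x) * G (sz (r x) + D (sz x) * (C * (sz (e x) + 1)) + sz (e x) + 1) + 6 <= Q (sz x)).
  { unfold Q.
    assert (D (sz x) * G (sz (r x) + D (sz x) * (C * (sz (e x) + 1)) + sz (e x) + 1) <=
      D (sz x) * G (Pr (sz x) + D (sz x) * (C * (Pe (sz x) + 1)) + Pe (sz x) + 1)); [|lia].
    apply Nat.mul_le_mono_l, G_mono.
    assert (D (sz x) * (C * (sz (e x) + 1)) <= D (sz x) * (C * (Pe (sz x) + 1))); [|lia].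
    apply Nat.mul_le_mono_l, Nat.mul_le_mono_l. lia. }
  pose proof (dfs_steps _ _ _ _ E (sz (r x)) Lf (Q (sz x)) (Hok x) ltac:(simpl; lia)) as S.
  apply steps_wl in S as [k W]; [|destruct b; reflexivity|pose proof (sz_pos (r x)); destruct b; simpl; lia].
  set (s := Nd (e x) (Nd (rB b) Lf)) in *.
  assert (Hs : sz s <= Q (sz x)) by (pose proof (sz_pos (r x)); unfold s; destruct b; simpl; lia).
  exists (rB b), (P0 (sz x) + ((k + 1) * P (Q (sz x)) + P1 (Q (sz x)))). split.
  - eapply computes_seq. apply H0. eapply computes_seq. eapply HC. exact W.
    pose proof (H12 _ _ Hs). eapply computes_le. apply (H1 s). all: auto.
  - rewrite <- Hb. destruct b; split; intros; auto; discriminate || tauto.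
Qed.

End Dfs.

(** * Instances as trees *)

Fixpoint tN (n : nat) : tree := match n with 0 => Lf | S n => Nd Lf (tN n) end.
Definition tV : list nat -> tree := tL tN.
Definition tP : list gstate -> tree := tL tV.
Definition tnode (k : nat) (l : list tree) : tree := Nd (tN k) (tL (fun t => t) l).

Fixpoint tRe (e : re gstate) : tree :=
  match e with
  | ReEmpty => tnode 0 []
  | ReEps => tnode 1 []
  | ReSym x => tnode 2 [tV x]
  | ReSeq e1 e2 => tnode 3 [tRe e1; tRe e2]
  | ReAlt e1 e2 => tnode 4 [tRe e1; tRe e2]
  | ReStar e1 => tnode 5 [tRe e1]
  end.

Definition tTr (t : nat * list nat * nat) : tree :=
  match t with (l, a, l') => Nd (tN l) (Nd (tV a) (Nd (tN l') Lf)) end.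

Definition tAg (ag : agent) : tree :=
  Nd (tN (ag_nloc ag)) (Nd (tN (ag_init ag)) (Nd (tN (ag_nact ag))
    (Nd (tL tV (ag_prot ag)) (Nd (tL tTr (ag_trans ag)) Lf)))).

Definition tIS (IS : isrl) : tree :=
  Nd (tL tAg (is_agents IS)) (Nd (tL tRe (is_lambda IS)) Lf).

Fixpoint tF (f : fml) : tree :=
  match f with
  | FPi => tnode 0 []
  | FVar p => tnode 1 [tN p]
  | FNeg f1 => tnode 2 [tF f1]
  | FAnd f1 f2 => tnode 3 [tF f1; tF f2]
  | FK i f1 => tnode 4 [tN i; tF f1]
  | FC G f1 => tnode 5 [tV G; tF f1]
  | FB f1 => tnode 6 [tF f1]
  | FD f1 => tnode 7 [tF f1]
  | FE f1 => tnode 8 [tF f1]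
  end.

Definition tInst (IS : isrl) (f : fml) (I : interval) : tree :=
  Nd (tIS IS) (Nd (tF f) (Nd (tL tP I) Lf)).

(** The correspondence between forests and binary trees: behind the opening parenthesis of an
    element comes its content, the left subtree, then the remaining elements, the right subtree; the
    closing parenthesis is the final leaf. *)
Lemma enc_tL {A} (f : A -> list bool) (g : A -> tree) l :
  (forall a, In a l -> f a = true :: enc (g a)) -> enc_list f l = true :: enc (tL g l).
Proof.
  intros H. unfold enc_list. f_equal.
  induction l as [|a l IH]; simpl; auto. rewrite (H a), <- IH; simpl; auto.
  - now rewrite <- app_assoc.
  - intros. apply H. now right.
Qed.

Lemma enc_tN n : enc_nat n = true :: enc (tN n).
Proof.
  unfold enc_nat. f_equal. induction n; simpl; auto. now rewrite <- IHn.
Qed.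

Lemma enc_tV g : enc_list enc_nat g = true :: enc (tV g).
Proof. apply enc_tL. intros; apply enc_tN. Qed.

Lemma enc_tnode k l : enc_node k (map (fun t => true :: enc t) l) = true :: enc (tnode k l).
Proof.
  unfold enc_node, tnode. rewrite enc_tN. cbn [app enc]. f_equal. f_equal. f_equal.
  induction l; simpl; auto. rewrite <- IHl, <- app_assoc. reflexivity.
Qed.

Lemma enc_tRe e : enc_re enc_gstate e = true :: enc (tRe e).
Proof.
  induction e; cbn [enc_re tRe]; rewrite <- enc_tnode; cbn [map];
  rewrite ?IHe, ?IHe1, ?IHe2; auto. unfold enc_gstate. now rewrite enc_tV.
Qed.

Lemma enc_tF f : enc_fml f = true :: enc (tF f).
Proof.
  induction f; cbn [enc_fml tF]; rewrite <- enc_tnode; cbn [map];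
  rewrite ?IHf, ?IHf1, ?IHf2, ?enc_tV, ?enc_tN; auto.
Qed.

Lemma enc_tAg ag : enc_agent ag = true :: enc (tAg ag).
Proof.
  unfold enc_agent. unfold enc_list at 1. unfold tAg, id. cbn [map concat].
  rewrite !enc_tN.
  rewrite (enc_tL (enc_list enc_nat) tV), (enc_tL enc_trans tTr).
  - simpl. repeat (rewrite <- app_assoc; simpl). reflexivity.
  - intros [[l a] l'] _. unfold enc_trans. unfold enc_list at 1. unfold tTr, id. cbn [map concat].
    rewrite !enc_tN, enc_tV. simpl.
    repeat (rewrite <- app_assoc; simpl). reflexivity.
  - intros; apply enc_tV.
Qed.

Lemma enc_tInst IS f I : enc_instance IS f I = true :: enc (tInst IS f I).
Proof.
  unfold enc_instance, tInst, enc_interval, enc_isrl.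
  rewrite (enc_tL enc_agent tAg), (enc_tL (enc_re enc_gstate) tRe), enc_tF,
    (enc_tL (enc_list enc_gstate) tP).
  - unfold enc_list; simpl; unfold id. rewrite <- !app_assoc. simpl. repeat (rewrite <- app_assoc; simpl). reflexivity.
  - intros. apply enc_tL. intros. apply enc_tV.
  - intros; apply enc_tRe.
  - intros; apply enc_tAg.
Qed.

(** * The model-checking game *)

Notation "x '#' y" := (Nd x y) (at level 60, right associativity).

Definition call (k : nat) (args : tree) : tree := rP (Nd (tN k) args).
Definition rAnd a b := rI a b rF.
Definition rOr a b := rI a rT b.
Definition rNot a := rI a rF rT.

Definition iEq := 0. Definition iLt := 1. Definition iNat := 2. Definition iIn := 3.
Definition iInNth := 4. Definition iLocals := 5. Definition iProt := 6. Definition iTrans := 7.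
Definition iJoint := 8. Definition iTG := 9. Definition iGuess := 10. Definition iChain := 11.
Definition iInit := 12. Definition iTC := 13. Definition iTCmid := 14. Definition iStep := 15.
Definition iSomeSim := 16. Definition iSim := 17. Definition iSameLoc := 18. Definition iPath := 19.
Definition iReachVia := 20. Definition iReach := 21. Definition iRe := 22. Definition iSeqSplit := 23.
Definition iStarSplit := 24. Definition iApp := 25. Definition iSat := 26. Definition iVar := 27.
Definition iKWit := 28. Definition iCWit := 29. Definition iBSplit := 30. Definition iESplit := 31.
Definition iAgShape := 32. Definition iAgWf := 33. Definition iLen := 34. Definition iProtWf := 35.
Definition iBelow := 36. Definition iTransWf := 37. Definition iReWf := 38. Definition iLamWf := 39.
Definition iFmlWf := 40. Definition iMState := 41. Definition iInterval := 42. Definition iSnoc := 43.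
Definition iGlobals := 44. Definition iLast := 45. Definition iWithGlobals := 46. Definition iMain := 47.

(* The environment is [budget # agents # lambda]. *)
Definition eN (e : tree) := hd' e.
Definition eA (e : tree) := hd' (tl' e).
Definition eL (e : tree) := tl' (tl' e).

(* Arguments are packed as right-nested pairs: [pi] is the i-th one and [qi] what follows it. *)
Definition p1 (a : tree) := hd' a.
Definition q1 (a : tree) := tl' a.
Definition p2 (a : tree) := hd' (tl' a).
Definition q2 (a : tree) := tl' (tl' a).
Definition p3 (a : tree) := hd' (tl' (tl' a)).
Definition q3 (a : tree) := tl' (tl' (tl' a)).
Definition p4 (a : tree) := hd' (tl' (tl' (tl' a))).
Definition p5 (a : tree) := hd' (tl' (tl' (tl' (tl' a)))).
Definition q5 (a : tree) := tl' (tl' (tl' (tl' (tl' a)))).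

Definition guess (e : tree) (k : nat) (args : tree) : tree :=
  call iGuess (eN e # Lf # tN k # args).

Definition isLf (x : tree) : tree := tif x rF rT.

Definition sel6 (t a0 a1 a2 a3 a4 a5 : tree) : tree :=
  tif t (tif (tl' t) (tif (q2 t) (tif (q3 t) (tif (tl' (q3 t)) (tif (q5 t) rF a5) a4) a3) a2) a1) a0.

Definition sel9 (t a0 a1 a2 a3 a4 a5 a6 a7 a8 : tree) : tree :=
  tif t (tif (tl' t) (tif (q2 t) (tif (q3 t) (tif (tl' (q3 t)) (tif (q5 t)
    (tif (tl' (q5 t)) (tif (q2 (q5 t)) (tif (q3 (q5 t)) rF a8) a7) a6) a5) a4) a3) a2) a1) a0.

(* Every call uses each part of its argument at most once, so that arguments grow only by
   amounts bounded by the environment. *)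
Definition ruEq (e a : tree) := let x := p1 a in let y := q1 a in
  tif x (tif y (rAnd (call iEq (hd' x # hd' y)) (call iEq (tl' x # tl' y))) rF) (isLf y).
Definition ruLt (e a : tree) := let x := p1 a in let y := q1 a in
  tif y (tif x (tif (hd' x) rF (call iLt (tl' x # tl' y))) rT) rF.
Definition ruNat (e a : tree) := tif a (tif (hd' a) rF (call iNat (tl' a))) rT.
Definition ruIn (e a : tree) := let x := p1 a in let l := q1 a in
  tif l (rOr (call iEq (x # hd' l)) (call iIn (x # tl' l))) rF.
Definition ruInNth (e a : tree) := let x := p1 a in let n := p2 a in let l := q2 a in
  tif n (call iInNth (x # tl' n # tl' l)) (call iIn (x # hd' l)).
Definition ruLocals (e a : tree) := let s := p1 a in let x := p2 a in let ag := q2 a in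
  tif x (tif ag (rAnd (tif s (call iLt (hd' x # p3 (hd' ag))) (call iLt (hd' x # p1 (hd' ag))))
                      (call iLocals (s # tl' x # tl' ag))) rF) (isLf ag).
Definition ruProt (e a : tree) := let g := p1 a in let z := p2 a in let ag := q2 a in
  tif ag (rAnd (call iInNth (hd' z # hd' g # p4 (hd' ag))) (call iProt (tl' g # tl' z # tl' ag))) rT.
Definition ruTrans (e a : tree) := let g := p1 a in let g' := p2 a in let z := p3 a in let ag := q3 a in
  tif ag (rAnd (call iIn ((hd' g # z # hd' g' # Lf) # p5 (hd' ag)))
               (call iTrans (tl' g # tl' g' # z # tl' ag))) rT.
Definition ruJoint (e a : tree) := let z := p1 a in let g := p2 a in let g' := q2 a in
  rAnd (call iLocals (rT # z # eA e)) (rAnd (call iProt (g # z # eA e)) (call iTrans (g # g' # z # eA e))).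
Definition ruTG (e a : tree) := let g := p1 a in let g' := q1 a in
  rAnd (call iLocals (Lf # g # eA e)) (rAnd (call iLocals (Lf # g' # eA e)) (guess e iJoint (g # g'))).
(** A tree is guessed by stack moves, each costing one unit of [n]: push a leaf, or join the two
    topmost trees. At any moment the top may be handed over to rule [k]. *)
Definition ruGuess (e a : tree) := let n := p1 a in let st := p2 a in let k := q2 a in
  rOr (rP (hd' k # hd' st # tl' k))
    (tif n (rOr (call iGuess (tl' n # (Lf # st) # k))
                (call iGuess (tl' n # ((hd' st # p2 st) # q2 st) # k))) rF).
Definition ruChain (e a : tree) :=
  tif a (tif (tl' a) (rAnd (call iTG (hd' a # p2 a)) (call iChain (tl' a))) rT) rT.
Definition ruInit (e a : tree) := let g := p1 a in let ag := q1 a in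
  tif ag (tif g (rAnd (call iEq (hd' g # p2 (hd' ag))) (call iInit (tl' g # tl' ag))) rF) (isLf g).
Definition ruTC (e a : tree) := let k := p1 a in
  tif k (rOr (call iTC (tl' k # q1 a)) (guess e iTCmid (tl' k # q1 a))) (call iStep (q1 a)).
Definition ruTCmid (e a : tree) := let z := p1 a in let k := p2 a in let kd := p3 a in
  let x := hd' (q3 a) in let y := tl' (q3 a) in
  rAnd (call iTC (k # kd # x # z)) (call iTC (k # kd # z # y)).
(** [kd] selects the relation whose closure is searched: [Lf] for global transitions, [Lf # G] for
    the epistemic steps of [G]. The extra node keeps an empty [G] apart from the former. *)
Definition ruStep (e a : tree) := let kd := p1 a in let x := p2 a in let y := q2 a in
  tif kd (rAnd (call iPath x) (rAnd (call iPath y) (call iSomeSim (tl' kd # x # y)))) (call iTG (x # y)).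
Definition ruSomeSim (e a : tree) := let l := p1 a in
  tif l (rOr (call iSim (hd' l # q1 a)) (call iSomeSim (tl' l # q1 a))) rF.
Definition ruSim (e a : tree) := let i := p1 a in let x := p2 a in let y := q2 a in
  tif x (tif y (rAnd (call iSameLoc (i # hd' x # hd' y)) (call iSim (i # tl' x # tl' y))) rF) (isLf y).
Definition ruSameLoc (e a : tree) := let i := p1 a in let x := p2 a in let y := q2 a in
  tif i (call iSameLoc (tl' i # tl' x # tl' y)) (call iEq (hd' x # hd' y)).
Definition ruPath (e a : tree) := tif a (rAnd (call iReach (hd' a)) (call iChain a)) rF.
(** A single rule cannot traverse the agents to assemble the initial global state, so that state is
    guessed and then checked. *)
Definition ruReachVia (e a : tree) := let z := p1 a in let g := q1 a in
  rAnd (call iInit (z # eA e)) (call iTC ((Lf # eN e) # Lf # z # g)).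
Definition ruReach (e a : tree) := rOr (call iInit (a # eA e)) (guess e iReachVia a).
Definition ruRe (e a : tree) := let r := p1 a in let w := q1 a in
  sel6 (hd' r) rF (isLf w) (tif w (tif (tl' w) rF (call iEq (hd' w # p2 r))) rF)
    (guess e iSeqSplit a) (rOr (call iRe (p2 r # w)) (call iRe (p3 r # w)))
    (tif w (guess e iStarSplit a) rT).
Definition ruSeqSplit (e a : tree) := let z := p1 a in let r := p2 a in let w := q2 a in
  rAnd (call iApp (hd' z # tl' z # w)) (rAnd (call iRe (p2 r # hd' z)) (call iRe (p3 r # tl' z))).
Definition ruStarSplit (e a : tree) := let z := p1 a in let r := p2 a in let w := q2 a in
  rAnd (call iApp (hd' z # tl' z # w))
    (tif (hd' z) (rAnd (call iRe (p2 r # hd' z)) (call iRe (r # tl' z))) rF).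
Definition ruApp (e a : tree) := let u := p1 a in let v := p2 a in let w := q2 a in
  tif u (tif w (rAnd (call iEq (hd' u # hd' w)) (call iApp (tl' u # v # tl' w))) rF)
    (call iEq (v # w)).
(** [guess] offers existential choices only, so [K] and [C] become negated searches for a
    counterexample. *)
Definition ruSat (e a : tree) := let f := p1 a in let w := q1 a in
  sel9 (hd' f) (tif w (isLf (tl' w)) rF)
    (call iVar (p2 f # eL e # w))
    (rNot (call iSat (p2 f # w)))
    (rAnd (call iSat (p2 f # w)) (call iSat (p3 f # w)))
    (rNot (guess e iKWit a))
    (rNot (guess e iCWit a))
    (guess e iBSplit a)
    (call iSat ((tN 8 # (tN 6 # tl' f) # Lf) # w))
    (guess e iESplit a).
Definition ruVar (e a : tree) := let p := p1 a in let l := p2 a in let w := q2 a in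
  tif p (call iVar (tl' p # tl' l # w)) (call iRe (hd' l # w)).
Definition ruKWit (e a : tree) := let z := p1 a in let f := p2 a in let w := q2 a in
  rAnd (call iPath z) (rAnd (call iSim (p2 f # w # z)) (rNot (call iSat (p3 f # z)))).
Definition ruCWit (e a : tree) := let z := p1 a in let f := p2 a in let w := q2 a in
  rAnd (call iTC ((Lf # eN e) # (Lf # p2 f) # w # z)) (rNot (call iSat (p3 f # z))).
Definition ruBSplit (e a : tree) := let z := p1 a in let f := p2 a in let w := q2 a in
  rAnd (call iApp (hd' z # tl' z # w))
    (tif (hd' z) (tif (tl' z) (call iSat (p2 f # hd' z)) rF) rF).
Definition ruESplit (e a : tree) := let z := p1 a in let f := p2 a in let w := q2 a in
  rAnd (call iApp (hd' z # tl' z # w))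
    (tif (hd' z) (tif (tl' z) (call iSat (p2 f # tl' z)) rF) rF).
Definition ruAgShape (e a : tree) := let t := hd' a in
  tif a (tif t (tif (tl' t) (tif (q2 t) (tif (q3 t) (tif (tl' (q3 t)) (tif (q5 t) rF
    (rAnd (call iNat (p1 t)) (rAnd (call iNat (p3 t)) (call iAgShape (tl' a))))) rF) rF) rF) rF) rF) rT.
Definition ruAgWf (e a : tree) := let t := hd' a in
  tif a (rAnd (call iLt (p2 t # p1 t)) (rAnd (call iLen (p4 t # p1 t))
    (rAnd (call iProtWf (p4 t # p3 t)) (rAnd (call iTransWf (p5 t # p1 t)) (call iAgWf (tl' a)))))) rT.
Definition ruLen (e a : tree) := let x := p1 a in let y := q1 a in
  tif x (tif y (call iLen (tl' x # tl' y)) rF) (isLf y).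
Definition ruProtWf (e a : tree) := let l := p1 a in let n := q1 a in
  tif l (rAnd (call iBelow (hd' l # n)) (call iProtWf (tl' l # n))) rT.
Definition ruBelow (e a : tree) := let l := p1 a in let n := q1 a in
  tif l (rAnd (call iLt (hd' l # n)) (call iBelow (tl' l # n))) rT.
Definition ruTransWf (e a : tree) := let l := p1 a in let n := q1 a in let t := hd' l in
  tif l (tif t (tif (tl' t) (tif (q2 t) (tif (q3 t) rF
    (rAnd (call iLt (p1 t # n)) (rAnd (call iLocals (rT # p2 t # eA e)) (rAnd (call iLt (p3 t # n))
      (call iTransWf (tl' l # n)))))) rF) rF) rF) rT.
Definition ruReWf (e a : tree) := let c := tl' a in
  tif a (rAnd (call iNat (hd' a))
    (sel6 (hd' a) (isLf c) (isLf c)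
      (tif c (tif (tl' c) rF (call iLocals (Lf # hd' c # eA e))) rF)
      (tif c (tif (tl' c) (tif (q2 c) rF (rAnd (call iReWf (p1 c)) (call iReWf (p2 c)))) rF) rF)
      (tif c (tif (tl' c) (tif (q2 c) rF (rAnd (call iReWf (p1 c)) (call iReWf (p2 c)))) rF) rF)
      (tif c (tif (tl' c) rF (call iReWf (p1 c))) rF))) rF.
Definition ruLamWf (e a : tree) := tif a (rAnd (call iReWf (hd' a)) (call iLamWf (tl' a))) rT.
Definition ruFmlWf (e a : tree) := let c := tl' a in
  let un := tif c (tif (tl' c) rF (call iFmlWf (p1 c))) rF in
  tif a (rAnd (call iNat (hd' a))
    (sel9 (hd' a) (isLf c)
      (tif c (tif (tl' c) rF (call iLt (p1 c # eL e))) rF)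
      un
      (tif c (tif (tl' c) (tif (q2 c) rF (rAnd (call iFmlWf (p1 c)) (call iFmlWf (p2 c)))) rF) rF)
      (tif c (tif (tl' c) (tif (q2 c) rF (rAnd (call iLt (p1 c # eA e)) (call iFmlWf (p2 c)))) rF) rF)
      (tif c (tif (tl' c) (tif (q2 c) rF (rAnd (call iBelow (p1 c # eA e)) (call iFmlWf (p2 c)))) rF) rF)
      un un un)) rF.
Definition ruMState (e a : tree) := tif a (rAnd (call iInit (hd' a # eA e)) (call iChain a)) rF.
Definition ruInterval (e a : tree) :=
  tif a (rAnd (call iMState (hd' a))
    (tif (tl' a) (rAnd (call iSnoc (hd' a # p2 a)) (call iInterval (tl' a))) rT)) rF.
Definition ruSnoc (e a : tree) := let x := p1 a in let y := q1 a in
  tif x (tif y (rAnd (call iEq (hd' x # hd' y)) (call iSnoc (tl' x # tl' y))) rF)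
    (tif y (isLf (tl' y)) rF).
Definition ruGlobals (e a : tree) := let z := p1 a in let l := q1 a in
  tif l (tif z (rAnd (call iLast (hd' z # hd' l)) (call iGlobals (tl' z # tl' l))) rF) (isLf z).
Definition ruLast (e a : tree) := let g := p1 a in let s := q1 a in
  tif (tl' s) (call iLast (g # tl' s)) (call iEq (g # hd' s)).
Definition ruWithGlobals (e a : tree) := let z := p1 a in let l := p2 a in let f := q2 a in
  rAnd (call iGlobals (z # l)) (call iSat (f # z)).
(* The argument is the stack of trees left by [parse]: [(T # Lf) # Lf] on well-formed input. *)
Definition ruMain (e a : tree) := let t := hd' (hd' a) in let s := hd' t in
  tif a (tif (tl' a) rF (tif (hd' a) (tif (tl' (hd' a)) rF
  (tif t (tif (tl' t) (tif (q2 t) (tif (q3 t) rF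
  (tif s (tif (tl' s) (tif (q2 s) rF
    (tif (p1 s) (rAnd (call iAgShape (eA e)) (rAnd (call iAgWf (eA e)) (rAnd (call iLamWf (eL e))
      (rAnd (call iFmlWf (p2 t)) (rAnd (call iInterval (p3 t))
         (guess e iWithGlobals (p3 t # p2 t))))))) rF)) rF) rF)) rF) rF) rF)) rF)) rF.

Definition rules : list (tree -> tree -> tree) :=
  [ruEq; ruLt; ruNat; ruIn; ruInNth; ruLocals; ruProt; ruTrans; ruJoint; ruTG; ruGuess; ruChain; ruInit; ruTC;
   ruTCmid; ruStep; ruSomeSim; ruSim; ruSameLoc; ruPath; ruReachVia; ruReach; ruRe; ruSeqSplit; ruStarSplit; ruApp; ruSat; ruVar;
   ruKWit; ruCWit; ruBSplit; ruESplit; ruAgShape; ruAgWf; ruLen; ruProtWf; ruBelow; ruTransWf; ruReWf; ruLamWf; ruFmlWf; ruMState;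
   ruInterval; ruSnoc; ruGlobals; ruLast; ruWithGlobals; ruMain].

(** * Dispatch and size bounds of the rules *)

Fixpoint disp (l : list (tree -> tree -> tree)) (t e a : tree) : tree :=
  match l with
  | [] => rF
  | f :: l => tif t (disp l (tl' t) e a) (f e a)
  end.

Definition gstep (e p : tree) : tree := disp rules (hd' p) e (tl' p).

(** A generous constant: it covers unary rule numbers up to 47 and the nodes that a rule wraps
    around its arguments. *)
Definition growth := 400.

(** Taking both halves of an argument costs almost nothing, the source of the additive bounds. The
    [+ 1] is for the leaf, both of whose halves are [Lf]. *)
Lemma sz_ht x : sz (hd' x) + sz (tl' x) <= sz x + 1.
Proof. destruct x; simpl; lia. Qed.

Lemma okr_mono m m' r : okr m r -> m <= m' -> okr m' r.
Proof. intros H ?. induction H; constructor; auto; lia. Qed.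

Lemma okr_tif m c a b : okr m a -> okr m b -> okr m (tif c a b).
Proof. destruct c; auto. Qed.

Lemma okr_P m k args : 2 + 2 * k + sz args <= m -> okr m (call k args).
Proof.
  intros H. apply ok_P. replace (sz (tN k # args)) with (2 + 2 * k + sz args); auto.
  simpl. induction k; simpl in *; lia.
Qed.

Lemma okr_isLf m x : okr m (isLf x).
Proof. destruct x; constructor. Qed.

Ltac satht :=
  repeat match goal with
  | |- context [hd' ?x] =>
      lazymatch goal with H : sz (hd' x) + sz (tl' x) <= _ |- _ => fail | _ => pose proof (sz_ht x) end
  | |- context [tl' ?x] =>
      lazymatch goal with H : sz (hd' x) + sz (tl' x) <= _ |- _ => fail | _ => pose proof (sz_ht x) end
  end.

Definition good_rule (f : tree -> tree -> tree) : Prop :=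
  FP (fun x => f (hd' x) (tl' x)) /\ forall e a, okr (sz a + growth * (sz e + 1)) (f e a).

Ltac unf := unfold sel6, sel9, guess, eN, eA, eL, p1, q1, p2, q2, p3, q3, p4, p5, q5 in *.

Ltac okrs := unf; unfold rAnd, rOr, rNot;
  repeat first [apply ok_F | apply ok_T | apply okr_isLf | apply ok_I | apply okr_tif | apply okr_P];
  unfold growth, rT, iGuess; satht; cbn [sz tN]; try (apply ok_P; cbn [sz]; satht; lia); lia.

Ltac fps := unf; unfold call, rP, rAnd, rOr, rNot, rI, isLf, rT, rF; fp.

Lemma rules_good : Forall good_rule rules.
Proof.
  unfold rules.
  repeat (apply Forall_cons; [split; [cbv beta zeta delta [
    ruEq ruLt ruNat ruIn ruInNth ruLocals ruProt ruTrans ruJoint ruTG ruGuess ruChain ruInit ruTC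
   ruTCmid ruStep ruSomeSim ruSim ruSameLoc ruPath ruReachVia ruReach ruRe ruSeqSplit ruStarSplit ruApp ruSat ruVar
   ruKWit ruCWit ruBSplit ruESplit ruAgShape ruAgWf ruLen ruProtWf ruBelow ruTransWf ruReWf ruLamWf ruFmlWf ruMState
   ruInterval ruSnoc ruGlobals ruLast ruWithGlobals ruMain]; fps
   |intros e a; cbv beta zeta delta [
    ruEq ruLt ruNat ruIn ruInNth ruLocals ruProt ruTrans ruJoint ruTG ruGuess ruChain ruInit ruTC
   ruTCmid ruStep ruSomeSim ruSim ruSameLoc ruPath ruReachVia ruReach ruRe ruSeqSplit ruStarSplit ruApp ruSat ruVar
   ruKWit ruCWit ruBSplit ruESplit ruAgShape ruAgWf ruLen ruProtWf ruBelow ruTransWf ruReWf ruLamWf ruFmlWf ruMState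
   ruInterval ruSnoc ruGlobals ruLast ruWithGlobals ruMain iEq iLt iNat iIn iInNth iLocals iProt iTrans iJoint iTG iGuess iChain iInit
   iTC iTCmid iStep iSomeSim iSim iSameLoc iPath iReachVia iReach iRe iSeqSplit iStarSplit iApp iSat iVar iKWit iCWit iBSplit iESplit iAgShape iAgWf iLen
   iProtWf iBelow iTransWf iReWf iLamWf iFmlWf iMState iInterval iSnoc iGlobals iLast iWithGlobals iMain]; okrs]|]).
  apply Forall_nil.
Qed.

Lemma disp_good l t : Forall good_rule l -> FP t ->
  FP (fun x => disp l (t x) (hd' x) (tl' (tl' x))) /\
  forall u e p, okr (sz p + growth * (sz e + 1)) (disp l u e (tl' p)).
Proof.
  intros H. revert t. induction H as [|f l [H1 H2] H IH]; intros t Ht; simpl.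
  - split. apply FP_const. intros. constructor.
  - destruct (IH (fun x => tl' (t x))) as [I1 I2]. now apply FP_tl. split.
    + apply FP_if; auto. apply (FP_comp _ (fun x => Nd (hd' x) (tl' (tl' x))) H1). fp.
    + intros u e p. apply okr_tif; [apply I2|].
      pose proof (sz_ht p). pose proof (sz_pos (hd' p)).
      eapply okr_mono; [apply H2|apply Nat.add_le_mono_r; lia].
Qed.

Lemma gstep_FP : FP (fun x => gstep (hd' x) (tl' x)).
Proof. apply (disp_good rules (fun x => hd' (tl' x)) rules_good). fp. Qed.

Lemma gstep_ok e p : okr (sz p + growth * (sz e + 1)) (gstep e p).
Proof. apply (disp_good rules (fun x => x) rules_good). apply FP_id. Qed.

(** * Satisfaction depends only on the global states of an interval *)

Fixpoint chain {A : Type} (R : A -> A -> Prop) (l : list A) : Prop :=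
  match l with
  | a :: l' => match l' with b :: _ => R a b | [] => True end /\ chain R l'
  | [] => True
  end.

Lemma chain_nth {A} (R : A -> A -> Prop) d l :
  chain R l <-> forall j, S j < length l -> R (nth j l d) (nth (S j) l d).
Proof.
  induction l as [|a l IH].
  - split; simpl; intros; auto; lia.
  - destruct l as [|b l].
    + split; simpl; intros; auto; lia.
    + change (chain R (a :: b :: l)) with (R a b /\ chain R (b :: l)). rewrite IH. split.
      * intros [H1 H2] [|j] Hj; simpl in *; auto. apply (H2 j). lia.
      * intros H. split. apply (H 0); simpl; lia. intros j Hj. apply (H (S j)). simpl in *; lia.
Qed.

Lemma chain_app {A} (R : A -> A -> Prop) l1 l2 : chain R (l1 ++ l2) -> chain R l1 /\ chain R l2.
Proof.
  induction l1 as [|a l1 IH]; simpl; auto.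
  intros [H1 H2]. apply IH in H2 as [H2 H3]. repeat split; auto.
  destruct l1; simpl in *; auto.
Qed.

Lemma chain_snoc {A} (R : A -> A -> Prop) d l a : l <> [] -> chain R l -> R (last l d) a ->
  chain R (l ++ [a]).
Proof.
  induction l as [|x l IH]; [tauto|]. intros _ [H1 H2] H3.
  destruct l as [|y l]. simpl in *; auto.
  split; auto. apply IH; auto. discriminate.
Qed.

Lemma chain_map {A B} (f : A -> B) (R : B -> B -> Prop) l :
  chain R (map f l) <-> chain (fun a b => R (f a) (f b)) l.
Proof.
  induction l as [|a l IH]; simpl; [tauto|]. rewrite IH. destruct l; simpl; tauto.
Qed.

Lemma chain_impl {A} (R Q : A -> A -> Prop) l : (forall a b, R a b -> Q a b) -> chain R l -> chain Q l.
Proof. intros H. induction l as [|a l IH]; simpl; auto. destruct l; intuition. Qed.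

Lemma chain_last {A} (R : A -> A -> Prop) d a l : chain R (a :: l) ->
  last (a :: l) d = a \/ clos_trans A R a (last (a :: l) d).
Proof.
  revert a. induction l as [|b l IH]; intros a H. now left.
  destruct H as [H1 H2]. right. change (last (a :: b :: l) d) with (last (b :: l) d).
  destruct (IH b H2) as [->|H]. now apply t_step. eapply t_trans; [apply t_step|]; eauto.
Qed.

Definition reach (IS : isrl) (g : gstate) : Prop :=
  init_g IS = g \/ clos_trans gstate (tG IS) (init_g IS) g.

Definition rpath (IS : isrl) (P : list gstate) : Prop :=
  P <> [] /\ reach IS (hd [] P) /\ chain (tG IS) P.

Definition simP (i : nat) : list gstate -> list gstate -> Prop :=
  Forall2 (fun g g' => nth i g 0 = nth i g' 0).

Definition pstep (IS : isrl) (Gam : list nat) (P P' : list gstate) : Prop :=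
  rpath IS P /\ rpath IS P' /\ exists i, In i Gam /\ simP i P P'.

Fixpoint psat (IS : isrl) (f : fml) (P : list gstate) : Prop :=
  match f with
  | FPi => length P = 1
  | FVar p => lang (nth p (is_lambda IS) ReEmpty) P
  | FNeg f1 => ~ psat IS f1 P
  | FAnd f1 f2 => psat IS f1 P /\ psat IS f2 P
  | FK i f1 => forall P', rpath IS P' -> simP i P P' -> psat IS f1 P'
  | FC G f1 => forall P', clos_trans _ (pstep IS G) P P' -> psat IS f1 P'
  | FB f1 => exists P' P1, P' <> [] /\ P1 <> [] /\ P = P' ++ P1 /\ psat IS f1 P'
  | FD f1 => exists P1 P' P2, P1 <> [] /\ P' <> [] /\ P2 <> [] /\
               P = P1 ++ P' ++ P2 /\ psat IS f1 P'
  | FE f1 => exists P1 P', P1 <> [] /\ P' <> [] /\ P = P1 ++ P' /\ psat IS f1 P'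
  end.

Lemma is_mstate_chain IS s : is_mstate IS s <-> s <> [] /\ hd [] s = init_g IS /\ chain (tG IS) s.
Proof. unfold is_mstate. now rewrite (chain_nth (tG IS) [] s). Qed.

Lemma is_interval_chain IS I : is_interval IS I <->
  I <> [] /\ Forall (is_mstate IS) I /\ chain (tM IS) I.
Proof. unfold is_interval. now rewrite (chain_nth (tM IS) [] I). Qed.

Lemma reach_gof IS s : is_mstate IS s -> reach IS (gof s).
Proof.
  rewrite is_mstate_chain. intros (H1 & H2 & H3). destruct s as [|a s]; [tauto|].
  simpl in H2. subst. unfold gof, reach.
  destruct (chain_last (tG IS) [] (init_g IS) s H3); auto.
Qed.

Lemma gof_snoc s g : gof (s ++ [g]) = g.
Proof. apply last_last. Qed.

Lemma is_mstate_snoc IS s g : is_mstate IS s -> tG IS (gof s) g -> is_mstate IS (s ++ [g]).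
Proof.
  rewrite !is_mstate_chain. intros (H1 & H2 & H3) H. repeat split.
  - now destruct s.
  - now destruct s.
  - eapply chain_snoc; eauto.
Qed.

Lemma reach_mstate IS g : reach IS g -> exists s, is_mstate IS s /\ gof s = g.
Proof.
  intros [<-|H].
  - exists [init_g IS]. split; auto. apply is_mstate_chain. simpl. repeat split; auto. discriminate.
  - apply clos_trans_tn1 in H. induction H as [g H|g g' H _ (s & Hs & E)].
    + exists ([init_g IS] ++ [g]). split; [|reflexivity]. apply is_mstate_snoc; auto.
      apply is_mstate_chain. simpl. repeat split; auto. discriminate.
    + exists (s ++ [g']). split; [|apply gof_snoc]. apply is_mstate_snoc; auto. now rewrite E.
Qed.

Lemma rpath_of_interval IS I : is_interval IS I -> rpath IS (map gof I).
Proof.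
  rewrite is_interval_chain. intros (H1 & H2 & H3). repeat split.
  - destruct I; simpl; congruence.
  - destruct I; [tauto|]. inversion H2; subst. now apply reach_gof.
  - apply chain_map. eapply chain_impl; [|exact H3]. intros s s' (Hs & Hs' & g & ->).
    rewrite is_mstate_chain in Hs, Hs'. destruct Hs as (N & _ & _), Hs' as (_ & _ & Hc).
    rewrite gof_snoc. unfold gof.
    clear - N Hc. induction s as [|a s IH]; [tauto|].
    destruct s as [|b s]. simpl in *; tauto.
    change (last (a :: b :: s) []) with (last (b :: s) []). apply IH. discriminate. apply Hc.
Qed.

(** States are histories, so a path of global states lifts from any history of its first element, by
    appending one global state at a time. *)
Lemma interval_of_path IS : forall l s, is_mstate IS s -> chain (tG IS) (gof s :: l) ->
  exists J, is_interval IS (s :: J) /\ map gof J = l.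
Proof.
  induction l as [|g l IH]; intros s Hs Hc.
  - exists []. split; auto. apply is_interval_chain. simpl. repeat split; auto. discriminate.
  - destruct Hc as [H1 H2]. destruct (IH (s ++ [g])) as (J & HJ & E).
    + now apply is_mstate_snoc.
    + now rewrite gof_snoc.
    + exists ((s ++ [g]) :: J). split; [|simpl; now rewrite gof_snoc, E].
      rewrite is_interval_chain in *. destruct HJ as (_ & HF & HC).
      split; [discriminate|]. split; [auto|]. split; auto.
      split; [auto|]. split; [now apply is_mstate_snoc|]. exists g. auto.
Qed.

Lemma interval_of_rpath IS P : rpath IS P -> exists I, is_interval IS I /\ map gof I = P.
Proof.
  intros (H1 & H2 & H3). destruct P as [|g P]; [tauto|].
  destruct (reach_mstate IS g H2) as (s & Hs & <-).
  destruct (interval_of_path IS P s Hs H3) as (J & HJ & <-). eauto.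
Qed.

Lemma simI_simP i I I' : simI i I I' <-> simP i (map gof I) (map gof I').
Proof.
  unfold simI, simP. revert I'. induction I as [|s I IH]; intros [|s' I'].
  - split; auto. intros _. split; auto. simpl; lia.
  - split; intros H; [destruct H; discriminate|inversion H].
  - split; intros H; [destruct H; discriminate|inversion H].
  - simpl. split.
    + intros [H1 H2]. constructor. apply (H2 0). lia. apply IH. split. lia.
      intros j Hj. apply (H2 (S j)). lia.
    + intros H. inversion H; subst. apply IH in H5 as [H5 H6]. split. lia.
      intros [|j] Hj; auto. apply H6. lia.
Qed.

Lemma interval_app IS I1 I2 : is_interval IS (I1 ++ I2) ->
  (I1 <> [] -> is_interval IS I1) /\ (I2 <> [] -> is_interval IS I2).
Proof.
  rewrite !is_interval_chain. intros (H1 & H2 & H3).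
  apply Forall_app in H2 as [? ?]. apply chain_app in H3 as [? ?]. auto.
Qed.

Lemma map_nil_iff {A B} (f : A -> B) l : map f l <> [] <-> l <> [].
Proof. destruct l; simpl; split; congruence. Qed.

Lemma simG_pstep IS G I I' : is_interval IS I -> clos_trans _ (simGstep IS G) I I' ->
  clos_trans _ (pstep IS G) (map gof I) (map gof I').
Proof.
  intros HI H. induction H as [I I' (H1 & H2 & i & H3 & H4)|I I1 I2 H1 IH1 H2 IH2].
  - apply t_step. split; [now apply rpath_of_interval|]. split; [now apply rpath_of_interval|].
    exists i. split; auto. now apply simI_simP.
  - eapply t_trans; [apply IH1; auto|apply IH2].
    clear - H1. induction H1; auto. apply H.
Qed.

(** [simI] compares last components only, so the histories behind the intermediate paths can be
    chosen freely; only the starting interval is prescribed. *)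
Lemma pstep_simG IS G P P' : clos_trans _ (pstep IS G) P P' ->
  forall I, is_interval IS I -> map gof I = P ->
  exists I', is_interval IS I' /\ map gof I' = P' /\ clos_trans _ (simGstep IS G) I I'.
Proof.
  induction 1 as [P P' (H1 & H2 & i & H3 & H4)|P P1 P2 H1 IH1 H2 IH2]; intros I HI E.
  - destruct (interval_of_rpath IS P' H2) as (I' & HI' & E'). subst.
    exists I'. split; [auto|]. split; [auto|]. apply t_step. split; [auto|]. split; [auto|].
    exists i. split; auto. now apply simI_simP.
  - destruct (IH1 I HI E) as (I1 & A1 & A2 & A3). destruct (IH2 I1 A1 A2) as (I2 & B1 & B2 & B3).
    exists I2. split; [auto|]. split; [auto|]. eapply t_trans; eauto.
Qed.

Lemma sat_psat IS f : forall I, is_interval IS I -> (sat IS f I <-> psat IS f (map gof I)).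
Proof.
  induction f as [|p|f IH|f IH g IHg|i f IH|G f IH|f IH|f IH|f IH]; intros I HI; simpl.
  - now rewrite length_map.
  - reflexivity.
  - now rewrite (IH I HI).
  - now rewrite (IH I HI), (IHg I HI).
  - split.
    + intros H P' HP HS. destruct (interval_of_rpath IS P' HP) as (I' & HI' & <-).
      apply IH; auto. apply H; auto. now apply simI_simP.
    + intros H I' HI' HS. apply IH; auto. apply H. now apply rpath_of_interval. now apply simI_simP.
  - split.
    + intros H P' HP. destruct (pstep_simG IS G _ _ HP I HI eq_refl) as (I' & HI' & <- & HC).
      apply IH; auto.
    + intros H I' HC. apply IH.
      * clear - HC HI. induction HC; auto. apply H.
      * apply H. now apply simG_pstep.
  - split.
    + intros (I' & I1 & H1 & H2 & -> & H3). exists (map gof I'), (map gof I1).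
      rewrite !map_nil_iff, map_app. repeat split; auto. apply IH; auto.
      now apply (interval_app IS I' I1 HI).
    + intros (P' & P1 & H1 & H2 & E & H3). apply map_eq_app in E as (I' & I1 & -> & <- & <-).
      rewrite map_nil_iff in *. exists I', I1. repeat split; auto. apply IH; auto.
      now apply (interval_app IS I' I1 HI).
  - split.
    + intros (I1 & I' & I2 & H1 & H2 & H3 & -> & H4). exists (map gof I1), (map gof I'), (map gof I2).
      rewrite !map_nil_iff, !map_app. repeat split; auto. apply IH; auto.
      apply interval_app in HI as [_ HI]. apply (interval_app IS I' I2); auto.
      apply HI. destruct I'; simpl; congruence.
    + intros (P1 & P' & P2 & H1 & H2 & H3 & E & H4). apply map_eq_app in E as (I1 & I3 & -> & <- & E).
      apply map_eq_app in E as (I' & I2 & -> & <- & <-).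
      rewrite map_nil_iff in *. exists I1, I', I2. repeat split; auto. apply IH; auto.
      apply interval_app in HI as [_ HI]. apply (interval_app IS I' I2); auto.
      apply HI. destruct I'; simpl; congruence.
  - split.
    + intros (I1 & I' & H1 & H2 & -> & H3). exists (map gof I1), (map gof I').
      rewrite !map_nil_iff, map_app. repeat split; auto. apply IH; auto.
      now apply (interval_app IS I1 I' HI).
    + intros (P1 & P' & H1 & H2 & E & H3). apply map_eq_app in E as (I1 & I' & -> & <- & <-).
      rewrite map_nil_iff in *. exists I1, I'. repeat split; auto. apply IH; auto.
      now apply (interval_app IS I1 I' HI).
Qed.

(** * Reachability by repeated squaring *)

Fixpoint tcr {A : Type} (R : A -> A -> Prop) (k : nat) (x y : A) : Prop :=
  match k with
  | 0 => R x y
  | S k => tcr R k x y \/ exists z, tcr R k x z /\ tcr R k z y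
  end.

Lemma tcr_clos {A} (R : A -> A -> Prop) k : forall x y, tcr R k x y -> clos_trans A R x y.
Proof.
  induction k as [|k IH]; simpl; intros x y.
  - apply t_step.
  - intros [H|(z & H1 & H2)]; auto. eapply t_trans; eauto.
Qed.

Fixpoint walkl {A : Type} (R : A -> A -> Prop) (x : A) (l : list A) (y : A) : Prop :=
  match l with [] => x = y | a :: l => R x a /\ walkl R a l y end.

Lemma walkl_app {A} (R : A -> A -> Prop) l1 : forall x l2 y,
  walkl R x (l1 ++ l2) y <-> exists z, walkl R x l1 z /\ walkl R z l2 y.
Proof.
  induction l1 as [|a l1 IH]; intros x l2 y; simpl.
  - split; [eauto|]. now intros (z & -> & H).
  - rewrite IH. split.
    + intros (H & z & H1 & H2). eauto.
    + intros (z & (H & H1) & H2). eauto.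
Qed.

Lemma walkl_tcr {A} (R : A -> A -> Prop) k : forall x l y, walkl R x l y -> l <> [] ->
  length l <= 2 ^ k -> tcr R k x y.
Proof.
  induction k as [|k IH]; intros x l y H Hn HL.
  - destruct l as [|a [|b l]]; simpl in *; try tauto; try lia. destruct H as [H ->]. auto.
  - simpl in HL. destruct (Nat.le_gt_cases (length l) (2 ^ k)) as [C|C].
    + left. eapply IH; eauto.
    + right. rewrite <- (firstn_skipn (2 ^ k) l) in H. apply walkl_app in H as (z & H1 & H2).
      assert (0 < 2 ^ k) by (apply Nat.neq_0_lt_0, Nat.pow_nonzero; lia).
      exists z. split.
      * eapply IH; eauto.
        -- intros E. apply (f_equal (@length A)) in E. rewrite length_firstn in E. simpl in E. lia.
        -- rewrite length_firstn. lia.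
      * eapply IH; eauto.
        -- intros E. apply (f_equal (@length A)) in E. rewrite length_skipn in E. simpl in E. lia.
        -- rewrite length_skipn. lia.
Qed.

Lemma clos_walkl {A} (R : A -> A -> Prop) x y : clos_trans A R x y ->
  exists l, l <> [] /\ walkl R x l y.
Proof.
  induction 1 as [x y H|x z y _ (l1 & N1 & H1) _ (l2 & N2 & H2)].
  - exists [y]. split. discriminate. simpl; auto.
  - exists (l1 ++ l2). split. destruct l1; simpl; congruence. apply walkl_app; eauto.
Qed.

Lemma dup_split {A} (l : list A) : ~ NoDup l -> exists a l1 l2 l3, l = l1 ++ a :: l2 ++ a :: l3.
Proof.
  induction l as [|a l IH]; intros H.
  - destruct H. constructor.
  - destruct (classic (In a l)) as [I|I].
    + apply in_split in I as (l2 & l3 & ->). exists a, [], l2, l3. reflexivity.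
    + destruct IH as (b & l1 & l2 & l3 & ->). intros N. apply H. now constructor.
      exists b, (a :: l1), l2, l3. reflexivity.
Qed.

(** Of two occurrences of a vertex the cut keeps one, so the walk stays nonempty. The start [x] is
    not listed and may recur, as fits a closure that is not reflexive. *)
Lemma walkl_NoDup {A} (R : A -> A -> Prop) x y : forall n l, length l <= n -> l <> [] ->
  walkl R x l y -> exists l', l' <> [] /\ walkl R x l' y /\ NoDup l'.
Proof.
  induction n as [|n IH]; intros l HL Hn H.
  - destruct l; [tauto|simpl in HL; lia].
  - destruct (classic (NoDup l)) as [N|N]; [eauto|].
    apply dup_split in N as (a & l1 & l2 & l3 & ->).
    apply (IH (l1 ++ a :: l3)).
    + rewrite length_app in *. simpl in *. rewrite length_app in HL. simpl in HL. lia.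
    + destruct l1; discriminate.
    + apply walkl_app in H as (z & H1 & H2 & H3). apply walkl_app in H3 as (u & H3 & H4 & H5).
      apply walkl_app. exists z. split; auto. simpl. auto.
Qed.

Lemma walkl_inv {A} (R : A -> A -> Prop) (Inv : A -> Prop) l : forall x y,
  (forall u v, Inv u -> R u v -> Inv v) -> Inv x -> walkl R x l y -> Forall Inv l.
Proof.
  induction l as [|a l IH]; intros x y HI Hx H; auto.
  destruct H as [H1 H2]. constructor; eauto.
Qed.

Fixpoint bit_lists (n : nat) : list (list bool) :=
  match n with
  | 0 => [[]]
  | S n => [] :: map (cons true) (bit_lists n) ++ map (cons false) (bit_lists n)
  end.

Lemma bit_lists_in n : forall l, length l <= n -> In l (bit_lists n).
Proof.
  induction n as [|n IH]; intros [|b l] H; simpl in *; auto; try lia.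
  right. apply in_app_iff. destruct b; [left|right]; apply in_map, IH; lia.
Qed.

Lemma bit_lists_length n : length (bit_lists n) < 2 ^ (S n).
Proof.
  induction n as [|n IH]; simpl in *; auto. rewrite length_app, !length_map. lia.
Qed.

(** Counting: the vertices of a loop-free walk have distinct codes among the fewer than [2 ^ (S n)]
    bit lists of length at most [n], so the walk is short enough for level [S n]. *)
Lemma tcr_complete (R : tree -> tree -> Prop) (Inv : tree -> Prop) n x y :
  (forall u v, Inv u -> R u v -> Inv v) -> (forall u, Inv u -> sz u <= n) -> Inv x ->
  clos_trans tree R x y -> tcr R (S n) x y.
Proof.
  intros HI Hn Hx H. apply clos_walkl in H as (l & N & H).
  apply (walkl_NoDup R x y (length l) l) in H as (l' & N' & H & D); auto.
  eapply walkl_tcr; eauto.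
  pose proof (walkl_inv R Inv l' x y HI Hx H) as F.
  assert (length (map enc l') <= length (bit_lists n)).
  { apply NoDup_incl_length.
    - apply NoDup_map_inv with (f := fun x => x). rewrite map_id.
      clear - D. induction D as [|a l Ha D IH]; simpl; constructor; auto.
      intros I. apply in_map_iff in I as (b & E & I). apply enc_inj in E. subst. auto.
    - intros u I. apply in_map_iff in I as (t & <- & I). apply bit_lists_in. rewrite enc_length.
      apply Hn. rewrite Forall_forall in F. auto. }
  rewrite length_map in *. pose proof (bit_lists_length n). lia.
Qed.

(** * The game decides the model-checking problem *)

(* [r] evaluates within depth [d], to true exactly when [P] holds. *)
Definition W (e : tree) (d : nat) (r : tree) (P : Prop) : Prop :=
  exists b, ev gstep e d r b /\ (b = true <-> P).

Lemma W_iff e d r P Q : W e d r P -> (P <-> Q) -> W e d r Q.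
Proof. intros (b & H & E) HQ. exists b. split; auto. tauto. Qed.

Lemma ev_le e d r b : ev gstep e d r b -> forall d', d <= d' -> ev gstep e d' r b.
Proof.
  induction 1 as [d b|d a b c x y H1 IH1 H2 IH2|d p x H IH]; intros d' L.
  - constructor.
  - econstructor; eauto.
  - destruct d' as [|d']; [lia|]. constructor. apply IH. lia.
Qed.

Lemma W_le e d d' r P : W e d r P -> d <= d' -> W e d' r P.
Proof. intros (b & H & E) L. exists b. split; auto. eapply ev_le; eauto. Qed.

Lemma W_T e d (P : Prop) : P -> W e d rT P.
Proof. intros. exists true. split. apply (ev_B _ _ _ true). tauto. Qed.

Lemma W_F e d (P : Prop) : ~ P -> W e d rF P.
Proof. intros. exists false. split. apply (ev_B _ _ _ false). split; [discriminate|tauto]. Qed.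

(** The second conjunct is evaluated only if the first succeeds, so its specification is needed only
    under [P]. In this way later checks may presuppose that a tree is a code. *)
Lemma W_and e d a b P Q : W e d a P -> (P -> W e d b Q) -> W e d (rAnd a b) (P /\ Q).
Proof.
  intros (x & Hx & Ex) H. destruct x.
  - destruct H as (y & Hy & Ey). tauto. exists y. split. eapply ev_I; eauto. tauto.
  - exists false. split. eapply ev_I. exact Hx. apply (ev_B _ _ _ false).
    split; [discriminate|]. tauto.
Qed.

Lemma W_or e d a b P Q : W e d a P -> W e d b Q -> W e d (rOr a b) (P \/ Q).
Proof.
  intros (x & Hx & Ex) (y & Hy & Ey). destruct x.
  - exists true. split. eapply ev_I. exact Hx. apply (ev_B _ _ _ true). tauto.
  - exists y. split. eapply ev_I; eauto. split; intros; [tauto|].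
    assert (~ P) by (intros p; apply Ex in p; discriminate). tauto.
Qed.

Lemma W_not e d a P : W e d a P -> W e d (rNot a) (~ P).
Proof.
  intros (x & Hx & Ex). exists (negb x). split.
  - eapply ev_I. exact Hx. destruct x; [apply (ev_B _ _ _ false)|apply (ev_B _ _ _ true)].
  - destruct x; simpl; intuition discriminate.
Qed.

Lemma disp_nth l e a : forall k, disp l (tN k) e a = nth k l (fun _ _ => rF) e a.
Proof. induction l as [|f l IH]; intros [|k]; simpl; auto. Qed.

Lemma W_call k ru e d a P : nth k rules (fun _ _ => rF) = ru -> W e d (ru e a) P ->
  W e (S d) (call k a) P.
Proof.
  intros <- (b & H & E). exists b. split; auto. apply ev_P. unfold gstep. cbn [hd' tl'].
  now rewrite disp_nth.
Qed.

Lemma W_isLf e d x : W e d (isLf x) (x = Lf).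
Proof. destruct x; [apply W_T|apply W_F]; congruence. Qed.

Ltac wc k ru := apply (W_call k ru); [reflexivity|]; unfold ru; unf; cbn [hd' tl' tif].

Lemma W_Eq e x : forall y, W e (sz x) (call iEq (x # y)) (x = y).
Proof.
  induction x as [|a IHa b IHb]; intros [|c d]; simpl sz; wc iEq ruEq.
  - now apply W_T.
  - apply W_F. discriminate.
  - apply W_F. discriminate.
  - eapply W_iff. apply W_and; [eapply W_le; [apply IHa|lia]|intros _; eapply W_le; [apply IHb|lia]].
    split; [intros []; congruence|intros H; inversion H; auto].
Qed.

(** The depth of a comparison can be charged to either side; this version serves when the left side
    is an unchecked guess. *)
Lemma W_Eq' e y : forall x, W e (sz y) (call iEq (x # y)) (x = y).
Proof.
  induction y as [|a IHa b IHb]; intros [|c d]; simpl sz; wc iEq ruEq.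
  - now apply W_T.
  - apply W_F. discriminate.
  - apply W_F. discriminate.
  - eapply W_iff. apply W_and; [eapply W_le; [apply IHa|lia]|intros _; eapply W_le; [apply IHb|lia]].
    split; [intros []; congruence|intros H; inversion H; auto].
Qed.

Fixpoint tlen (t : tree) : nat := match t with Lf => 0 | Nd _ t => S (tlen t) end.

Lemma tlen_tN n : tlen (tN n) = n.
Proof. induction n; simpl; auto. Qed.
Lemma tlen_tL {A} (f : A -> tree) l : tlen (tL f l) = length l.
Proof. induction l; simpl; auto. Qed.

Lemma tN_inj n m : tN n = tN m -> n = m.
Proof. intros H. apply (f_equal tlen) in H. now rewrite !tlen_tN in H. Qed.

Lemma tL_inj {A} (f : A -> tree) : (forall a b, f a = f b -> a = b) ->
  forall l l', tL f l = tL f l' -> l = l'.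
Proof.
  intros H l; induction l as [|a l IH]; intros [|b l'] E; simpl in *; try discriminate; auto.
  inversion E. f_equal; auto.
Qed.

Lemma tV_inj g g' : tV g = tV g' -> g = g'.
Proof. apply tL_inj, tN_inj. Qed.
Lemma tP_inj g g' : tP g = tP g' -> g = g'.
Proof. apply tL_inj, tV_inj. Qed.

(** [y] counts by its length, whatever its entries; a numeral can thus be compared directly with the
    list of agents or with the labelling. *)
Lemma W_Lt e y : forall x, W e (sz y) (call iLt (x # y)) (exists n, x = tN n /\ n < tlen y).
Proof.
  induction y as [|a _ b IH]; intros x; simpl sz; wc iLt ruLt.
  - apply W_F. intros (n & _ & H). simpl in H. lia.
  - destruct x as [|[|] x]; cbn [hd' tl' tif].
    + apply W_T. exists 0. simpl. split; auto; lia.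
    + eapply W_iff. eapply W_le; [apply IH|lia]. simpl. split.
      * intros (n & -> & H). exists (S n). split; auto; lia.
      * intros ([|n] & E & H); inversion E. exists n. split; auto; lia.
    + apply W_F. intros ([|n] & E & H); inversion E.
Qed.

Lemma W_Nat e x : W e (sz x) (call iNat x) (exists n, x = tN n).
Proof.
  induction x as [|a _ x IH]; simpl sz; wc iNat ruNat.
  - apply W_T. now exists 0.
  - destruct a; cbn [tif].
    + eapply W_iff. eapply W_le; [apply IH|lia]. split.
      * intros [n ->]. now exists (S n).
      * intros [[|n] E]; inversion E. eauto.
    + apply W_F. intros [[|n] E]; inversion E.
Qed.

Lemma W_In {A} e (f : A -> tree) x l : W e (sz x + sz (tL f l)) (call iIn (x # tL f l))
  (exists a, In a l /\ x = f a).
Proof.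
  induction l as [|a l IH]; simpl sz.
  - replace (sz x + 1) with (S (sz x)) by lia. wc iIn ruIn. apply W_F. intros (a & [] & _).
  - replace (sz x + S (sz (f a) + sz (tL f l))) with (S (sz x + sz (f a) + sz (tL f l))) by lia.
    wc iIn ruIn. fold (tL f l).
    eapply W_iff. apply W_or; [eapply W_le; [apply W_Eq|lia]|eapply W_le; [apply IH|lia]].
    split.
    + intros [->|(b & H1 & H2)]. exists a; simpl; auto. exists b; simpl; auto.
    + intros (b & [->|H1] & H2); eauto.
Qed.

Lemma sz_tN n : sz (tN n) = 2 * n + 1.
Proof. induction n; simpl in *; lia. Qed.

Lemma W_InNth e x n : forall prot, W e (sz x + n + sz (tL tV prot) + 1) (call iInNth (x # tN n # tL tV prot))
  (exists a, In a (nth n prot []) /\ x = tN a).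
Proof.
  induction n as [|n IH]; intros prot.
  - replace (sz x + 0 + sz (tL tV prot) + 1) with (S (sz x + sz (tL tV prot))) by lia.
    wc iInNth ruInNth. destruct prot as [|l prot].
    + eapply W_le. exact (W_In e tN x []). simpl; lia.
    + eapply W_le. apply (W_In e tN x l). simpl. fold tV. change (tL tN l) with (tV l). lia.
  - replace (sz x + S n + sz (tL tV prot) + 1) with (S (sz x + n + sz (tL tV prot) + 1)) by lia.
    wc iInNth ruInNth. destruct prot as [|l prot].
    + eapply W_iff. eapply W_le. apply (IH []). lia. destruct n; simpl; tauto.
    + eapply W_le. apply (IH prot). simpl. lia.
Qed.

(* Agents whose two sizes are known to be numerals, the other components being unchecked trees. *)
Definition partial_agent : Type := (nat * tree * nat * tree * tree)%type.
Definition fA (q : partial_agent) : tree :=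
  match q with (nl, ti, na, tp, tm) => Nd (tN nl) (Nd ti (Nd (tN na) (Nd tp (Nd tm Lf)))) end.
Definition selA (s : tree) (q : partial_agent) : nat :=
  match q with (nl, ti, na, tp, tm) => match s with Lf => nl | _ => na end end.

Lemma W_Locals e s l : forall x, W e (sz (tL fA l)) (call iLocals (s # x # tL fA l))
  (exists g, x = tV g /\ Forall2 (fun v q => v < selA s q) g l).
Proof.
  induction l as [|[[[[nl ti] na] tp] tm] l IH]; intros x.
  - wc iLocals ruLocals. destruct x; cbn [tif].
    + apply W_T. exists []. split; auto.
    + apply W_F. intros (g & E & H). inversion H; subst. discriminate.
  - change (sz (tL fA ((nl, ti, na, tp, tm) :: l)))
      with (S (sz (fA (nl, ti, na, tp, tm)) + sz (tL fA l))).
    change (tL fA ((nl, ti, na, tp, tm) :: l)) with (fA (nl, ti, na, tp, tm) # tL fA l).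
    set (d := sz (fA (nl, ti, na, tp, tm)) + sz (tL fA l)).
    assert (Hd : sz (tN nl) <= d /\ sz (tN na) <= d /\ sz (tL fA l) <= d) by (unfold d; simpl; lia).
    clearbody d.
    wc iLocals ruLocals. destruct x as [|x1 x2]; cbn [tif hd' tl' fA].
    + apply W_F. intros (g & E & H). inversion H; subst. discriminate.
    + eapply W_iff. apply W_and.
      * instantiate (1 := exists n, x1 = tN n /\ n < match s with Lf => nl | _ => na end).
        destruct s; cbn [tif].
        -- eapply W_iff. eapply W_le; [apply W_Lt|lia]. now rewrite tlen_tN.
        -- eapply W_iff. eapply W_le; [apply W_Lt|lia]. now rewrite tlen_tN.
      * intros _. eapply W_le; [apply IH|lia].
      * split.
        -- intros ((n & -> & H1) & g & -> & H2). exists (n :: g). split; auto.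
        -- intros (g & E & H). inversion H as [|v q g' l' H1 H2]; subst. inversion E; subst.
           split; eauto.
Qed.

(* The trees that [n] further moves of the guessing game can produce from the stack [st]. *)
Fixpoint buildable (n : nat) (st z : tree) : Prop :=
  z = hd' st \/
  match n with
  | 0 => False
  | S n => buildable n (Lf # st) z \/ buildable n ((hd' st # hd' (tl' st)) # tl' (tl' st)) z
  end.

Lemma buildable_S n : forall st z, buildable n st z -> buildable (S n) st z.
Proof.
  induction n as [|n IH]; intros st z H.
  - destruct H as [H|[]]. now left.
  - destruct H as [H|[H|H]]; [left|right; left|right; right]; auto.
Qed.

(** Postorder with right subtrees first: one push per leaf and one join per inner node, [sz z] moves
    in all. *)
Lemma buildable_push z : forall n st w, buildable n (z # st) w -> buildable (n + sz z) st w.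
Proof.
  induction z as [|a IHa b IHb]; intros n st w H.
  - simpl sz. rewrite Nat.add_1_r. right. now left.
  - simpl sz. replace (n + S (sz a + sz b)) with ((S n + sz a) + sz b) by lia.
    apply IHb, IHa. right. right. exact H.
Qed.

Lemma buildable_complete n z : sz z <= n -> buildable n Lf z.
Proof.
  intros H. assert (G : buildable (0 + sz z) Lf z) by (apply buildable_push; now left).
  simpl in G. induction H; auto. now apply buildable_S.
Qed.

(** A move enlarges the stack by at most 4. The extreme case is a join on the empty stack, which
    reads missing entries as [Lf] and goes from size 1 to 5. *)
Lemma W_some_stack e d k args Q : forall n st,
  (forall z, sz z <= sz st + 4 * n -> W e d (call k (z # args)) (Q z)) ->
  W e (d + n + 1) (call iGuess (tN n # st # tN k # args)) (exists z, buildable n st z /\ Q z).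
Proof.
  induction n as [|n IH]; intros st H.
  - replace (d + 0 + 1) with (S d) by lia. wc iGuess ruGuess.
    eapply W_iff. apply W_or. apply H. destruct st; simpl; lia. apply (W_F e d False); auto.
    simpl. split.
    + intros [HQ|[]]. eauto.
    + intros (z & [->|[]] & HQ). auto.
  - replace (d + S n + 1) with (S (d + n + 1)) by lia. wc iGuess ruGuess. fold tN.
    eapply W_iff. apply W_or; [|apply W_or].
    + eapply W_le. apply H. destruct st; simpl; lia. lia.
    + apply IH. intros z Hz. apply H. simpl in Hz. lia.
    + apply IH. intros z Hz. apply H. destruct st as [|a [|b st]]; simpl in *; lia.
    + simpl. split.
      * intros [HQ|[(z & H1 & H2)|(z & H1 & H2)]]; eauto.
      * intros (z & [->|[H1|H1]] & HQ); eauto.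
Qed.

(** Two different bounds: candidates of size up to [4 * n + 1] can come up and must all be judged
    within depth [d], whereas a witness is sure to be built only if its size is at most [n]. *)
Lemma W_some e n d k args Q : eN e = tN n ->
  (forall z, sz z <= 4 * n + 1 -> W e d (call k (z # args)) (Q z)) ->
  (forall z, Q z -> sz z <= n) ->
  W e (d + n + 1) (guess e k args) (exists z, Q z).
Proof.
  intros E H HQ. unfold guess. rewrite E. eapply W_iff. apply (W_some_stack e d k args Q).
  - intros z Hz. apply H. simpl in Hz. lia.
  - split.
    + intros (z & _ & Hz). eauto.
    + intros (z & Hz). exists z. split; auto. apply buildable_complete; auto.
Qed.

(** The start [x] is a verified vertex while the target [y] may be any guess. Once the first half is
    confirmed, the midpoint satisfies [Inv] and can start the second half. Each level pays for one
    guess, hence the factor [n + 4]. *)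
Lemma W_TC e n kd (R : tree -> tree -> Prop) (Inv : tree -> Prop) dS : eN e = tN n ->
  (forall u v, Inv u -> R u v -> Inv v) -> (forall u, Inv u -> sz u <= n) ->
  (forall x y, sz x <= 4 * n + 1 -> sz y <= 4 * n + 1 -> W e dS (call iStep (kd # x # y)) (R x y)) ->
  forall k x y, Inv x -> sz y <= 4 * n + 1 ->
  W e (dS + 1 + k * (n + 4)) (call iTC (tN k # kd # x # y)) (tcr R k x y).
Proof.
  intros E HI Hn HS.
  assert (HC : forall k x z, Inv x -> tcr R k x z -> Inv z).
  { intros k x z Hx H. apply tcr_clos in H. induction H; eauto. }
  induction k as [|k IH]; intros x y Hx Hy.
  - replace (dS + 1 + 0 * (n + 4)) with (S dS) by lia. wc iTC ruTC. apply HS; auto.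
    specialize (Hn x Hx). lia.
  - replace (dS + 1 + S k * (n + 4)) with (S ((S (dS + 1 + k * (n + 4)) + n + 1) + 1)) by lia.
    apply (W_call iTC ruTC); [reflexivity|]. unfold ruTC, p1, q1; cbn [hd' tl' tif tN].
    apply W_or.
    + eapply W_le; [apply IH; auto|lia].
    + eapply W_le; [apply (W_some e n) with (Q := fun z => tcr R k x z /\ tcr R k z y); auto|].
      * intros z Hz. wc iTCmid ruTCmid. apply W_and. apply IH; auto.
        intros H. apply IH; eauto.
      * intros z [H _]. eauto.
      * lia.
Qed.

(** * Transitions, similarity and regular expressions in the game *)

Definition pre (ag : agent) : partial_agent :=
  (ag_nloc ag, tN (ag_init ag), ag_nact ag, tL tV (ag_prot ag), tL tTr (ag_trans ag)).

Lemma tAg_pre l : tL tAg l = tL fA (map pre l).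
Proof. rewrite tL_map. reflexivity. Qed.

Lemma Forall2_map_r {A B C} (R : A -> C -> Prop) (f : B -> C) l : forall l',
  Forall2 R l (map f l') <-> Forall2 (fun a b => R a (f b)) l l'.
Proof.
  induction l as [|a l IH]; intros [|b l']; simpl; split; intros H; inversion H; subst; auto;
  constructor; auto; apply IH; auto.
Qed.

Lemma hd_tV g : hd' (tV g) = tN (hd 0 g).
Proof. destruct g; reflexivity. Qed.
Lemma tl_tV g : tl' (tV g) = tV (tl g).
Proof. destruct g; reflexivity. Qed.

Lemma sz_hd_tV g : hd 0 g + sz (tN (hd 0 g)) <= 2 * sz (tV g) /\ sz (tN (hd 0 g)) <= sz (tV g).
Proof. destruct g as [|a g]; simpl; [lia|]. rewrite sz_tN. simpl. lia. Qed.
Lemma sz_tl_tV g : sz (tV (tl g)) <= sz (tV g).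
Proof. destruct g; simpl; lia. Qed.

Lemma tTr_inj t u : tTr t = tTr u -> t = u.
Proof.
  destruct t as [[l a] l'], u as [[m b] m']. simpl. intros H. inversion H.
  apply tN_inj in H1, H3. apply tV_inj in H2. congruence.
Qed.

Fixpoint protOK (l : list agent) (g z : list nat) : Prop :=
  match l with
  | [] => True
  | ag :: l => In (hd 0 z) (nth (hd 0 g) (ag_prot ag) []) /\ protOK l (tl g) (tl z)
  end.

Fixpoint trnOK (l : list agent) (g g' z : list nat) : Prop :=
  match l with
  | [] => True
  | ag :: l => In (hd 0 g, z, hd 0 g') (ag_trans ag) /\ trnOK l (tl g) (tl g') z
  end.

(** Two copies of the joint action: [z] is consumed along the agents for the protocols, [z0] stays
    whole inside every transition. *)
Lemma prot_trn_nth z0 l : forall g g' z,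
  (protOK l g z /\ trnOK l g g' z0) <->
  forall i, i < length l ->
      In (nth i z 0) (nth (nth i g 0) (ag_prot (nth i l dflt_agent)) []) /\
      In (nth i g 0, z0, nth i g' 0) (ag_trans (nth i l dflt_agent)).
Proof.
  assert (E : forall (l : list nat), hd 0 l = nth 0 l 0) by (intros []; auto).
  assert (E' : forall (l : list nat) i, nth i (tl l) 0 = nth (S i) l 0) by (intros [|] []; auto).
  induction l as [|ag l IH]; intros g g' z; simpl.
  - split; auto. intros _ i Hi. lia.
  - split.
    + intros [[H1 H2] [H3 H4]] [|i] Hi.
      * rewrite <- !E. auto.
      * rewrite <- !E'. apply IH; auto. lia.
    + intros H. pose proof (H 0 ltac:(lia)) as [H1 H2]. rewrite <- !E in *.
      assert (protOK l (tl g) (tl z) /\ trnOK l (tl g) (tl g') z0); [|tauto].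
      apply IH. intros i Hi. rewrite !E'. apply (H (S i)). lia.
Qed.

Lemma W_Prot e l : forall g z, W e (sz (tV g) + sz (tV z) + sz (tL tAg l) + sz (tV g))
  (call iProt (tV g # tV z # tL tAg l)) (protOK l g z).
Proof.
  induction l as [|ag l IH]; intros g z.
  - eapply W_le with 1; [|simpl; lia]. wc iProt ruProt. now apply W_T.
  - change (tL tAg (ag :: l)) with (tAg ag # tL tAg l).
    set (d := sz (tV g) + sz (tV z) + (sz (tAg ag) + sz (tL tAg l)) + sz (tV g)).
    replace (sz (tV g) + _ + _ + _) with (S d) by (unfold d; simpl; lia).
    assert (Hd : sz (tN (hd 0 z)) + hd 0 g + sz (tL tV (ag_prot ag)) + 1 <= d).
    { pose proof (sz_hd_tV g). pose proof (sz_hd_tV z). pose proof (sz_pos (tN (hd 0 g))).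
      unfold d; simpl; lia. }
    assert (Hd' : sz (tV (tl g)) + sz (tV (tl z)) + sz (tL tAg l) + sz (tV (tl g)) <= d).
    { pose proof (sz_tl_tV g). pose proof (sz_tl_tV z). unfold d; lia. }
    clearbody d. wc iProt ruProt. rewrite !hd_tV, !tl_tV. apply W_and.
    + eapply W_iff. eapply W_le; [apply W_InNth|exact Hd].
      split; [|eauto]. intros (a & H & E). apply tN_inj in E. now subst.
    + intros _. eapply W_le; [apply IH|exact Hd'].
Qed.

Lemma W_Trans e z l : forall g g', W e (sz (tV g) + sz (tV g') + sz (tV z) + sz (tL tAg l) + 4)
  (call iTrans (tV g # tV g' # tV z # tL tAg l)) (trnOK l g g' z).
Proof.
  induction l as [|ag l IH]; intros g g'.
  - eapply W_le with 1; [|simpl; lia]. wc iTrans ruTrans. now apply W_T.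
  - change (tL tAg (ag :: l)) with (tAg ag # tL tAg l).
    set (d := sz (tV g) + sz (tV g') + sz (tV z) + (sz (tAg ag) + sz (tL tAg l)) + 4).
    replace (sz (tV g) + _ + _ + _ + 4) with (S d) by (unfold d; simpl; lia).
    assert (Hd : sz (tTr (hd 0 g, z, hd 0 g')) + sz (tL tTr (ag_trans ag)) <= d).
    { pose proof (sz_hd_tV g). pose proof (sz_hd_tV g'). unfold d; simpl; lia. }
    assert (Hd' : sz (tV (tl g)) + sz (tV (tl g')) + sz (tV z) + sz (tL tAg l) + 4 <= d).
    { pose proof (sz_tl_tV g). pose proof (sz_tl_tV g'). unfold d; lia. }
    clearbody d. wc iTrans ruTrans. rewrite !hd_tV, !tl_tV. apply W_and.
    + eapply W_iff. eapply W_le; [|exact Hd]. apply (W_In e tTr (tTr (hd 0 g, z, hd 0 g'))).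
      split; [|eauto]. intros (a & H & E). apply tTr_inj in E. now subst.
    + intros _. eapply W_le; [apply IH|exact Hd'].
Qed.

Lemma W_Init e l : forall x, W e (sz (tL tAg l)) (call iInit (x # tL tAg l)) (x = tV (map ag_init l)).
Proof.
  induction l as [|ag l IH]; intros x.
  - simpl sz. wc iInit ruInit. apply W_isLf.
  - change (tL tAg (ag :: l)) with (tAg ag # tL tAg l). simpl sz.
    set (d := sz (tAg ag) + sz (tL tAg l)).
    assert (Hd : sz (tN (ag_init ag)) <= d /\ sz (tL tAg l) <= d) by (unfold d; simpl; lia).
    change (S _) with (S d). clearbody d. wc iInit ruInit. destruct x as [|a x]; cbn [tif hd' tl'].
    + apply W_F. discriminate.
    + eapply W_iff. apply W_and; [eapply W_le; [apply W_Eq'|apply Hd]|].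
      intros _. eapply W_le; [apply IH|apply Hd].
      simpl. split; [intros [-> ->]; auto|intros H; inversion H; auto].
Qed.

Lemma W_SameLoc e i : forall g g', W e (i + sz (tV g) + 1) (call iSameLoc (tN i # tV g # tV g'))
  (nth i g 0 = nth i g' 0).
Proof.
  assert (E : forall (l : list nat), hd 0 l = nth 0 l 0) by (intros []; auto).
  assert (E' : forall (l : list nat) i, nth i (tl l) 0 = nth (S i) l 0) by (intros [|] []; auto).
  induction i as [|i IH]; intros g g'.
  - replace (0 + sz (tV g) + 1) with (S (sz (tV g))) by lia. wc iSameLoc ruSameLoc. rewrite !hd_tV, <- !E.
    eapply W_iff. eapply W_le; [apply W_Eq|apply sz_hd_tV]. split; [apply tN_inj|congruence].
  - replace (S i + sz (tV g) + 1) with (S (i + sz (tV g) + 1)) by lia. wc iSameLoc ruSameLoc. fold tN.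
    rewrite !tl_tV, <- !E'. eapply W_le; [apply IH|]. pose proof (sz_tl_tV g). lia.
Qed.

Lemma W_Sim e i P : forall P', W e (i + sz (tP P) + 1) (call iSim (tN i # tP P # tP P')) (simP i P P').
Proof.
  induction P as [|g P IH]; intros P'.
  - replace (i + sz (tP []) + 1) with (S (i + 1)) by (simpl; lia). wc iSim ruSim.
    eapply W_iff. apply W_isLf. destruct P'; simpl; split; intros H; auto; try discriminate.
    constructor. inversion H.
  - change (tP (g :: P)) with (tV g # tP P). simpl sz.
    replace (i + S (sz (tV g) + sz (tP P)) + 1) with (S (i + (sz (tV g) + sz (tP P)) + 1)) by lia.
    wc iSim ruSim. destruct P' as [|g' P'].
    + apply W_F. intros H; inversion H.
    + change (tP (g' :: P')) with (tV g' # tP P'). cbn [tif hd' tl'].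
      eapply W_iff. apply W_and; [eapply W_le; [apply W_SameLoc|lia]|intros _; eapply W_le; [apply IH|]].
      pose proof (sz_pos (tV g)). lia.
      split; [intros []; constructor; auto|intros H; inversion H; auto].
Qed.

Lemma W_SomeSim e P P' G : W e (sz (tV G) + sz (tP P) + 1) (call iSomeSim (tV G # tP P # tP P'))
  (exists i, In i G /\ simP i P P').
Proof.
  induction G as [|i G IH].
  - replace (sz (tV []) + sz (tP P) + 1) with (S (sz (tP P) + 1)) by (simpl; lia). wc iSomeSim ruSomeSim.
    apply W_F. intros (i & [] & _).
  - change (tV (i :: G)) with (tN i # tV G). simpl sz.
    replace (S (sz (tN i) + sz (tV G)) + sz (tP P) + 1) with (S (sz (tN i) + sz (tV G) + sz (tP P) + 1)) by lia.
    wc iSomeSim ruSomeSim. eapply W_iff. apply W_or; eapply W_le; [apply W_Sim|rewrite sz_tN; lia|apply IH|lia].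
    split.
    + intros [H|(j & H1 & H2)]. exists i; simpl; auto. exists j; simpl; auto.
    + intros (j & [->|H1] & H2); eauto.
Qed.

Lemma W_App e w : forall u v, W e (sz (tP w) + 1) (call iApp (u # v # tP w))
  (exists u' v', u = tP u' /\ v = tP v' /\ w = u' ++ v').
Proof.
  induction w as [|g w IH]; intros u v.
  - simpl sz. wc iApp ruApp. destruct u as [|a u]; cbn [tif].
    + eapply W_iff. eapply W_le; [apply W_Eq'|simpl; lia]. split.
      * intros ->. exists [], []. auto.
      * intros (u' & v' & E & -> & E'). symmetry in E'. apply app_eq_nil in E' as [-> ->]. auto.
    + apply W_F. intros (u' & v' & E & -> & E'). symmetry in E'. apply app_eq_nil in E' as [-> ->].
      discriminate.
  - change (tP (g :: w)) with (tV g # tP w).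
    replace (sz (tV g # tP w) + 1) with (S (sz (tV g) + sz (tP w) + 1)) by (simpl; lia).
    wc iApp ruApp. destruct u as [|a u]; cbn [tif hd' tl'].
    + eapply W_iff. eapply W_le; [apply W_Eq'|simpl; lia]. split.
      * intros ->. exists [], (g :: w). auto.
      * intros ([|g' u'] & v' & E & -> & E'); [|discriminate]. simpl in E'. now subst.
    + eapply W_iff. apply W_and; [eapply W_le; [apply W_Eq'|lia]|intros _; eapply W_le; [apply IH|lia]].
      split.
      * intros (-> & u' & v' & -> & -> & ->). exists (g :: u'), v'. auto.
      * intros ([|g' u'] & v' & E & -> & E'); [discriminate|]. inversion E. inversion E'; subst.
        split; eauto.
Qed.

Lemma lang_star_inv {X} (r : re X) w : lang (ReStar r) w <->
  w = [] \/ exists u v, u <> [] /\ w = u ++ v /\ lang r u /\ lang (ReStar r) v.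
Proof.
  split.
  - intros H. remember (ReStar r) as s eqn:E. induction H; try discriminate; inversion E; subst; auto.
    destruct u as [|x u].
    + apply IHlang2; auto.
    + right. exists (x :: u), v. repeat split; auto. discriminate.
  - intros [->|(u & v & _ & -> & H1 & H2)]. constructor. now apply lang_starS.
Qed.

Lemma sz_tP_app u v : sz (tP (u ++ v)) + 1 = sz (tP u) + sz (tP v).
Proof.
  induction u as [|g u IH]; simpl. lia. fold (tP (u ++ v)). fold (tP u). lia.
Qed.

(** Shared by concatenation, star, [B] and [E], all of which guess a word cut in two. The pair of
    codes has size [sz (tP w) + 2], whence the condition on [n]. *)
Lemma W_split e n d k ru args w body (Q : list gstate -> list gstate -> Prop) :
  eN e = tN n -> nth k rules (fun _ _ => rF) = ru ->
  (forall z, ru e (z # args) = rAnd (call iApp (hd' z # tl' z # tP w)) (body z)) ->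
  sz (tP w) + 2 <= n -> sz (tP w) + 1 <= d ->
  (forall u v z, w = u ++ v -> hd' z = tP u -> tl' z = tP v -> W e d (body z) (Q u v)) ->
  W e (d + n + 2) (guess e k args) (exists u v, w = u ++ v /\ Q u v).
Proof.
  intros En Ek Er Hn Hd HB.
  eapply W_iff.
  - eapply W_le; [apply (W_some e n (S d)) with
      (Q := fun z => exists u v, hd' z = tP u /\ tl' z = tP v /\ w = u ++ v /\ Q u v); auto|lia].
    + intros z _. apply (W_call k ru); auto. rewrite Er. eapply W_iff.
      * apply W_and; [eapply W_le; [apply W_App|lia]|].
        intros (u & v & E1 & E2 & E3).
        instantiate (1 := exists u v, hd' z = tP u /\ tl' z = tP v /\ w = u ++ v /\ Q u v).
        eapply W_iff. apply (HB u v z); auto. split; [intros; exists u, v; auto|].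
        intros (u' & v' & E1' & E2' & _ & H). rewrite E1 in E1'. rewrite E2 in E2'.
        apply tP_inj in E1', E2'. now subst.
      * split; [tauto|]. intros (u & v & E1 & E2 & E3 & H). split; eauto 7.
    + intros z (u & v & E1 & E2 & -> & _). pose proof (sz_tP_app u v).
      destruct z; simpl in *; subst; lia.
  - split.
    + intros (z & u & v & _ & _ & H). eauto.
    + intros (u & v & H). exists (tP u # tP v), u, v. auto.
Qed.

Lemma tRe_S r k : 1 <= k -> exists d, sz (tRe r) * k = S d /\ k <= S d /\
  match r with
  | ReSeq r1 r2 | ReAlt r1 r2 => sz (tRe r1) * k + sz (tRe r2) * k + k <= d
  | ReStar r1 => sz (tRe r1) * k + k <= d
  | _ => k <= d
  end.
Proof.
  intros Hk. exists (sz (tRe r) * k - 1).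
  assert (H : match r with
  | ReSeq r1 r2 | ReAlt r1 r2 => sz (tRe r1) + sz (tRe r2) + 3 <= sz (tRe r)
  | ReStar r1 => sz (tRe r1) + 3 <= sz (tRe r)
  | _ => 3 <= sz (tRe r)
  end) by (destruct r; simpl; lia).
  pose proof (sz_pos (tRe r)). destruct r; nia.
Qed.

(** Every node of the expression is granted depth [(M + 1) * c]: a star is unfolded at most once per
    letter, and [c] covers the guess and the check of one unfolding. *)
Lemma W_Re e n M : eN e = tN n -> M + 2 <= n -> forall r w, sz (tP w) <= M ->
  W e (sz (tRe r) * ((M + 1) * (n + M + 6))) (call iRe (tRe r # tP w)) (lang r w).
Proof.
  intros En HM. set (c := n + M + 6). set (k := (M + 1) * c).
  assert (Hk : 1 <= k) by (unfold k, c; nia).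
  assert (Hkc : c <= k) by (unfold k; nia).
  assert (HW : forall w, length w + 1 <= sz (tP w)).
  { clear. unfold tP. induction w; simpl; lia. }
  induction r as [| |x|r1 IH1 r2 IH2|r1 IH1 r2 IH2|r1 IH1]; intros w Hw;
    match goal with |- W _ (sz (tRe ?r) * _) _ _ => destruct (tRe_S r k Hk) as (d & Ed & Hd & Hr); simpl in Hr end;
    try match goal with |- W _ _ (call iRe (tRe (ReStar _) # _)) _ => fail 1 | _ =>
      rewrite Ed; clear Ed; apply (W_call iRe ruRe); [reflexivity|]; unfold ruRe; unf;
         cbn [tRe tnode tL fold_right tN hd' tl' tif] end.
  - apply W_F. intros H; inversion H.
  - eapply W_iff. apply W_isLf. destruct w; split; intros H; try discriminate; auto.
    constructor. inversion H.
  - destruct w as [|g [|g' w]]; cbn [tP tL fold_right tif hd' tl'].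
    + apply W_F. intros H; inversion H.
    + eapply W_iff. eapply W_le; [apply W_Eq|]. simpl in Hw. unfold c in *; lia.
      split; [intros H; apply tV_inj in H; subst; constructor|intros H; now inversion H].
    + apply W_F. intros H; inversion H.
  - eapply W_iff.
    + eapply W_le; [apply (W_split e n (sz (tRe r1) * k + sz (tRe r2) * k + M + 1) iSeqSplit ruSeqSplit) with
        (w := w) (Q := fun u v => lang r1 u /\ lang r2 v)
        (body := fun z => rAnd (call iRe (tRe r1 # hd' z)) (call iRe (tRe r2 # tl' z)));
        auto; try lia|unfold c in *; lia].
      intros u v z -> -> ->. pose proof (sz_tP_app u v). pose proof (sz_pos (tP u)). pose proof (sz_pos (tP v)).
      apply W_and; [|intros _]; (eapply W_le; [apply IH1 || apply IH2; lia|lia]).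
    + split.
      * intros (u & v & -> & H1 & H2). now constructor.
      * intros H. inversion H; subst. eauto.
  - eapply W_iff. apply W_or; [eapply W_le; [apply IH1; lia|lia]|eapply W_le; [apply IH2; lia|lia]].
    split; [intros []; [now apply lang_altl|now apply lang_altr]|intros H; inversion H; auto].
  (* The star calls itself, so structural induction on [r] is complemented by induction on the
     length of the word. *)
  - assert (G : forall m w, length w <= m -> sz (tP w) <= M ->
      W e (sz (tRe r1) * k + (m + 1) * c) (call iRe (tRe (ReStar r1) # tP w)) (lang (ReStar r1) w)).
    { clear w Hw Ed Hd Hr d. induction m as [|m IHm]; intros w Hm Hw.
      - eapply W_le with 1; [|unfold c; lia].
        apply (W_call iRe ruRe); [reflexivity|]; unfold ruRe; unf;
         cbn [tRe tnode tL fold_right tN hd' tl' tif]. destruct w; [|simpl in Hm; lia].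
        apply W_T. constructor.
      - replace (sz (tRe r1) * k + (S m + 1) * c) with (S (sz (tRe r1) * k + (m + 1) * c + c - 1)) by (unfold c; lia).
        apply (W_call iRe ruRe); [reflexivity|]; unfold ruRe; unf;
         cbn [tRe tnode tL fold_right tN hd' tl' tif].
        destruct w as [|g w].
        { apply W_T. constructor. }
        cbn [tP tL fold_right tif]. change (tV g # fold_right _ Lf w) with (tP (g :: w)).
        eapply W_iff; [|symmetry; apply lang_star_inv].
        eapply W_iff.
        + eapply W_le; [apply (W_split e n (sz (tRe r1) * k + (m + 1) * c + M + 1) iStarSplit ruStarSplit) with
          (w := g :: w) (Q := fun u v => u <> [] /\ lang r1 u /\ lang (ReStar r1) v)
          (body := fun z => tif (hd' z) (rAnd (call iRe (tRe r1 # hd' z)) (call iRe (tRe (ReStar r1) # tl' z))) rF);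
          auto; try lia|unfold c; lia].
          intros u v z Ew -> ->.
          rewrite Ew in *. pose proof (sz_tP_app u v). pose proof (sz_pos (tP u)). pose proof (sz_pos (tP v)).
          destruct u as [|g' u]; cbn [tP tL fold_right tif].
          * apply W_F. tauto.
          * change (tV g' # fold_right _ Lf u) with (tP (g' :: u)).
            eapply W_iff.
            { apply W_and; [eapply W_le; [apply IH1; lia|lia]|intros _; eapply W_le; [apply IHm|lia]].
              rewrite length_app in Hm. simpl in Hm. lia. lia. }
            intuition discriminate.
        + split.
          * intros (u & v & H1 & H2 & H3 & H4). right. exists u, v. auto.
          * intros [H|(u & v & H2 & H1 & H3 & H4)]; [discriminate|]. exists u, v. auto. }
    eapply W_le. apply (G (length w) w); auto. rewrite Ed.
    assert ((length w + 1) * c <= k) by (unfold k; apply Nat.mul_le_mono_r; specialize (HW w); lia).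
    lia.
Qed.

(** * Paths and satisfaction in the game *)

Definition tAs (IS : isrl) : tree := tL tAg (is_agents IS).
Definition env (IS : isrl) (n : nat) : tree := tN n # tAs IS # tL tRe (is_lambda IS).

Lemma W_valid_gstate e IS x : W e (sz (tAs IS)) (call iLocals (Lf # x # tAs IS))
  (exists g, x = tV g /\ valid_gstate IS g).
Proof.
  unfold tAs. rewrite tAg_pre. eapply W_iff. apply W_Locals.
  split; intros (g & E & H); exists g; split; auto;
  now apply (Forall2_map_r (fun v q => v < selA Lf q) pre g (is_agents IS)).
Qed.

Lemma W_valid_joint e IS x : W e (sz (tAs IS)) (call iLocals (rT # x # tAs IS))
  (exists g, x = tV g /\ valid_joint IS g).
Proof.
  unfold tAs. rewrite tAg_pre. eapply W_iff. apply W_Locals.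
  split; intros (g & E & H); exists g; split; auto;
  now apply (Forall2_map_r (fun v q => v < selA rT q) pre g (is_agents IS)).
Qed.

Lemma valid_sz IS g : valid_gstate IS g -> sz (tV g) <= sz (tAs IS).
Proof.
  unfold valid_gstate, tAs. induction 1 as [|v ag g l H _ IH]; simpl; auto.
  pose proof (sz_tN v). pose proof (sz_tN (ag_nloc ag)). fold (tV g) (tL tAg l). lia.
Qed.

Lemma joint_sz IS g : valid_joint IS g -> sz (tV g) <= sz (tAs IS).
Proof.
  unfold valid_joint, tAs. induction 1 as [|v ag g l H _ IH]; simpl; auto.
  pose proof (sz_tN v). pose proof (sz_tN (ag_nact ag)). fold (tV g) (tL tAg l). lia.
Qed.

Lemma tG_alt IS g g' : tG IS g g' <-> valid_gstate IS g /\ valid_gstate IS g' /\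
  exists z, valid_joint IS z /\ protOK (is_agents IS) g z /\ trnOK (is_agents IS) g g' z.
Proof.
  unfold tG, agent_of. split; intros (H1 & H2 & z & H3 & H4); repeat split; auto; exists z; split; auto;
  now apply prot_trn_nth.
Qed.

(** The squaring rule also meets guesses that code no global state. Moving the relation to trees
    lets it be decided on those as well, where it fails. *)
Definition tGt (IS : isrl) (x y : tree) : Prop :=
  exists g g', x = tV g /\ y = tV g' /\ tG IS g g'.

Lemma clos_tGt IS g y : clos_trans _ (tGt IS) (tV g) y <->
  exists g', y = tV g' /\ clos_trans _ (tG IS) g g'.
Proof.
  split.
  - intros H. remember (tV g) as x eqn:E. revert g E.
    induction H as [x y (g1 & g2 & -> & -> & H)|x y z _ IH1 _ IH2]; intros g E.
    + apply tV_inj in E. subst. exists g2. split; auto. now apply t_step.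
    + destruct (IH1 g E) as (g1 & E1 & H1). destruct (IH2 g1 E1) as (g2 & E2 & H2).
      exists g2. split; auto. eapply t_trans; eauto.
  - intros (g' & -> & H). induction H as [g g' H|g g1 g2 _ IH1 _ IH2].
    + apply t_step. exists g, g'. auto.
    + eapply t_trans; eauto.
Qed.

Definition pstepT (IS : isrl) (G : list nat) (x y : tree) : Prop :=
  exists P P', x = tP P /\ y = tP P' /\ pstep IS G P P'.

Lemma clos_pstepT IS G P y : clos_trans _ (pstepT IS G) (tP P) y <->
  exists P', y = tP P' /\ clos_trans _ (pstep IS G) P P'.
Proof.
  split.
  - intros H. remember (tP P) as x eqn:E. revert P E.
    induction H as [x y (g1 & g2 & -> & -> & H)|x y z _ IH1 _ IH2]; intros g E.
    + apply tP_inj in E. subst. exists g2. split; auto. now apply t_step.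
    + destruct (IH1 g E) as (g1 & E1 & H1). destruct (IH2 g1 E1) as (g2 & E2 & H2).
      exists g2. split; auto. eapply t_trans; eauto.
  - intros (g' & -> & H). induction H as [g g' H|g g1 g2 _ IH1 _ IH2].
    + apply t_step. exists g, g'. auto.
    + eapply t_trans; eauto.
Qed.

Fixpoint tchain (R : tree -> tree -> Prop) (a : tree) : Prop :=
  match a with
  | Nd x t => match t with Nd y _ => R x y | Lf => True end /\ tchain R t
  | Lf => True
  end.

Lemma tchain_iff IS g t : tchain (tGt IS) (tV g # t) <-> exists P, t = tP P /\ chain (tG IS) (g :: P).
Proof.
  revert g. induction t as [|y _ t IH]; intros g.
  - split; [|now simpl]. intros _. exists []. simpl. auto.
  - cbn [tchain]. split.
    + intros [(g1 & g2 & E1 & -> & H) Ht]. apply tV_inj in E1. subst.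
      apply IH in Ht as (P & -> & Hc). exists (g2 :: P). split; auto. split; auto.
    + intros ([|g' P] & E & Hc); [discriminate|]. simpl in E. inversion E; subst.
      destruct Hc as [H Hc]. split. exists g, g'. auto.
      change (tchain (tGt IS) (tV g' # tP P)). apply IH. eauto.
Qed.

Lemma reach_valid IS g : valid_gstate IS (init_g IS) -> reach IS g -> valid_gstate IS g.
Proof.
  intros Hi [<-|H]; auto. apply clos_trans_tn1 in H. destruct H; apply H.
Qed.

Lemma rpath_valid IS P : valid_gstate IS (init_g IS) -> rpath IS P -> Forall (valid_gstate IS) P.
Proof.
  intros Hi (H1 & H2 & H3). destruct P as [|g P]; [tauto|]. simpl in H2.
  apply reach_valid in H2; auto. clear H1. revert g H2 H3.
  induction P as [|g' P IH]; intros g Hg Hc; auto. destruct Hc as [H Hc].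
  constructor; auto. apply IH; auto. apply H.
Qed.

Lemma path_sz IS P m : Forall (valid_gstate IS) P -> length P <= m ->
  sz (tP P) <= m * (sz (tAs IS) + 1) + 1.
Proof.
  intros H. revert m. induction H as [|g P Hg _ IH]; intros m Hm; simpl in *. lia.
  destruct m as [|m]; [lia|]. specialize (IH m ltac:(lia)). fold (tP P).
  pose proof (valid_sz IS g Hg). lia.
Qed.

Section Game.
Variables (IS : isrl) (n ell : nat).
Hypothesis Hinit : valid_gstate IS (init_g IS).
Hypothesis HA : sz (tAs IS) <= n.
(** By [path_sz] a path of length [ell] has a code of size at most [ell * (sz (tAs IS) + 1) + 1];
    the 2 more leave room for guessing it as a pair of factors. *)
Hypothesis Hell : ell * (sz (tAs IS) + 1) + 3 <= n.

Notation e := (env IS n).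
Notation A := (tAs IS).
Notation B := (4 * n + 1).

Ltac envs :=
  change (hd' (tl' e)) with A; change (tl' (tl' e)) with (tL tRe (is_lambda IS));
  change (hd' e) with (tN n).
Ltac wce k ru := wc k ru; envs.

Definition depth_TG := 4 * sz A + n + 20.

Lemma W_TG x y : W e depth_TG (call iTG (x # y)) (tGt IS x y).
Proof.
  clear Hell ell.
  unfold depth_TG. replace (4 * sz A + n + 20) with (S (4 * sz A + n + 19)) by lia.
  apply (W_call iTG ruTG); [reflexivity|]; unfold ruTG, p1, q1, eA; cbn [hd' tl']; envs.
  eapply W_iff.
  - apply W_and; [eapply W_le; [apply W_valid_gstate|lia]|intros (g & -> & Hg)].
    (* The remaining conjuncts must have a meaning without the first one, so they introduce their
       own witnesses; injectivity of [tV] identifies these later. Other specifications below are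
       built the same way. *)
    instantiate (1 := (exists g', y = tV g' /\ valid_gstate IS g') /\
      exists z g g', x = tV g /\ y = tV g' /\ valid_joint IS z /\
        protOK (is_agents IS) g z /\ trnOK (is_agents IS) g g' z).
    apply W_and; [eapply W_le; [apply W_valid_gstate|lia]|intros (g' & -> & Hg')].
    eapply W_iff.
    + eapply W_le; [apply (W_some e n (4 * sz A + 10)) with (Q := fun t => exists z, t = tV z /\
         valid_joint IS z /\ protOK (is_agents IS) g z /\ trnOK (is_agents IS) g g' z); auto|lia].
      * intros t _. replace (4 * sz A + 10) with (S (4 * sz A + 9)) by lia. wce iJoint ruJoint.
        eapply W_iff. apply W_and; [eapply W_le; [apply W_valid_joint|lia]|intros (z & -> & Hz)].
        -- instantiate (1 := exists z, t = tV z /\ protOK (is_agents IS) g z /\ trnOK (is_agents IS) g g' z).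
           pose proof (valid_sz IS g Hg). pose proof (valid_sz IS g' Hg'). pose proof (joint_sz IS z Hz).
           eapply W_iff. apply W_and; [eapply W_le; [apply W_Prot|unfold tAs in *; lia]|].
           intros _. eapply W_le; [apply W_Trans|unfold tAs in *; lia].
           split; [intros; exists z; auto|]. intros (z' & E & ?). apply tV_inj in E. now subst.
        -- split.
           ++ intros [(z & -> & H1) (z' & E & H2)]. apply tV_inj in E. subst. eauto.
           ++ intros (z & -> & H1 & H2). split; eauto.
      * intros t (z & -> & Hz & _). pose proof (joint_sz IS z Hz). lia.
    + split.
      * intros (t & z & _ & H). exists z, g, g'. tauto.
      * intros (z & g1 & g2 & E1 & E2 & H). apply tV_inj in E1, E2. subst. exists (tV z), z. tauto.
  - unfold tGt. split.
    + intros ((g & -> & Hg) & (g' & -> & Hg') & z & g1 & g2 & E1 & E2 & H). apply tV_inj in E1, E2.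
      subst. exists g1, g2. repeat split; auto. apply tG_alt. eauto 6.
    + intros (g & g' & -> & -> & H). apply tG_alt in H as (H1 & H2 & z & H3). split; eauto. split; eauto.
      exists z, g, g'. tauto.
Qed.

Definition depth_Reach := depth_TG + (n + 2) * (n + 4) + n + 10.

Lemma W_Reach x : sz x <= B -> W e depth_Reach (call iReach x) (exists g, x = tV g /\ reach IS g).
Proof.
  intros Hx. unfold depth_Reach.
  set (d := S depth_TG + 1 + S n * (n + 4)).
  assert (HdA : sz A <= depth_TG) by (unfold depth_TG; lia).
  eapply W_le with (S (S d + n + 1)); [|unfold d; lia].
  wce iReach ruReach. eapply W_iff.
  - apply W_or; [eapply W_le; [apply W_Init|unfold d, tAs in *; lia]|].
    apply (W_some e n (S d)) with (Q := fun z => z = tV (init_g IS) /\ tcr (tGt IS) (S n) z x); auto.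
    + intros z _. wce iReachVia ruReachVia. apply W_and; [eapply W_le; [apply W_Init|unfold d, tAs in *; lia]|].
      (* One level more than the budget, as [tcr_complete] demands. *)
      intros ->. change (Lf # tN n) with (tN (S n)).
      apply (W_TC e n Lf (tGt IS) (fun x => exists g, x = tV g /\ valid_gstate IS g)); auto.
      * intros u v _ (g & g' & _ & -> & H). exists g'. split; auto. apply H.
      * intros u (g & -> & H). apply valid_sz in H. lia.
      * intros. wce iStep ruStep. apply W_TG.
      * exists (map ag_init (is_agents IS)). split; auto.
    + intros z [-> _]. pose proof (valid_sz IS _ Hinit). lia.
  - unfold reach. split.
    + intros [->|(z & -> & H)].
      * exists (init_g IS). auto.
      * apply tcr_clos, clos_tGt in H as (g' & -> & H). eauto.
    + intros (g & -> & [<-|H]).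
      * now left.
      * right. exists (tV (init_g IS)). split; auto.
        apply tcr_complete with (fun x => exists g, x = tV g /\ valid_gstate IS g).
        -- intros u v _ (g1 & g2 & _ & -> & Hv). exists g2. split; auto. apply Hv.
        -- intros u (g1 & -> & Hv). apply valid_sz in Hv. lia.
        -- eauto.
        -- apply clos_tGt. eauto.
Qed.

Lemma W_Chain x : W e (sz x + depth_TG) (call iChain x) (tchain (tGt IS) x).
Proof.
  clear Hell ell.
  induction x as [|a _ x IH].
  - apply (W_le e 1); [|simpl; lia]. wce iChain ruChain. now apply W_T.
  - change (sz (a # x) + depth_TG) with (S (sz a + sz x + depth_TG)). wce iChain ruChain. destruct x as [|b x]; cbn [tif].
    + apply W_T. simpl. auto.
    + apply W_and; [eapply W_le; [apply W_TG|lia]|intros _; eapply W_le; [apply IH|lia]].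
Qed.

Definition depth_Path := B + depth_Reach + depth_TG + 2.

Lemma W_Path x : sz x <= B -> W e depth_Path (call iPath x) (exists P, x = tP P /\ rpath IS P).
Proof.
  intros Hx. unfold depth_Path. replace (B + depth_Reach + depth_TG + 2) with (S (B + depth_Reach + depth_TG + 1)) by lia.
  wce iPath ruPath. destruct x as [|a x]; cbn [tif hd' tl'].
  - apply W_F. intros (P & E & H & _). destruct P; [tauto|discriminate].
  - simpl in Hx. eapply W_iff.
    + apply W_and; [eapply W_le; [apply W_Reach; lia|lia]|intros _; eapply W_le; [apply W_Chain|simpl; lia]].
    + unfold rpath. split.
      * intros [(g & -> & Hg) H]. apply tchain_iff in H as (P & -> & Hc).
        exists (g :: P). repeat split; auto; try discriminate; apply Hc.
      * intros ([|g P] & E & H1 & H2 & H3); [tauto|]. simpl in E. inversion E; subst.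
        split. eauto. apply tchain_iff. eauto.
Qed.

Lemma W_StepG G x y : sz x <= B -> sz y <= B ->
  W e (depth_Path + sz (tV G) + B + 5) (call iStep ((Lf # tV G) # x # y)) (pstepT IS G x y).
Proof.
  intros Hx Hy. replace (depth_Path + sz (tV G) + B + 5) with (S (depth_Path + sz (tV G) + B + 4)) by lia.
  wce iStep ruStep. eapply W_iff.
  - apply W_and; [eapply W_le; [apply W_Path; lia|lia]|intros (P & -> & HP)].
    instantiate (1 := (exists P', y = tP P' /\ rpath IS P') /\
      exists P P', x = tP P /\ y = tP P' /\ exists i, In i G /\ simP i P P').
    apply W_and; [eapply W_le; [apply W_Path; lia|lia]|intros (P' & -> & HP')].
    eapply W_iff. eapply W_le; [apply W_SomeSim|lia].
    split; [intros; exists P, P'; auto|]. intros (Q & Q' & E & E' & H). apply tP_inj in E, E'. now subst.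
  - unfold pstepT, pstep. split.
    + intros ((P & -> & H) & (P' & -> & H') & Q & Q' & E & E' & H2). apply tP_inj in E, E'. subst.
      exists Q, Q'. auto.
    + intros (P & P' & -> & -> & H1 & H2 & H3). split; eauto. split; eauto.
Qed.

(** Keeps just what bounds the code of a path, in a form inherited by the factors of a split and,
    since [simP] preserves length, by similar paths. *)
Definition short_path (P : list gstate) : Prop := Forall (valid_gstate IS) P /\ length P <= ell.

Lemma short_path_sz P : short_path P -> sz (tP P) + 2 <= n.
Proof. intros [H1 H2]. pose proof (path_sz IS P ell H1 H2). lia. Qed.

Lemma short_path_app P P' : short_path (P ++ P') -> short_path P /\ short_path P'.
Proof.
  intros [H1 H2]. apply Forall_app in H1 as [? ?]. rewrite length_app in H2.
  split; split; auto; lia.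
Qed.

Lemma short_path_sim i P P' : short_path P -> rpath IS P' -> simP i P P' -> short_path P'.
Proof.
  intros [_ H] HP HS. split. now apply rpath_valid.
  apply Forall2_length in HS. unfold gstate in *. lia.
Qed.

Definition lambda_size := sz (tL tRe (is_lambda IS)).
Definition depth_Var := lambda_size + lambda_size * ((n + 1) * (n + n + 6)) + 1.

Lemma W_Var w : short_path w -> forall p l, p < length l -> sz (tL tRe l) <= lambda_size ->
  W e (p + lambda_size * ((n + 1) * (n + n + 6)) + 1) (call iVar (tN p # tL tRe l # tP w)) (lang (nth p l ReEmpty) w).
Proof.
  intros Hw. pose proof (short_path_sz w Hw) as Hs.
  assert (HX : forall r : re gstate, sz (tRe r) <= lambda_size ->
    sz (tRe r) * ((n - 2 + 1) * (n + (n - 2) + 6)) <= lambda_size * ((n + 1) * (n + n + 6))).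
  { intros r Hr. apply Nat.mul_le_mono; auto. apply Nat.mul_le_mono; lia. }
  generalize dependent (lambda_size * ((n + 1) * (n + n + 6))). intros X HX.
  induction p as [|p IH]; intros [|r l] Hp HL; simpl in Hp; try lia;
    change (tL tRe (r :: l)) with (tRe r # tL tRe l) in *; simpl in HL.
  - apply (W_le e (S X)); [|lia].
    wce iVar ruVar. eapply W_le; [apply (W_Re e n (n - 2)); auto; lia|].
    apply HX. cbn [nth]. lia.
  - apply (W_le e (S (p + X + 1))); [|lia].
    wce iVar ruVar. fold tN. apply IH; lia.
Qed.

Definition sat_depth := depth_Path + (n + 2) * (n + 4) + depth_Var + 10 * n + 60.

(** The encoding of a connective is large enough to pay for its guesses. [D] receives more because
    it is first rewritten and then splits the path twice. *)
Lemma tF_S f : exists d, sz (tF f) * sat_depth = S d /\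
  match f with
  | FPi | FVar _ => sat_depth <= S d
  | FNeg f1 | FB f1 | FE f1 | FK _ f1 => sz (tF f1) * sat_depth + sat_depth <= S d
  | FD f1 => sz (tF f1) * sat_depth + 5 * sat_depth <= S d
  | FAnd f1 f2 => sz (tF f1) * sat_depth + sz (tF f2) * sat_depth + sat_depth <= S d
  | FC G f1 => sz (tF f1) * sat_depth + sat_depth + sz (tV G) <= S d
  end.
Proof.
  exists (sz (tF f) * sat_depth - 1).
  assert (HK : 1 <= sat_depth) by (unfold sat_depth; lia).
  assert (H : match f with
  | FPi | FVar _ => 3
  | FNeg f1 | FB f1 | FE f1 | FK _ f1 => sz (tF f1) + 3
  | FD f1 => sz (tF f1) + 5
  | FAnd f1 f2 => sz (tF f1) + sz (tF f2) + 3
  | FC G f1 => sz (tF f1) + sz (tV G) + 3 end <= sz (tF f)) by (destruct f; simpl; lia).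
  pose proof (sz_pos (tF f)).
  split. nia. destruct f; nia.
Qed.

Ltac wsat :=
  apply (W_call iSat ruSat); [reflexivity|]; unfold ruSat, sel9, p1, p2, q2, q3, q5, p3, q1;
  cbn [tF tnode tL fold_right tN hd' tl' tif].

(** Stated for a given depth [d] outside the induction of [W_Sat], because the case [D] evaluates
    [FE (FB f)], where [FB f] is not a subformula. *)
Lemma W_B f d w : short_path w -> sz (tP w) + 1 <= d ->
  (forall u v, w = u ++ v -> W e d (call iSat (tF f # tP u)) (psat IS f u)) ->
  W e (d + n + 3) (call iSat (tF (FB f) # tP w)) (psat IS (FB f) w).
Proof.
  intros Hw Hd H. pose proof (short_path_sz w Hw) as Hs.
  replace (d + n + 3) with (S (d + n + 2)) by lia.
  wsat.
  eapply W_iff.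
  - apply (W_split e n d iBSplit ruBSplit) with (w := w) (Q := fun u v => u <> [] /\ v <> [] /\ psat IS f u)
     (body := fun z => tif (hd' z) (tif (tl' z) (call iSat (tF f # hd' z)) rF) rF); auto.
    intros u v z E -> ->. destruct u as [|g u]; cbn [tP tL fold_right tif].
    { apply W_F. tauto. }
    destruct v as [|g' v]; cbn [tP tL fold_right tif].
    { apply W_F. tauto. }
    eapply W_iff. apply (H (g :: u) (g' :: v) E). intuition discriminate.
  - simpl. split; intros (u & v & ?); exists u, v; tauto.
Qed.

Lemma W_E f d w : short_path w -> sz (tP w) + 1 <= d ->
  (forall u v, w = u ++ v -> W e d (call iSat (tF f # tP v)) (psat IS f v)) ->
  W e (d + n + 3) (call iSat (tF (FE f) # tP w)) (psat IS (FE f) w).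
Proof.
  intros Hw Hd H. pose proof (short_path_sz w Hw) as Hs.
  replace (d + n + 3) with (S (d + n + 2)) by lia.
  wsat.
  eapply W_iff.
  - apply (W_split e n d iESplit ruESplit) with (w := w) (Q := fun u v => u <> [] /\ v <> [] /\ psat IS f v)
     (body := fun z => tif (hd' z) (tif (tl' z) (call iSat (tF f # tl' z)) rF) rF); auto.
    intros u v z E -> ->. destruct u as [|g u]; cbn [tP tL fold_right tif].
    { apply W_F. tauto. }
    destruct v as [|g' v]; cbn [tP tL fold_right tif].
    { apply W_F. tauto. }
    eapply W_iff. apply (H (g :: u) (g' :: v) E). intuition discriminate.
  - simpl. split; intros (u & v & ?); exists u, v; tauto.
Qed.

Lemma psat_D f w : psat IS (FE (FB f)) w <-> psat IS (FD f) w.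
Proof.
  simpl. split.
  - intros (u & v & H1 & H2 & -> & v1 & v2 & H3 & H4 & -> & H5). exists u, v1, v2. auto.
  - intros (u & v & x & H1 & H2 & H3 & -> & H5). exists u, (v ++ x). repeat split; auto.
    destruct v; simpl; congruence. exists v, x. auto.
Qed.

Lemma W_Sat f : wf_fml IS f -> forall w, short_path w ->
  W e (sz (tF f) * sat_depth) (call iSat (tF f # tP w)) (psat IS f w).
Proof.
  assert (HKn : 10 * n + 60 <= sat_depth) by (unfold sat_depth; lia).
  induction f as [|p|f IH|f IHf g IHg|i f IH|G f IH|f IH|f IH|f IH]; intros Hf w Hw;
    pose proof (short_path_sz w Hw) as Hs;
    match goal with |- W _ (sz (tF ?r) * _) _ _ => destruct (tF_S r) as (d & Ed & Hd); rewrite Ed; clear Ed end.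
  - wce iSat ruSat. destruct w as [|a [|b w]]; cbn [tP tL fold_right tif hd' tl' isLf].
    + apply W_F. discriminate.
    + now apply W_T.
    + apply W_F. discriminate.
  - wsat. unfold eL. envs.
    simpl in Hf. eapply W_le; [apply W_Var; auto|].
    assert (length (is_lambda IS) <= lambda_size).
    { unfold lambda_size. generalize (is_lambda IS). intros l. induction l; simpl in *; lia. }
    unfold sat_depth, depth_Var in *. lia.
  - wsat.
    apply W_not. eapply W_le; [apply IH; auto|lia].
  - wsat.
    destruct Hf. apply W_and; [eapply W_le; [apply IHf; auto|lia]|intros _; eapply W_le; [apply IHg; auto|lia]].
  - wsat.
    destruct Hf as [Hi Hf].
    assert (Hil : i <= n).
    { etransitivity; [|exact HA]. apply Nat.lt_le_incl. eapply Nat.lt_le_trans; [exact Hi|].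
      unfold tAs. generalize (is_agents IS). intros l. induction l; simpl in *; lia. }
    eapply W_iff.
    + apply W_not. eapply W_le; [apply (W_some e n (sz (tF f) * sat_depth + depth_Path + 2 * n + 4)) with
        (Q := fun z => exists P', z = tP P' /\ rpath IS P' /\ simP i w P' /\ ~ psat IS f P'); auto|].
      * intros z Hz. replace (sz (tF f) * sat_depth + depth_Path + 2 * n + 4) with (S (sz (tF f) * sat_depth + depth_Path + 2 * n + 3)) by lia.
        apply (W_call iKWit ruKWit); [reflexivity|]; unfold ruKWit; unfold p1, p2, p3, q2;
        cbn [tF tnode tL fold_right tN hd' tl' tif].
        eapply W_iff.
        { apply W_and; [eapply W_le; [apply W_Path; lia|lia]|intros (P' & -> & HP')].
          instantiate (1 := exists P', z = tP P' /\ simP i w P' /\ ~ psat IS f P').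
          eapply W_iff. apply W_and; [eapply W_le; [apply W_Sim|lia]|intros HS].
          apply W_not. eapply W_le; [apply IH; auto; eapply short_path_sim; eauto|lia].
          split; [intros; exists P'; auto|]. intros (P1 & E & H). apply tP_inj in E. now subst. }
        split.
        { intros [(P' & -> & H1) (P1 & E & H2)]. apply tP_inj in E. subst. exists P1. tauto. }
        { intros (P' & -> & H1 & H2). split; eauto. }
      * intros z (P' & -> & H1 & H2 & _). pose proof (short_path_sim i w P' Hw H1 H2) as Ho. apply short_path_sz in Ho. lia.
      * unfold sat_depth in *. lia.
    + simpl. split.
      * intros H P' H1 H2. apply NNPP. intros H3. apply H. exists (tP P'), P'. auto.
      * intros H (z & P' & _ & H1 & H2 & H3). auto.
  - wsat.
    destruct Hf as [HG Hf].
    set (dS := depth_Path + sz (tV G) + B + 5).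
    (* Chains for [C] never change the length of the path, so all their members fit into the
       budget. *)
    set (Inv := fun x => exists P, x = tP P /\ short_path P).
    assert (I1 : forall u v, Inv u -> pstepT IS G u v -> Inv v).
    { intros u v (P & -> & HP) (Q & Q' & E & -> & H1 & H2 & j & _ & H3). apply tP_inj in E. subst Q.
      exists Q'. split; auto. eapply short_path_sim; eauto. }
    assert (I2 : forall u, Inv u -> sz u <= n).
    { intros u (P & -> & HP). apply short_path_sz in HP. lia. }
    assert (IC : forall k x z, Inv x -> tcr (pstepT IS G) k x z -> Inv z).
    { intros k x z Hx H. apply tcr_clos in H. induction H; eauto. }
    assert (Iw : Inv (tP w)) by (exists w; auto).
    assert (ET : forall z, tcr (pstepT IS G) (S n) (tP w) z <-> exists P', z = tP P' /\ clos_trans _ (pstep IS G) w P').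
    { intros z. rewrite <- clos_pstepT. split. apply tcr_clos. apply tcr_complete with Inv; auto. }
    eapply W_iff.
    + apply W_not. eapply W_le; [apply (W_some e n (S (sz (tF f) * sat_depth + (dS + 1 + S n * (n + 4))))) with
        (Q := fun z => tcr (pstepT IS G) (S n) (tP w) z /\ exists P', z = tP P' /\ ~ psat IS f P'); auto|].
      * intros z Hz.
        apply (W_call iCWit ruCWit); [reflexivity|]; unfold ruCWit; unfold p1, p2, p3, q2, eN;
        cbn [tF tnode tL fold_right tN hd' tl' tif]. envs. change (Lf # tN n) with (tN (S n)).
        change (fold_right (fun a t => tN a # t) Lf G) with (tV G).
        apply W_and.
        { eapply W_le; [apply (W_TC e n (Lf # tV G) (pstepT IS G) Inv dS); auto|lia].
          intros. apply W_StepG; auto. }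
        intros H. destruct (IC _ _ _ Iw H) as (P' & -> & HP').
        eapply W_iff. apply W_not. eapply W_le; [apply IH; auto|lia].
        split; [intros; exists P'; auto|]. intros (P1 & E & ?). apply tP_inj in E. now subst.
      * intros z [H _]. eauto.
      * unfold sat_depth, dS in *. lia.
    + simpl. split.
      * intros H P' H1. apply NNPP. intros H3. apply H. exists (tP P'). split; [|eauto].
        apply ET. eauto.
      * intros H (z & H1 & P' & -> & H3). apply ET in H1 as (P1 & E & H1). apply tP_inj in E. subst. auto.
  - eapply W_le; [apply (W_B f (sz (tF f) * sat_depth + n)); auto; try lia|unfold sat_depth in *; lia].
    intros u v ->. apply short_path_app in Hw as [? ?]. eapply W_le; [apply IH; auto|lia].
  - eapply W_iff; [|apply psat_D].
    apply (W_le e (S (sz (tF f) * sat_depth + n + (n + 3) + (n + 3)))); [|lia].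
    wsat.
    eapply W_le; [apply (W_E (FB f) (sz (tF f) * sat_depth + n + (n + 3))); auto; try lia|lia].
    intros u v ->. apply short_path_app in Hw as [? Hv]. pose proof (short_path_sz v Hv).
    eapply W_le; [apply (W_B f (sz (tF f) * sat_depth + n)); auto; try lia|lia].
    intros v1 v2 ->. apply short_path_app in Hv as [? ?]. eapply W_le; [apply IH; auto|lia].
  - eapply W_le; [apply (W_E f (sz (tF f) * sat_depth + n)); auto; try lia|unfold sat_depth in *; lia].
    intros u v ->. apply short_path_app in Hw as [? ?]. eapply W_le; [apply IH; auto|lia].
Qed.

End Game.

(** * Checking that the input is a well-formed instance *)

(** A transition mentions joint actions, hence the sizes of all agents. These numerals are therefore
    checked for every agent before the rest of any single agent is. *)
Lemma W_AgShape e a : W e (sz a) (call iAgShape a) (exists l : list partial_agent, a = tL fA l).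
Proof.
  induction a as [|t _ a IH].
  - wc iAgShape ruAgShape. apply W_T. now exists [].
  - simpl sz. wc iAgShape ruAgShape.
    destruct t as [|t1 [|t2 [|t3 [|t4 [|t5 [|]]]]]]; cbn [tif hd' tl'];
      try (apply W_F; intros ([|[[[[? ?] ?] ?] ?] l] & E); discriminate).
    eapply W_iff. apply W_and; [eapply W_le; [apply W_Nat|simpl; lia]|intros _].
    apply W_and; [eapply W_le; [apply W_Nat|simpl; lia]|intros _; eapply W_le; [apply IH|lia]].
    split.
    + intros ([nl ->] & [na ->] & l & ->). exists ((nl, t2, na, t4, t5) :: l). reflexivity.
    + intros ([|[[[[nl ti] na] tp] tm] l] & E); inversion E; subst. eauto 6.
Qed.

Lemma W_Len e m : forall x, W e (m + 1) (call iLen (x # tN m)) (tlen x = m).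
Proof.
  induction m as [|m IH]; intros x.
  - simpl. wc iLen ruLen. destruct x; [apply W_T|apply W_F]; simpl; congruence.
  - simpl Nat.add. wc iLen ruLen. destruct x as [|a x]; cbn [tif hd' tl' tN].
    + apply W_F. discriminate.
    + eapply W_iff. apply IH. simpl. lia.
Qed.

Lemma W_Below e y l : W e (sz l + sz y) (call iBelow (l # y))
  (exists G, l = tV G /\ Forall (fun x => x < tlen y) G).
Proof.
  induction l as [|a _ l IH].
  - simpl. wc iBelow ruBelow. apply W_T. exists []. split; auto.
  - simpl. wc iBelow ruBelow.
    eapply W_iff. apply W_and; [eapply W_le; [apply W_Lt|lia]|intros _; eapply W_le; [apply IH|lia]].
    split.
    + intros ((v & -> & Hv) & G & -> & HG). exists (v :: G). split; auto.
    + intros ([|v G] & E & HG); inversion E; subst. inversion HG; subst. split; eauto.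
Qed.

Lemma W_ProtWf e y l : W e (sz l + sz y) (call iProtWf (l # y))
  (exists G, l = tL tV G /\ Forall (Forall (fun x => x < tlen y)) G).
Proof.
  induction l as [|a _ l IH].
  - simpl. wc iProtWf ruProtWf. apply W_T. exists []. split; auto.
  - simpl. wc iProtWf ruProtWf.
    eapply W_iff. apply W_and; [eapply W_le; [apply W_Below|lia]|intros _; eapply W_le; [apply IH|lia]].
    split.
    + intros ((v & -> & Hv) & G & -> & HG). exists (v :: G). split; auto.
    + intros ([|v G] & E & HG); inversion E; subst. inversion HG; subst. split; eauto.
Qed.

Definition wfT (l0 : list partial_agent) (nl : nat) (t : nat * list nat * nat) : Prop :=
  match t with (l, a, l') => l < nl /\ Forall2 (fun v q => v < selA rT q) a l0 /\ l' < nl end.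

Lemma W_TransWf e l0 nl l : eA e = tL fA l0 -> W e (sz l + sz (tN nl) + sz (eA e)) (call iTransWf (l # tN nl))
  (exists G, l = tL tTr G /\ Forall (wfT l0 nl) G).
Proof.
  intros EA. induction l as [|t _ l IH].
  - simpl. wc iTransWf ruTransWf. apply W_T. exists []. split; auto.
  - simpl sz. replace (S (sz t + sz l) + sz (tN nl) + sz (eA e)) with (S (sz t + sz l + sz (tN nl) + sz (eA e))) by lia.
    apply (W_call iTransWf ruTransWf); [reflexivity|].
    unfold ruTransWf, p1, q1, p2, q2, p3, q3; cbn [hd' tl' tif].
    destruct t as [|t1 [|t2 [|t3 [|]]]]; cbn [tif hd' tl'];
      try (apply W_F; intros ([|[[? ?] ?] G] & E & _); discriminate).
    eapply W_iff. apply W_and; [eapply W_le; [apply W_Lt|simpl; lia]|intros _].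
    apply W_and; [rewrite EA; eapply W_le; [apply W_Locals|simpl; lia]|intros _].
    apply W_and; [eapply W_le; [apply W_Lt|simpl; lia]|intros _; eapply W_le; [apply IH|lia]].
    rewrite !tlen_tN. split.
    + intros ((v & -> & Hv) & (a & -> & Ha) & (v' & -> & Hv') & G & -> & HG).
      exists ((v, a, v') :: G). split; auto. constructor; auto. simpl; auto.
    + intros ([|[[v a] v'] G] & E & HG); inversion E; subst.
      apply Forall_cons_iff in HG as [(H1 & H2 & H3) HG']. repeat split; eauto.
Qed.

Definition wf1 (l0 : list partial_agent) (ag : agent) : Prop :=
  ag_init ag < ag_nloc ag /\
  length (ag_prot ag) = ag_nloc ag /\
  Forall (Forall (fun x => x < ag_nact ag)) (ag_prot ag) /\
  Forall (wfT l0 (ag_nloc ag)) (ag_trans ag).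

Lemma W_AgWf e l0 l : eA e = tL fA l0 ->
  W e (sz (tL fA l) + sz (eA e)) (call iAgWf (tL fA l))
  (exists ags, l = map pre ags /\ Forall (wf1 l0) ags).
Proof.
  intros EA. induction l as [|[[[[nl ti] na] tp] tm] l IH].
  - simpl. wc iAgWf ruAgWf. apply W_T. exists []. split; auto.
  - change (tL fA ((nl, ti, na, tp, tm) :: l)) with (fA (nl, ti, na, tp, tm) # tL fA l).
    set (d := sz (fA (nl, ti, na, tp, tm)) + sz (tL fA l) + sz (eA e)).
    change (sz (_ # _) + sz (eA e)) with (S d).
    assert (Hd : sz (tN nl) + sz (tN na) + sz ti + sz tp + sz tm + sz (tL fA l) + sz (eA e) <= d)
      by (unfold d; simpl; lia).
    clearbody d. pose proof (sz_tN nl) as Hnl.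
    change (fA (nl, ti, na, tp, tm)) with (tN nl # ti # tN na # tp # tm # Lf).
    apply (W_call iAgWf ruAgWf); [reflexivity|]; unfold ruAgWf, p1, p2, p3, p4, p5; cbn [hd' tl' tif].
    eapply W_iff. apply W_and; [eapply W_le; [apply W_Lt|lia]|intros _].
    apply W_and; [eapply W_le; [apply W_Len|lia]|intros _].
    apply W_and; [eapply W_le; [apply W_ProtWf|lia]|intros _].
    apply W_and; [eapply W_le; [apply W_TransWf; eauto|lia]|intros _; eapply W_le; [apply IH|lia]].
    rewrite !tlen_tN. split.
    + intros ((v & -> & Hv) & Hl & (pr & -> & Hp) & (tr & -> & Ht) & ags & -> & Hags).
      rewrite tlen_tL in Hl.
      exists (mkAgent nl v na pr tr :: ags). split; auto. constructor; auto. repeat split; auto.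
    + intros ([|[nl' v na' pr tr] ags] & E & H); inversion E; subst.
      apply Forall_cons_iff in H as [(H1 & H2 & H3 & H4) H']. simpl in *. subst. repeat split; eauto.
      apply tlen_tL.
Qed.

Lemma tRe_tag r t c : t # c = tRe r -> exists k, t = tN k.
Proof. destruct r; intros E; injection E as -> _; [exists 0|exists 1|exists 2|exists 3|exists 4|exists 5]; reflexivity. Qed.

Lemma tF_tag f t c : t # c = tF f -> exists k, t = tN k.
Proof. destruct f; intros E; injection E as -> _; [exists 0|exists 1|exists 2|exists 3|exists 4|exists 5|exists 6|exists 7|exists 8]; reflexivity. Qed.

Lemma W_ReWf e l0 : eA e = tL fA l0 -> forall m x, sz x <= m ->
  W e (sz x + sz (eA e)) (call iReWf x)
  (exists r, x = tRe r /\ Forall (fun g => Forall2 (fun v q => v < selA Lf q) g l0) (re_syms r)).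
Proof.
  intros EA. induction m as [|m IH]; intros x Hm.
  { pose proof (sz_pos x). lia. }
  destruct x as [|t c].
  - simpl. wc iReWf ruReWf. apply W_F. intros (r & E & _). destruct r; discriminate.
  - simpl in Hm |- *.
    apply (W_call iReWf ruReWf); [reflexivity|]. unfold ruReWf; cbn [hd' tl' tif].
    (* [sel6] looks only at the spine of the tag, so without the numeral check a malformed tag would
       pass for a number. *)
    eapply W_iff with (P := (exists k, t = tN k) /\ (exists r, t # c = tRe r /\ Forall (fun g => Forall2 (fun v q => v < selA Lf q) g l0) (re_syms r)));
      [|split; [tauto|]; intros (r & E & H); split; eauto using tRe_tag].
    apply W_and; [eapply W_le; [apply W_Nat|lia]|intros [k ->]].
    destruct k as [|[|[|[|[|[|k]]]]]]; unfold sel6, p1, p2, q2, q3, q5; cbn [tN hd' tl' tif];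
      [| | | | | |apply W_F; intros (r & E & _); destruct r; discriminate].
    + eapply W_iff. apply W_isLf. split; [intros ->; exists ReEmpty; split; [reflexivity|constructor]|].
      intros (r & E & _); destruct r; inversion E; auto.
    + eapply W_iff. apply W_isLf. split; [intros ->; exists ReEps; split; [reflexivity|constructor]|].
      intros (r & E & _); destruct r; inversion E; auto.
    + destruct c as [|c1 [|]]; cbn [tif hd' tl'];
        try (apply W_F; intros (r & E & _); destruct r; discriminate).
      eapply W_iff. rewrite EA. eapply W_le; [apply W_Locals|rewrite <- EA; simpl; lia].
      split.
      * intros (g & -> & Hg). exists (ReSym g). split; [reflexivity|]. simpl. auto.
      * intros (r & E & H). destruct r as [| |g| | |]; inversion E; subst. exists g. split; auto.
        simpl in H. inversion H; auto.
    + destruct c as [|c1 [|c2 [|]]]; cbn [tif hd' tl'];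
        try (apply W_F; intros (r & E & _); destruct r; discriminate).
      simpl in Hm. eapply W_iff.
      apply W_and; [eapply W_le; [apply IH; lia|simpl; lia]|intros _; eapply W_le; [apply IH; lia|simpl; lia]].
      split.
      * intros [(r1 & -> & H1) (r2 & -> & H2)]. exists (ReSeq r1 r2). split; [reflexivity|].
        simpl. apply Forall_app; auto.
      * intros (r & E & H). destruct r; inversion E; subst. simpl in H. apply Forall_app in H as [? ?].
        split; eauto.
    + destruct c as [|c1 [|c2 [|]]]; cbn [tif hd' tl'];
        try (apply W_F; intros (r & E & _); destruct r; discriminate).
      simpl in Hm. eapply W_iff.
      apply W_and; [eapply W_le; [apply IH; lia|simpl; lia]|intros _; eapply W_le; [apply IH; lia|simpl; lia]].
      split.
      * intros [(r1 & -> & H1) (r2 & -> & H2)]. exists (ReAlt r1 r2). split; [reflexivity|].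
        simpl. apply Forall_app; auto.
      * intros (r & E & H). destruct r; inversion E; subst. simpl in H. apply Forall_app in H as [? ?].
        split; eauto.
    + destruct c as [|c1 [|]]; cbn [tif hd' tl'];
        try (apply W_F; intros (r & E & _); destruct r; discriminate).
      simpl in Hm. eapply W_iff. eapply W_le; [apply IH; lia|simpl; lia].
      split.
      * intros (r1 & -> & H1). exists (ReStar r1). split; [reflexivity|auto].
      * intros (r & E & H). destruct r; inversion E; subst. eauto.
Qed.

Lemma W_LamWf e l0 x : eA e = tL fA l0 -> W e (sz x + sz (eA e)) (call iLamWf x)
  (exists l, x = tL tRe l /\
    Forall (fun r => Forall (fun g => Forall2 (fun v q => v < selA Lf q) g l0) (re_syms r)) l).
Proof.
  intros EA. induction x as [|r _ x IH].
  - simpl. wc iLamWf ruLamWf. apply W_T. exists []. auto.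
  - simpl. apply (W_call iLamWf ruLamWf); [reflexivity|]. unfold ruLamWf; cbn [hd' tl' tif].
    eapply W_iff. apply W_and; [eapply W_le; [eapply W_ReWf; eauto|lia]|].
    intros _. eapply W_le; [apply IH|lia].
    split.
    + intros [(r' & -> & H) (l & -> & Hl)]. exists (r' :: l). auto.
    + intros ([|r' l] & E & H); inversion E; subst. inversion H; subst. split; eauto.
Qed.

Lemma W_FmlWf IS n : forall m x, sz x <= m ->
  W (env IS n) (sz x + sz (env IS n)) (call iFmlWf x) (exists f, x = tF f /\ wf_fml IS f).
Proof.
  set (e := env IS n).
  assert (EA : eA e = tL tAg (is_agents IS)) by reflexivity.
  assert (EL : eL e = tL tRe (is_lambda IS)) by reflexivity.
  assert (He : sz (eA e) <= sz e /\ sz (eL e) <= sz e) by (unfold e, env, eA, eL; simpl; lia).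
  clearbody e.
  assert (LA : tlen (eA e) = length (is_agents IS)) by (rewrite EA; apply tlen_tL).
  assert (LL : tlen (eL e) = length (is_lambda IS)) by (rewrite EL; apply tlen_tL).
  induction m as [|m IH]; intros x Hm.
  { pose proof (sz_pos x). lia. }
  destruct x as [|t c].
  - simpl. wc iFmlWf ruFmlWf. apply W_F. intros (r & E & _). destruct r; discriminate.
  - simpl in Hm |- *.
    apply (W_call iFmlWf ruFmlWf); [reflexivity|]. unfold ruFmlWf; cbn [hd' tl' tif].
    eapply W_iff with (P := (exists k, t = tN k) /\ (exists f, t # c = tF f /\ wf_fml IS f));
      [|split; [tauto|]; intros (r & E & H); split; eauto using tF_tag].
    apply W_and; [eapply W_le; [apply W_Nat|lia]|intros [k ->]].
    assert (IH1 : forall Q : Prop, (forall f c1, c = c1 # Lf -> c1 = tF f -> wf_fml IS f -> Q) ->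
      (Q -> exists c1 f, c = c1 # Lf /\ c1 = tF f /\ wf_fml IS f) ->
      W e (S (sz c) + sz e) (tif c (tif (tl' c) rF (call iFmlWf (p1 c))) rF) Q).
    { intros Q HQ1 HQ2. unfold p1. destruct c as [|c1 [|]]; cbn [tif hd' tl'];
        try (apply W_F; intros HQ; destruct (HQ2 HQ) as (c1' & f & E & _); discriminate).
      simpl in Hm. eapply W_iff. eapply W_le; [apply IH; lia|simpl; lia]. split.
      - intros (f & E & Hf). eauto.
      - intros HQ. destruct (HQ2 HQ) as (c1' & f & E & E' & Hf). inversion E; subst. eauto. }
    destruct k as [|[|[|[|[|[|[|[|[|k]]]]]]]]]; unfold sel9, p1, p2, q2, q3, q5; cbn [tN hd' tl' tif];
      [| | | | | | | | |apply W_F; intros (r & E & _); destruct r; discriminate].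
    + eapply W_iff. apply W_isLf. split; [intros ->; exists FPi; split; [reflexivity|constructor]|].
      intros (r & E & _); destruct r; inversion E; auto.
    + destruct c as [|c1 [|]]; cbn [tif hd' tl'];
        try (apply W_F; intros (r & E & _); destruct r; discriminate).
      eapply W_iff. eapply W_le; [apply W_Lt|simpl; lia]. rewrite LL. split.
      * intros (p & -> & H1). exists (FVar p). split; [reflexivity|auto].
      * intros (r & E & H). destruct r; inversion E; subst. eauto.
    + eapply W_le; [apply IH1|simpl; lia].
      * intros f c1 -> -> H. exists (FNeg f). split; [reflexivity|auto].
      * intros (r & E & H). destruct r; inversion E; subst. eauto 6.
    + destruct c as [|c1 [|c2 [|]]]; cbn [tif hd' tl'];
        try (apply W_F; intros (r & E & _); destruct r; discriminate).
      simpl in Hm. eapply W_iff.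
      apply W_and; [eapply W_le; [apply IH; lia|simpl; lia]|intros _; eapply W_le; [apply IH; lia|simpl; lia]].
      split.
      * intros [(r1 & -> & H1) (r2 & -> & H2)]. exists (FAnd r1 r2). split; [reflexivity|]. simpl; auto.
      * intros (r & E & H). destruct r; inversion E; subst. destruct H. split; eauto.
    + destruct c as [|c1 [|c2 [|]]]; cbn [tif hd' tl'];
        try (apply W_F; intros (r & E & _); destruct r; discriminate).
      simpl in Hm. eapply W_iff.
      apply W_and; [eapply W_le; [apply W_Lt|simpl; lia]|intros _; eapply W_le; [apply IH; lia|simpl; lia]].
      rewrite LA. split.
      * intros [(i & -> & H1) (r2 & -> & H2)]. exists (FK i r2). split; [reflexivity|]. simpl; auto.
      * intros (r & E & H). destruct r; inversion E; subst. destruct H. split; eauto.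
    + destruct c as [|c1 [|c2 [|]]]; cbn [tif hd' tl'];
        try (apply W_F; intros (r & E & _); destruct r; discriminate).
      simpl in Hm. eapply W_iff.
      apply W_and; [eapply W_le; [apply W_Below|simpl; lia]|intros _; eapply W_le; [apply IH; lia|simpl; lia]].
      rewrite LA. split.
      * intros [(G & -> & H1) (r2 & -> & H2)]. exists (FC G r2). split; [reflexivity|]. simpl; auto.
      * intros (r & E & H). destruct r; inversion E; subst. destruct H. split; eauto.
    + eapply W_le; [apply IH1|simpl; lia].
      * intros f c1 -> -> H. exists (FB f). split; [reflexivity|auto].
      * intros (r & E & H). destruct r; inversion E; subst. eauto 6.
    + eapply W_le; [apply IH1|simpl; lia].
      * intros f c1 -> -> H. exists (FD f). split; [reflexivity|auto].
      * intros (r & E & H). destruct r; inversion E; subst. eauto 6.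
    + eapply W_le; [apply IH1|simpl; lia].
      * intros f c1 -> -> H. exists (FE f). split; [reflexivity|auto].
      * intros (r & E & H). destruct r; inversion E; subst. eauto 6.
Qed.

Fixpoint tsnoc (x u : tree) : tree := match x with Lf => u # Lf | Nd a b => a # tsnoc b u end.

Lemma W_Snoc e x : forall y, W e (sz x) (call iSnoc (x # y)) (exists u, y = tsnoc x u).
Proof.
  induction x as [|a _ x IH]; intros y.
  - simpl. wc iSnoc ruSnoc. destruct y as [|b [|]]; cbn [tif hd' tl' isLf].
    + apply W_F. intros [u E]. discriminate.
    + apply W_T. now exists b.
    + apply W_F. intros [u E]. discriminate.
  - simpl. wc iSnoc ruSnoc. destruct y as [|b y]; cbn [tif hd' tl'].
    + apply W_F. intros [u E]. discriminate.
    + eapply W_iff. apply W_and; [eapply W_le; [apply W_Eq|lia]|intros _; eapply W_le; [apply IH|lia]].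
      split.
      * intros [-> [u ->]]. eauto.
      * intros [u E]. inversion E; subst. eauto.
Qed.

Lemma tsnoc_tP s u s' : tP s' = tsnoc (tP s) u <-> exists g, s' = s ++ [g] /\ u = tV g.
Proof.
  revert s'. induction s as [|a s IH]; intros s'; simpl.
  - split.
    + destruct s' as [|g [|]]; intros E; inversion E; eauto.
    + intros (g & -> & ->). reflexivity.
  - split.
    + destruct s' as [|g s']; intros E; [discriminate|]. inversion E as [[E1 E2]].
      apply tV_inj in E1. apply IH in E2 as (g' & -> & ->). subst. eauto.
    + intros (g & -> & ->). simpl. f_equal. apply IH. eauto.
Qed.

Lemma W_Last e g s : W e (sz (tP s) + sz g) (call iLast (g # tP s)) (g = tV (gof s)).
Proof.
  induction s as [|a s IH].
  - simpl. wc iLast ruLast. eapply W_le; [apply W_Eq|lia].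
  - change (tP (a :: s)) with (tV a # tP s). simpl sz.
    replace (S (sz (tV a) + sz (tP s)) + sz g) with (S (sz (tV a) + sz (tP s) + sz g)) by lia.
    wc iLast ruLast. destruct s as [|b s]; cbn [tP tL fold_right tif].
    + eapply W_le; [apply W_Eq|lia].
    + eapply W_le; [apply IH|unfold tP, tL; cbn [fold_right sz]; lia].
Qed.

Lemma W_Globals e I : forall z, W e (sz (tL tP I) + sz z) (call iGlobals (z # tL tP I)) (z = tP (map gof I)).
Proof.
  induction I as [|s I IH]; intros z.
  - simpl. wc iGlobals ruGlobals. apply W_isLf.
  - change (tL tP (s :: I)) with (tP s # tL tP I). simpl sz.
    replace (S (sz (tP s) + sz (tL tP I)) + sz z) with (S (sz (tP s) + sz (tL tP I) + sz z)) by lia.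
    wc iGlobals ruGlobals. destruct z as [|g z]; cbn [tif hd' tl'].
    + apply W_F. discriminate.
    + eapply W_iff. apply W_and; [eapply W_le; [apply W_Last|simpl; lia]|intros _; eapply W_le; [apply IH|simpl; lia]].
      simpl. split; [intros [-> ->]; auto|intros E; inversion E; auto].
Qed.

Lemma W_MState IS n a : sz (tAs IS) <= n ->
  W (env IS n) (sz a + depth_TG IS n + 1) (call iMState a) (exists s, a = tP s /\ is_mstate IS s).
Proof.
  intros HA. replace (sz a + depth_TG IS n + 1) with (S (sz a + depth_TG IS n)) by lia. wc iMState ruMState.
  change (hd' (tl' (env IS n))) with (tL tAg (is_agents IS)).
  destruct a as [|g t]; cbn [tif hd' tl'].
  - apply W_F. intros (s & E & H & _). destruct s; [tauto|discriminate].
  - eapply W_iff.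
    + apply W_and; [eapply W_le; [apply W_Init|unfold depth_TG, tAs; lia]|intros _].
      apply W_Chain; auto.
    + split.
      * intros [-> H]. apply tchain_iff in H as (P & -> & Hc). exists (init_g IS :: P).
        split; auto. apply is_mstate_chain. repeat split; auto; try discriminate; apply Hc.
      * intros ([|g' s] & E & H); [discriminate|]. inversion E; subst.
        apply is_mstate_chain in H as (_ & H1 & H2). simpl in H1. subst. split; auto.
        apply tchain_iff. exists s. auto.
Qed.

Lemma is_interval_cons IS s I : is_interval IS (s :: I) <->
  is_mstate IS s /\ (I = [] \/ exists g I', I = (s ++ [g]) :: I' /\ is_interval IS I).
Proof.
  rewrite is_interval_chain. split.
  - intros (_ & H1 & H2). apply Forall_cons_iff in H1 as [H1 H3]. split; auto.
    destruct I as [|s' I']; auto. right. destruct H2 as [(_ & _ & g & ->) H2].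
    exists g, I'. split; auto. apply is_interval_chain. split; [discriminate|auto].
  - intros [H [->|(g & I' & -> & H')]].
    + repeat split; auto. discriminate.
    + apply is_interval_chain in H' as (_ & H1 & H2). split; [discriminate|]. split; auto.
      split; auto. apply Forall_cons_iff in H1 as [H1 _]. split; auto. split; auto. eauto.
Qed.

Lemma W_Interval IS n a : sz (tAs IS) <= n ->
  W (env IS n) (sz a + depth_TG IS n + 1) (call iInterval a) (exists I, a = tL tP I /\ is_interval IS I).
Proof.
  intros HA. induction a as [|s _ a IH].
  - apply (W_le _ 1); [|simpl; lia]. wc iInterval ruInterval. apply W_F. intros (I & E & H & _).
    destruct I; [tauto|discriminate].
  - change (sz (s # a) + depth_TG IS n + 1) with (S (sz s + sz a + depth_TG IS n + 1)).
    wc iInterval ruInterval. eapply W_iff.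
    + apply W_and; [eapply W_le; [apply W_MState; auto|lia]|].
      instantiate (1 := a = Lf \/ (exists u, hd' a = tsnoc s u) /\ (exists I, a = tL tP I /\ is_interval IS I)).
      intros _. destruct a as [|s' a]; cbn [tif hd'].
      * apply W_T. auto.
      * eapply W_iff. apply W_and; [eapply W_le; [apply W_Snoc|lia]|intros _; eapply W_le; [apply IH|lia]].
        split; [auto|]. intros [H|H]; [discriminate|auto].
    + split.
      * intros [(s0 & -> & Hs) [->|[[u Hu] (I & -> & HI)]]].
        -- exists [s0]. split; auto. apply is_interval_cons. auto.
        -- destruct I as [|s' I]; [destruct HI; tauto|]. simpl in Hu.
           apply tsnoc_tP in Hu as (g & -> & _).
           exists (s0 :: (s0 ++ [g]) :: I). split; auto. apply is_interval_cons. split; auto.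
           right. eauto.
      * intros ([|s0 I] & E & HI); [discriminate|]. inversion E; subst.
        apply is_interval_cons in HI as [Hs HI]. split; [eauto|].
        destruct HI as [->|(g & I' & -> & HI)]; [now left|]. right. split; [|eauto].
        exists (tV g). simpl. apply tsnoc_tP. eauto.
Qed.

(** * The complete check of an instance *)

Definition Good (T : tree) : Prop :=
  exists IS f I, T = tInst IS f I /\ wf_isrl IS /\ wf_fml IS f /\ is_interval IS I /\ sat IS f I.

Lemma wf_isrl_alt IS : wf_isrl IS <-> is_agents IS <> [] /\
  Forall (wf1 (map pre (is_agents IS))) (is_agents IS) /\
  Forall (fun r => Forall (fun g => Forall2 (fun v q => v < selA Lf q) g (map pre (is_agents IS))) (re_syms r))
    (is_lambda IS).
Proof.
  unfold wf_isrl.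
  assert (E1 : forall ag, wf_agent IS ag <-> wf1 (map pre (is_agents IS)) ag).
  { intros ag. unfold wf_agent, wf1.
    assert (E : forall t : nat * list nat * nat, (match t with (l, a, l') =>
            l < ag_nloc ag /\ valid_joint IS a /\ l' < ag_nloc ag end) <->
            wfT (map pre (is_agents IS)) (ag_nloc ag) t).
    { intros [[l a] l']. unfold wfT, valid_joint.
      pose proof (Forall2_map_r (fun v q => v < selA rT q) pre a (is_agents IS)). tauto. }
    assert (E' : forall l, Forall (fun t : nat * list nat * nat => match t with (l, a, l') =>
            l < ag_nloc ag /\ valid_joint IS a /\ l' < ag_nloc ag end) l <->
            Forall (wfT (map pre (is_agents IS)) (ag_nloc ag)) l).
    { intros l. split; apply Forall_impl; intros; apply E; auto. }
    rewrite E'. tauto. }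
  assert (E2 : forall r : re gstate, Forall (valid_gstate IS) (re_syms r) <->
    Forall (fun g => Forall2 (fun v q => v < selA Lf q) g (map pre (is_agents IS))) (re_syms r)).
  { intros r. split; apply Forall_impl; intros g Hg;
    apply (Forall2_map_r (fun v q => v < selA Lf q) pre g (is_agents IS)); auto. }
  split; intros (H1 & H2 & H3); repeat split; auto.
  - revert H2. apply Forall_impl; intros; apply E1; auto.
  - revert H3. apply Forall_impl; intros; apply E2; auto.
  - revert H2. apply Forall_impl; intros; apply E1; auto.
  - revert H3. apply Forall_impl; intros; apply E2; auto.
Qed.

Lemma fA_inj p q : fA p = fA q -> p = q.
Proof.
  destruct p as [[[[? ?] ?] ?] ?], q as [[[[? ?] ?] ?] ?]. simpl. intros E. injection E as E1 -> E2 -> ->.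
  apply tN_inj in E1, E2. now subst.
Qed.

Lemma pre_inj a b : pre a = pre b -> a = b.
Proof.
  destruct a, b. unfold pre; simpl. intros E. injection E as -> E1 -> E2 E3.
  apply tN_inj in E1. apply (tL_inj tV tV_inj) in E2. apply (tL_inj tTr tTr_inj) in E3. now subst.
Qed.

Lemma tAg_inj a b : tAg a = tAg b -> a = b.
Proof. intros E. apply pre_inj, fA_inj. exact E. Qed.

Lemma tRe_inj r : forall r', tRe r = tRe r' -> r = r'.
Proof.
  induction r; intros [] E; unfold tRe in E; fold tRe in E; try discriminate; try reflexivity; injection E; intros;
    f_equal; auto. now apply tV_inj.
Qed.

Lemma tF_inj f : forall f', tF f = tF f' -> f = f'.
Proof.
  induction f; intros [] E; unfold tF in E; fold tF in E; try discriminate; try reflexivity; injection E; intros;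
    f_equal; auto; try now apply tN_inj. now apply tV_inj.
Qed.

Lemma tInst_inj IS f I IS' f' I' : tInst IS f I = tInst IS' f' I' -> IS = IS' /\ f = f' /\ I = I'.
Proof.
  destruct IS, IS'. unfold tInst, tIS; simpl. intros E. injection E as E1 E2 E3 E4.
  apply (tL_inj tAg tAg_inj) in E1. apply (tL_inj tRe tRe_inj) in E2. apply tF_inj in E3.
  apply (tL_inj tP tP_inj) in E4. now subst.
Qed.

Lemma MC_BDE_Good w : MC_BDE w <-> exists T, w = true :: enc T /\ Good T.
Proof.
  unfold MC_BDE, Good. split.
  - intros (IS & f & I & -> & H). exists (tInst IS f I). rewrite enc_tInst. eauto 8.
  - intros (T & -> & IS & f & I & -> & H). exists IS, f, I. rewrite enc_tInst. auto.
Qed.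

(* A bound, in terms of the budget, on the depth of the whole game. *)
Definition depth_TG_bound n := 5 * n + 20.
Definition depth_Path_bound n := (4 * n + 1) + (depth_TG_bound n + (n + 2) * (n + 4) + n + 10) + depth_TG_bound n + 2.
Definition sat_depth_bound n := depth_Path_bound n + (n + 2) * (n + 4) + (n + n * ((n + 1) * (n + n + 6)) + 1) + 10 * n + 60.
Definition game_depth n := n * sat_depth_bound n + 30 * n + 60.

Lemma depth_TG_le IS n : sz (tAs IS) <= n -> depth_TG IS n <= depth_TG_bound n.
Proof. intros. unfold depth_TG, depth_TG_bound. lia. Qed.

Lemma sat_depth_le IS n : sz (tAs IS) <= n -> lambda_size IS <= n -> sat_depth IS n <= sat_depth_bound n.
Proof.
  intros HA HL. pose proof (depth_TG_le IS n HA) as HT.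
  unfold sat_depth, sat_depth_bound, depth_Path, depth_Path_bound, depth_Reach, depth_Var.
  assert (lambda_size IS * ((n + 1) * (n + n + 6)) <= n * ((n + 1) * (n + n + 6))) by (apply Nat.mul_le_mono_r; auto).
  lia.
Qed.

(** Agents and labelling are projected out of [T] into the environment before anything about [T] is
    known, so the claim covers trees that code no instance. *)
Lemma W_Main n AG LAM T : hd' (hd' T) = AG -> hd' (tl' (hd' T)) = LAM ->
  sz T * sz T + sz T + 3 <= n -> forall a, a = (T # Lf) # Lf ->
  W (tN n # AG # LAM) (game_depth n) (call iMain a) (Good T).
Proof.
  intros EA EL Hn a ->. set (e := tN n # AG # LAM).
  set (m := sz T) in *.
  assert (HDD : exists d, game_depth n = S d /\ n * sat_depth_bound n + 30 * n + 50 <= d) by (unfold game_depth; exists (n * sat_depth_bound n + 30 * n + 59); lia).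
  destruct HDD as (d & -> & Hd).
  apply (W_call iMain ruMain); [reflexivity|].
  unfold ruMain, p1, p2, p3, q2, q3; cbn [hd' tl' tif].
  assert (Bad : ~ (exists AG0 LAM0 f I, T = (AG0 # LAM0 # Lf) # f # I # Lf) -> W e d rF (Good T)).
  { intros H. apply W_F. intros (IS & f & I & -> & _). apply H. unfold tInst, tIS. eauto. }
  destruct T as [|s [|f [|I [|]]]]; cbn [hd' tl' tif] in *;
    try (apply Bad; intros (? & ? & ? & ? & ?); discriminate).
  destruct s as [|s1 [|s2 [|]]]; cbn [hd' tl' tif] in *;
    try (apply Bad; intros (? & ? & ? & ? & ?); discriminate).
  subst s1 s2. clear Bad.
  change (eA e) with AG. change (eL e) with LAM.
  assert (Hsz : sz AG + sz LAM + sz f + sz I + 5 <= m) by (unfold m; simpl; lia).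
  assert (Hmn : m <= n) by lia. assert (Hmm : m * m + 3 <= n) by lia. clearbody m.
  destruct AG as [|ag0 AG0]; cbn [tif].
  { apply W_F. intros (IS & f0 & I0 & E & (HN & _) & _). unfold tInst, tIS in E.
    inversion E. destruct (is_agents IS); [tauto|discriminate]. }
  set (AG := ag0 # AG0) in *.
  assert (HAG : AG <> Lf) by discriminate. clearbody AG. clear ag0 AG0.
  pose proof (sz_tN n) as HszN.
  eapply W_iff.
  - apply W_and; [eapply W_le; [apply W_AgShape|lia]|intros (l0 & El0)].
    assert (EA : eA e = tL fA l0) by (unfold e, eA; simpl; auto).
    assert (HeA : sz (eA e) = sz AG) by reflexivity.
    instantiate (1 := exists IS, AG = tAs IS /\ LAM = tL tRe (is_lambda IS) /\ wf_isrl IS /\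
      exists f0 I0, f = tF f0 /\ I = tL tP I0 /\ wf_fml IS f0 /\ is_interval IS I0 /\ sat IS f0 I0).
    eapply W_iff.
    + apply W_and; [subst AG; eapply W_le; [apply (W_AgWf e l0); auto|lia]|intros (ags & -> & Hags)].
      instantiate (1 := exists lam, LAM = tL tRe lam /\
        Forall (fun r => Forall (fun g => Forall2 (fun v q => v < selA Lf q) g l0) (re_syms r)) lam /\
        exists ags, AG = tL tAg ags /\ Forall (wf1 l0) ags /\
        let IS := mkISRL ags lam in exists f0 I0, f = tF f0 /\ I = tL tP I0 /\ wf_fml IS f0 /\ is_interval IS I0 /\ sat IS f0 I0).
      rewrite <- tAg_pre in El0.
      eapply W_iff.
      * apply W_and; [eapply W_le; [apply (W_LamWf e (map pre ags)); auto|lia]|intros (lam & -> & Hlam)].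
        (* From here on the environment is that of a well-formed [IS], and the lemmas of
           [Section Game] apply. *)
        set (IS := mkISRL ags lam).
        assert (Ee : e = env IS n) by (unfold e, env, tAs; simpl; now rewrite El0).
        assert (Ese : sz e <= 3 * n + 5) by (unfold e; simpl; lia).
        assert (Hwf : wf_isrl IS).
        { apply wf_isrl_alt. simpl. repeat split; auto. intros ->. apply HAG. exact El0. }
        assert (HAs : tAs IS = AG) by (unfold tAs; simpl; auto).
        assert (HAn : sz (tAs IS) <= n) by (rewrite HAs; lia).
        assert (HLn : lambda_size IS <= n) by (unfold lambda_size; simpl; lia).
        pose proof (depth_TG_le IS n HAn) as HTG. unfold depth_TG_bound in HTG.
        pose proof (sat_depth_le IS n HAn HLn) as HKK.
        assert (Hinit : valid_gstate IS (init_g IS)).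
        { destruct Hwf as (_ & Hw & _). unfold valid_gstate, init_g.
          assert (G : Forall (fun ag => ag_init ag < ag_nloc ag) (is_agents IS)).
          { revert Hw. apply Forall_impl. intros ag Ha. apply Ha. }
          clear - G. induction G; simpl; constructor; auto. }
        instantiate (1 := exists lam, LAM = tL tRe lam /\ exists ags, AG = tL tAg ags /\ let IS := mkISRL ags lam in
          exists f0 I0, f = tF f0 /\ I = tL tP I0 /\ wf_fml IS f0 /\ is_interval IS I0 /\ sat IS f0 I0).
        rewrite Ee. eapply W_iff.
        -- apply W_and; [eapply W_le; [apply (W_FmlWf IS n (sz f)); auto|rewrite <- Ee; lia]|intros (f0 & -> & Hf0)].
           instantiate (1 := exists I0, I = tL tP I0 /\ is_interval IS I0 /\ exists f0, f = tF f0 /\ sat IS f0 I0).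
           eapply W_iff.
           ++ apply W_and with (Q := exists I0, I = tL tP I0 /\ sat IS f0 I0);
                [eapply W_le; [apply (W_Interval IS n I); auto|lia]|intros (I0 & -> & HI0)].
              assert (HlI : length I0 <= m).
              { assert (length I0 <= sz (tL tP I0)); [|lia]. clear. induction I0; simpl; lia. }
              assert (Hell : length I0 * (sz (tAs IS) + 1) + 3 <= n).
              { rewrite HAs. assert (length I0 * (sz AG + 1) <= m * m) by (apply Nat.mul_le_mono; lia). lia. }
              assert (Hok : short_path IS (length I0) (map gof I0)).
              { split; [|now rewrite length_map]. apply rpath_valid; auto. now apply rpath_of_interval. }
              pose proof (short_path_sz IS n (length I0) HAn Hell _ Hok) as Hosz.
              eapply W_iff.
              ** eapply W_le; [apply (W_some (env IS n) n (sz (tF f0) * sat_depth IS n + 5 * n + 3)) with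
                   (Q := fun z => z = tP (map gof I0) /\ psat IS f0 (map gof I0)); auto|].
                 --- intros z Hz. replace (sz (tF f0) * sat_depth IS n + 5 * n + 3) with (S (sz (tF f0) * sat_depth IS n + 5 * n + 2)) by lia.
                     apply (W_call iWithGlobals ruWithGlobals); [reflexivity|]. unfold ruWithGlobals, p1, p2, q2; cbn [hd' tl' tif].
                     apply W_and; [eapply W_le; [apply W_Globals|lia]|intros ->].
                     eapply W_le; [apply (W_Sat IS n (length I0)); auto|lia].
                 --- intros z [-> _]. lia.
                 --- assert (sz (tF f0) * sat_depth IS n <= n * sat_depth_bound n) by (apply Nat.mul_le_mono; lia). lia.
              ** split.
                 --- intros (z & _ & H). exists I0. split; auto. now apply sat_psat.
                 --- intros (I1 & E1 & H). apply (tL_inj tP tP_inj) in E1.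
                     subst. exists (tP (map gof I1)). split; auto. now apply sat_psat.
           ++ split.
              ** intros [(I0 & -> & HI0) (I1 & E1 & H)]. apply (tL_inj tP tP_inj) in E1.
                 subst. exists I1. split; auto. split; auto. eauto.
              ** intros (I0 & -> & HI0 & f1 & E2 & H). apply tF_inj in E2. subst. split; eauto.
        -- split.
           ++ intros [(f1 & -> & Hf1) (I0 & -> & HI0 & f2 & E & H)]. apply tF_inj in E. subst f2.
              exists lam. split; auto. exists ags. split; auto. exists f1, I0. auto.
           ++ intros (lam' & E1 & ags' & E2 & f1 & I1 & -> & -> & H1 & H2 & H3).
              apply (tL_inj tRe tRe_inj) in E1. rewrite El0 in E2. apply (tL_inj tAg tAg_inj) in E2. subst lam' ags'.
              split; [exists f1; auto|]. exists I1. split; auto. split; auto. eauto.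
      * cbv zeta. split.
        -- intros [(lam & -> & Hlam) (lam' & E & ags' & E2 & H)]. apply (tL_inj tRe tRe_inj) in E. subst lam'.
           rewrite El0 in E2. apply (tL_inj tAg tAg_inj) in E2. subst ags'.
           exists lam. split; auto. split; auto. exists ags. auto.
        -- intros (lam & -> & Hlam & ags' & E2 & _ & H). split; eauto.
    + cbv zeta. split.
      * intros [(ags & -> & Hags) (lam & -> & Hlam & ags' & E & _ & H)].
        rewrite El0, <- tAg_pre in E. apply (tL_inj tAg tAg_inj) in E. subst ags'.
        exists (mkISRL ags lam). unfold tAs; simpl. rewrite El0, <- tAg_pre. split; auto. split; auto. split.
        -- apply wf_isrl_alt. simpl. repeat split; auto. intros ->. apply HAG. exact El0.
        -- exact H.
      * intros ([ags lam] & E & -> & Hwf & H). unfold tAs in *; simpl in *.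
        rewrite El0, tAg_pre in E. apply (tL_inj fA fA_inj) in E. subst l0.
        apply wf_isrl_alt in Hwf as (_ & H1 & H2). simpl in *.
        split; [eauto|]. exists lam. split; auto. split; auto. exists ags.
        rewrite El0, <- tAg_pre. auto.
  - unfold Good. split.
    + intros [_ (IS & -> & -> & Hwf & f0 & I0 & -> & -> & H)]. exists IS, f0, I0. split; [reflexivity|]. tauto.
    + intros (IS & f0 & I0 & E & Hwf & H). unfold tInst, tIS in E. injection E as E1 E2 E3 E4.
      split.
      * exists (map pre (is_agents IS)). now rewrite E1, tAg_pre.
      * exists IS. subst. split; auto. split; auto. split; auto. exists f0, I0. tauto.
Qed.

(** * Membership in polynomial space *)

(* Reads the input from right to left as a prefix code, on a stack of trees that initially
   holds the leaf closing the outermost parenthesis; [Lf] is the error state. *)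
Definition parf (p : tree) : tree :=
  let b := hd' (tl' p) in let st := tl' (tl' p) in
  tif st (tif b (tif (tl' st) ((hd' st # hd' (tl' st)) # tl' (tl' st)) Lf) (Lf # st)) Lf.

Definition parse (x : tree) : tree := foldrT parf Lf x (Lf # Lf).

Lemma parse_cons b w : parse (tbits (b :: w)) = parf (Lf # tbit b # parse (tbits w)).
Proof. reflexivity. Qed.

Lemma parse_enc t : forall w, parse (tbits w) <> Lf -> parse (tbits (enc t ++ w)) = t # parse (tbits w).
Proof.
  induction t as [|a IHa b IHb]; intros w H.
  - change (enc Lf ++ w) with (false :: w). rewrite parse_cons. unfold parf; cbn [hd' tl' tbit tif].
    destruct (parse (tbits w)); [tauto|reflexivity].
  - change (enc (a # b) ++ w) with (true :: (enc a ++ enc b) ++ w). rewrite <- app_assoc.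
    rewrite parse_cons, IHa; rewrite IHb; auto; try discriminate.
Qed.

Fixpoint encs (st : tree) : list bool := match st with Lf => [] | Nd t st => enc t ++ encs st end.

(** Invariant of reading from right to left; the additional [false] is the leaf lying on the initial
    stack. *)
Lemma parse_sound w : parse (tbits w) <> Lf -> w ++ [false] = encs (parse (tbits w)).
Proof.
  induction w as [|b w IH]; [reflexivity|]. rewrite parse_cons.
  unfold parf; cbn [hd' tl' tbit tif]. destruct (parse (tbits w)) as [|a st]; cbn [tif]; [tauto|].
  specialize (IH ltac:(discriminate)). simpl app. rewrite IH.
  destruct b; cbn [tbit tif].
  - destruct st as [|b st]; cbn [tl' hd' tif]; [tauto|]. intros _. simpl. now rewrite <- app_assoc.
  - reflexivity.
Qed.

(** Completed by that leaf, [true :: enc T] is the code of [T # Lf]; this explains the shape of the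
    resulting one-element stack. *)
Lemma parse_iff w T : parse (tbits w) = (T # Lf) # Lf <-> w = true :: enc T.
Proof.
  split.
  - intros E. pose proof (parse_sound w) as H. rewrite E in H. specialize (H ltac:(discriminate)).
    simpl in H. rewrite app_nil_r in H. change (true :: enc T ++ [false]) with ((true :: enc T) ++ [false]) in H.
    now apply app_inj_tail in H as [-> _].
  - intros ->. rewrite parse_cons. replace (enc T) with (enc T ++ []) by apply app_nil_r.
    rewrite parse_enc by discriminate. reflexivity.
Qed.

Lemma parse_sz w : sz (parse (tbits w)) <= 2 * length w + 3.
Proof.
  induction w as [|b w IH]; [simpl; lia|]. rewrite parse_cons.
  unfold parf; cbn [hd' tl' tif]. destruct (parse (tbits w)) as [|a st]; cbn [tif]; [simpl; lia|].
  destruct b; cbn [tbit tif]; [|simpl in *; lia].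
  destruct st as [|c st]; simpl in *; lia.
Qed.

Lemma FP_parf : FP parf.
Proof. unfold parf; cbv zeta; fp. Qed.

Lemma FP_parse : FP parse.
Proof.
  apply FP_foldrT; fp. exact FP_parf.
  exists (fun n => 3). split; [pbs|]. split; [monos|]. intros e0 b st. unfold parf; cbn [hd' tl' tif].
  destruct st as [|a st]; cbn [tif]; [simpl; lia|].
  destruct b; cbn [tif]; [simpl; lia|]. destruct st; simpl; lia.
Qed.

Definition unary (x : tree) : tree := mapT (fun _ => Lf) Lf x.
Definition mulT (x y : tree) : tree := flatT (fun p => hd' p) y x.

Lemma unary_tL {A} (f : A -> tree) l : unary (tL f l) = tN (length l).
Proof. unfold unary. rewrite mapT_tL. induction l; simpl; auto. now rewrite IHl. Qed.

Lemma tN_tL n : tN n = tL (fun _ : unit => Lf) (repeat tt n).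
Proof. induction n; simpl; auto. now rewrite IHn. Qed.

Lemma appT_tN n m : appT (tN n) (tN m) = tN (n + m).
Proof. rewrite !tN_tL, appT_tL, repeat_app. reflexivity. Qed.

Lemma mulT_tN n m : mulT (tN n) (tN m) = tN (n * m).
Proof.
  induction n as [|n IH]; [reflexivity|].
  change (mulT (tN (S n)) (tN m)) with (appT (tN m) (mulT (tN n) (tN m))). rewrite IH.
  apply appT_tN.
Qed.

Lemma FP_unary f : FP f -> FP (fun x => unary (f x)).
Proof. intros. apply FP_mapT; fp. Qed.
Lemma FP_mulT f g : FP f -> FP g -> FP (fun x => mulT (f x) (g x)).
Proof. intros. apply FP_flatT; fp. Qed.

(** The numeral of [2 * length w + 3], the bound of [parse_sz] on the parsed input. *)
Definition inlen (x : tree) : tree := Lf # Lf # Lf # appT (unary x) (unary x).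
(** Quadratic, since each of the at most [m] positions of a guessed path may hold a global state
    whose code is as large as the list of agents. *)
Definition budget (x : tree) : tree := Lf # Lf # Lf # appT (mulT (inlen x) (inlen x)) (inlen x).

Lemma budget_tbits w : let m := 2 * length w + 3 in budget (tbits w) = tN (m * m + m + 3).
Proof.
  cbv zeta. unfold budget, inlen. unfold tbits. rewrite !unary_tL, appT_tN.
  change (Lf # Lf # Lf # tN (length w + length w)) with (tN (3 + (length w + length w))).
  rewrite mulT_tN, appT_tN.
  replace (3 + (length w + length w)) with (2 * length w + 3) by lia.
  generalize ((2 * length w + 3) * (2 * length w + 3) + (2 * length w + 3)). intros k.
  rewrite (Nat.add_comm k 3). reflexivity.
Qed.

Lemma FP_budget : FP budget.
Proof.
  assert (FP inlen) by (unfold inlen; fp; apply FP_appT; apply FP_unary; fp).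
  unfold budget. fp. apply FP_appT; auto. apply FP_mulT; auto.
Qed.

Lemma W_Main_any n a : let T := hd' (hd' a) in sz a * sz a + sz a + 3 <= n ->
  W (tN n # hd' (hd' T) # hd' (tl' (hd' T))) (game_depth n) (call iMain a) (exists T, a = (T # Lf) # Lf /\ Good T).
Proof.
  intros T Hn.
  assert (Bad : (forall T, a <> (T # Lf) # Lf) ->
    W (tN n # hd' (hd' T) # hd' (tl' (hd' T))) (game_depth n) rF (exists T, a = (T # Lf) # Lf /\ Good T)).
  { intros H. apply W_F. intros (T' & E & _). now apply (H T'). }
  destruct a as [|[|T' [|]] [|]].
  4:{ eapply W_iff.
      - apply W_Main with (T := T'); auto. simpl in Hn. nia.
      - split; [eauto|]. intros (T1 & E & H). inversion E; now subst. }
  all: (apply (W_le _ 1); [|unfold game_depth; lia]);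
    apply (W_call iMain ruMain); [reflexivity|]; unfold ruMain; cbn [hd' tl' tif];
    apply W_F; intros (T1 & E & _); discriminate.
Qed.

Lemma tbits_sz w : length w <= sz (tbits w) <= 4 * length w + 1.
Proof. unfold tbits. induction w as [|[] w IH]; simpl in *; lia. Qed.

Theorem MC_BDE_in_PSPACE : in_PSPACE MC_BDE.
Proof.
  destruct (FP_size _ gstep_FP) as (G & HG & HGm & HGs).
  destruct (dfs_pspace gstep growth G gstep_FP) with
    (dom := fun x => exists w, x = tbits w)
    (L := fun x => exists T, parse x = (T # Lf) # Lf /\ Good T)
    (e := fun x => budget x # hd' (hd' (hd' (hd' (parse x)))) # hd' (tl' (hd' (hd' (hd' (parse x))))))
    (r := fun x => call iMain (parse x))
    (D := fun s => game_depth ((2 * s + 3) * (2 * s + 3) + (2 * s + 3) + 3))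
    as (c & P & HP & H).
  - apply gstep_ok.
  - exact HGm.
  - intros e p. specialize (HGs (e # p)). cbn [hd' tl'] in HGs.
    replace (sz e + sz p + 1) with (sz (e # p)) by (simpl; lia). exact HGs.
  - exact HG.
  - unfold game_depth, sat_depth_bound, depth_Path_bound, depth_TG_bound. pbs.
  - pose proof FP_parse. pose proof FP_budget. fp.
  - pose proof FP_parse. unfold call, rP. fp.
  - intros x. apply ok_P. simpl. lia.
  - intros x [w ->]. rewrite budget_tbits.
    set (m := 2 * length w + 3). set (n := m * m + m + 3).
    pose proof (parse_sz w) as Hp. fold m in Hp.
    destruct (W_Main_any n (parse (tbits w))) as (b & E & Hb).
    { unfold n. assert (sz (parse (tbits w)) * sz (parse (tbits w)) <= m * m) by (apply Nat.mul_le_mono; auto). lia. }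
    exists b. split; auto. eapply ev_le. exact E.
    pose proof (tbits_sz w) as [Hw _].
    assert (Hm : n <= (2 * sz (tbits w) + 3) * (2 * sz (tbits w) + 3) + (2 * sz (tbits w) + 3) + 3).
    { unfold n. assert (m * m <= (2 * sz (tbits w) + 3) * (2 * sz (tbits w) + 3)) by (apply Nat.mul_le_mono; unfold m; lia).
      unfold m in *. lia. }
    assert (MD : mono game_depth) by (unfold game_depth, sat_depth_bound, depth_Path_bound, depth_TG_bound; monos).
    apply MD. exact Hm.
  - destruct (pb_mono P HP) as (P' & HP' & HM' & HL').
    apply in_PSPACE_intro with c (fun n => P' (4 * n + 1)). pbs.
    intros w. destruct (H (tbits w)) as (y & T & Hc & Hy); eauto.
    destruct (Hc []) as (t & _ & E). exists y, t. rewrite !app_nil_r in E. split.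
    + eapply exec_le. exact E. simpl. rewrite Nat.add_0_r. etransitivity. apply HL'. apply HM'. apply tbits_sz.
    + rewrite Hy, MC_BDE_Good. split.
      * intros (T' & E1 & HT). apply parse_iff in E1. eauto.
      * intros (T' & E1 & HT). apply parse_iff in E1. eauto.
Qed.

(** * Hardness: tape cells as agents *)

(** The position of a cell relative to the head. The left end under the head is a case of its own,
    because a left move there stays put. *)
Inductive place := AtLeftEnd | AtHead | RightOf | LeftOf | Far.

Section Cells.
Variable Mc : TM.
Hypothesis HM : wf_TM Mc.

Notation ns := (tm_nsym Mc).
Notation nq := (tm_nstates Mc).

Definition lc (a : nat) (o : option nat) : nat :=
  match o with None => a | Some q => ns * S q + a end.
Definition cell_nloc := ns * S nq.
Definition cell_nact := S (nq * ns).
(** Shifted by one, as action 0 is idling. *)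
Definition code (q a : nat) : nat := S (q * ns + a).

(* On acceptance every cell goes to the local state 0, a blank cell without head. *)
Definition upS (kd : place) (q a : nat) : nat :=
  if q =? tm_accept Mc then 0 else
  match tm_delta Mc q a, kd with
  | (q', b, MoveS), _ | (q', b, MoveL), AtLeftEnd => lc b (Some q')
  | (q', b, _), _ => lc b None
  end.

Definition upN (kd : place) (q a a' : nat) : nat :=
  if q =? tm_accept Mc then 0 else
  match tm_delta Mc q a, kd with
  | (q', b, MoveR), RightOf | (q', b, MoveL), LeftOf => lc a' (Some q')
  | _, _ => lc a' None
  end.

(** Away from the head only local states without control state have transitions. In the rejecting
    state nothing moves, whatever [tm_delta] says there. *)
Definition pairs (kd : place) (q a : nat) : list (nat * nat) :=
  if q =? tm_reject Mc then [] else
  match kd with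
  | AtLeftEnd | AtHead => [(lc a (Some q), upS kd q a)]
  | _ => map (fun a' => (a', upN kd q a a')) (seq 0 ns)
  end.

Definition tbl (kd : place) : list (nat * nat * nat) :=
  flat_map (fun q => flat_map (fun a =>
    map (fun p => (code q a, fst p, snd p)) (pairs kd q a)) (seq 0 ns)) (seq 0 nq).

Definition kind (k i : nat) : place :=
  if k =? i then (if i =? 0 then AtLeftEnd else AtHead)
  else if k =? S i then RightOf else if S k =? i then LeftOf else Far.

Lemma in_tbl kd x l l' : In (x, l, l') (tbl kd) <->
  exists q a, q < nq /\ a < ns /\ x = code q a /\ In (l, l') (pairs kd q a).
Proof.
  unfold tbl. rewrite in_flat_map. split.
  - intros (q & Hq & H). apply in_flat_map in H as (a & Ha & H). apply in_map_iff in H as ([u v] & E & H).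
    inversion E; subst. apply in_seq in Hq, Ha. exists q, a. repeat split; auto; lia.
  - intros (q & a & Hq & Ha & -> & H). exists q. split. apply in_seq; lia.
    apply in_flat_map. exists a. split. apply in_seq; lia. apply in_map_iff. exists (l, l'). auto.
Qed.

Lemma ns_pos : 3 <= ns.
Proof. apply HM. Qed.

Lemma code_inj q a q' a' : a < ns -> a' < ns -> code q a = code q' a' -> q = q' /\ a = a'.
Proof.
  unfold code. intros Ha Ha' E.
  assert (E' : ns * q + a = ns * q' + a') by lia.
  apply Nat.div_mod_unique in E'; auto.
Qed.

Lemma lc_inj a o a' o' : a < ns -> a' < ns -> lc a o = lc a' o' -> a = a' /\ o = o'.
Proof.
  unfold lc. intros Ha Ha' E. destruct o as [q|], o' as [q'|].
  - apply Nat.div_mod_unique in E as [E1 E2]; auto.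
  - exfalso. pose proof ns_pos. nia.
  - exfalso. pose proof ns_pos. nia.
  - auto.
Qed.

Definition okq (o : option nat) : Prop := match o with Some q => q < nq | None => True end.

Lemma lc_lt a o : a < ns -> okq o -> lc a o < cell_nloc.
Proof. unfold lc, cell_nloc. destruct o as [q|]; simpl; intros; nia. Qed.

Lemma code_lt q a : q < nq -> a < ns -> code q a < cell_nact.
Proof. unfold code, cell_nact. intros. nia. Qed.

Lemma delta_ok q a q' b mv : q < nq -> a < ns -> tm_delta Mc q a = (q', b, mv) -> q' < nq /\ b < ns.
Proof. intros Hq Ha E. destruct HM as (_ & _ & _ & _ & _ & H). specialize (H q a Hq Ha). now rewrite E in H. Qed.

Lemma nloc_pos : 0 < cell_nloc.
Proof. unfold cell_nloc. pose proof ns_pos. nia. Qed.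

Lemma pairs_lt kd q a l l' : q < nq -> a < ns -> In (l, l') (pairs kd q a) -> l < cell_nloc /\ l' < cell_nloc.
Proof.
  intros Hq Ha. unfold pairs. destruct (q =? tm_reject Mc); [intros []|].
  pose proof nloc_pos.
  destruct (tm_delta Mc q a) as [[q' b] mv] eqn:E.
  destruct (delta_ok _ _ _ _ _ Hq Ha E) as [Hq' Hb].
  assert (HS : forall kd, upS kd q a < cell_nloc).
  { intros kd0. unfold upS. destruct (q =? tm_accept Mc); auto. rewrite E.
    destruct mv, kd0; apply lc_lt; simpl; auto. }
  assert (HN : forall kd a', a' < ns -> upN kd q a a' < cell_nloc).
  { intros kd0 a' Ha'. unfold upN. destruct (q =? tm_accept Mc); auto. rewrite E.
    destruct mv, kd0; apply lc_lt; simpl; auto. }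
  assert (H1 : forall kd, In (l, l') [(lc a (Some q), upS kd q a)] -> l < cell_nloc /\ l' < cell_nloc).
  { intros kd0 [E'|[]]. injection E' as <- <-. split; [apply (lc_lt a (Some q)); auto|auto]. }
  assert (H2 : forall kd, In (l, l') (map (fun a' => (a', upN kd q a a')) (seq 0 ns)) -> l < cell_nloc /\ l' < cell_nloc).
  { intros kd0 HI. apply in_map_iff in HI as (a' & E' & HI). apply in_seq in HI. injection E' as <- <-.
    split; [apply (lc_lt _ None); simpl; auto; lia|apply HN; lia]. }
  destruct kd; (apply H1 || apply H2).
Qed.

(** * The cells as agents of one system *)

Variables (n : nat) (w : list bool).

Definition joint (i x : nat) : list nat := map (fun j => if j =? i then x else 0) (seq 0 n).

Definition trans (k : nat) : list (nat * list nat * nat) :=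
  flat_map (fun i => map (fun t => (snd (fst t), joint i (fst (fst t)), snd t)) (tbl (kind k i))) (seq 0 n).

Definition symw (k : nat) : nat := nth k (map sym_of_bool w) 0.

Definition cell_init (k : nat) : nat := lc (symw k) (if k =? 0 then Some (tm_start Mc) else None).

(** The protocol permits every action in every local state; the transition relations alone single
    out the effective joint actions. *)
Definition cell_agent (k : nat) : agent :=
  mkAgent cell_nloc (cell_init k) cell_nact (repeat (seq 0 cell_nact) cell_nloc) (trans k).

Definition cellIS : isrl := mkISRL (map cell_agent (seq 0 n)) [ReSym (repeat 0 n)].

Lemma nth_map_seq {A} (f : nat -> A) d k m : k < m -> nth k (map f (seq 0 m)) d = f k.
Proof.
  intros H. rewrite (nth_indep _ d (f 0)) by (rewrite length_map, length_seq; auto).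
  rewrite map_nth, seq_nth; auto.
Qed.

Lemma Forall2_seq {A B} (R : A -> B -> Prop) (f : nat -> B) d : forall m s g,
  Forall2 R g (map f (seq s m)) <-> length g = m /\ forall k, k < m -> R (nth k g d) (f (s + k)).
Proof.
  induction m as [|m IH]; intros s g; simpl.
  - split.
    + intros H; inversion H; subst. split; auto. intros; lia.
    + intros [H _]. destruct g; [constructor|discriminate].
  - split.
    + intros H; inversion H; subst. apply IH in H4 as [H5 H6]. simpl. split; auto.
      intros [|k] Hk. rewrite Nat.add_0_r; auto. rewrite <- Nat.add_succ_comm. apply H6. lia.
    + intros [H1 H2]. destruct g as [|a g]; [discriminate|]. constructor.
      * specialize (H2 0). simpl in H2. rewrite Nat.add_0_r in H2. apply H2. lia.
      * apply IH. simpl in H1. split; auto. intros k Hk. specialize (H2 (S k)). simpl in H2.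
        rewrite <- Nat.add_succ_comm in H2. apply H2. lia.
Qed.

Lemma valid_cell g : valid_gstate cellIS g <-> length g = n /\ forall k, k < n -> nth k g 0 < cell_nloc.
Proof. unfold valid_gstate. simpl. rewrite (Forall2_seq _ cell_agent 0). reflexivity. Qed.

Lemma valid_joint_cell g : valid_joint cellIS g <-> length g = n /\ forall k, k < n -> nth k g 0 < cell_nact.
Proof. unfold valid_joint. simpl. rewrite (Forall2_seq _ cell_agent 0). reflexivity. Qed.

Lemma joint_valid i x : x < cell_nact -> valid_joint cellIS (joint i x).
Proof.
  intros Hx. apply valid_joint_cell. unfold joint. rewrite length_map, length_seq. split; auto.
  intros k Hk. rewrite nth_map_seq; auto. destruct (k =? i); auto. unfold cell_nact; lia.
Qed.

Lemma joint_inj i x i' x' : i < n -> 0 < x -> joint i x = joint i' x' -> i = i' /\ x = x'.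
Proof.
  intros Hi Hx E. apply (f_equal (fun l => nth i l 0)) in E. unfold joint in E.
  rewrite !nth_map_seq in E by auto. rewrite Nat.eqb_refl in E.
  destruct (Nat.eqb_spec i i'); [auto|lia].
Qed.

Lemma agent_cell k : k < n -> agent_of cellIS k = cell_agent k.
Proof. intros H. unfold agent_of. simpl. apply nth_map_seq; auto. Qed.

Lemma in_trans k l z l' : In (l, z, l') (trans k) <->
  exists i x, i < n /\ z = joint i x /\ In (x, l, l') (tbl (kind k i)).
Proof.
  unfold trans. rewrite in_flat_map. split.
  - intros (i & Hi & H). apply in_map_iff in H as ([[x u] v] & E & H). simpl in E. inversion E; subst.
    apply in_seq in Hi. exists i, x. repeat split; auto; lia.
  - intros (i & x & Hi & -> & H). exists i. split. apply in_seq; lia. apply in_map_iff.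
    exists (x, l, l'). auto.
Qed.

Lemma tG_cell g g' : 0 < n -> tG cellIS g g' <->
  valid_gstate cellIS g /\ valid_gstate cellIS g' /\
  exists i q a, i < n /\ q < nq /\ a < ns /\
    forall k, k < n -> In (nth k g 0, nth k g' 0) (pairs (kind k i) q a).
Proof.
  intros Hn. unfold tG. simpl. rewrite length_map, length_seq. split.
  - intros (H1 & H2 & z & H3 & H4). split; auto. split; auto.
    (* The transitions of any one agent reveal the form of the joint action; agent 0 exists because
       [0 < n]. *)
    destruct (H4 0 Hn) as [_ H5]. rewrite agent_cell in H5 by auto.
    cbn [ag_trans cell_agent] in H5. apply in_trans in H5 as (i & x & Hi & Ez & H5).
    apply in_tbl in H5 as (q & a & Hq & Ha & Ex & _).
    exists i, q, a. repeat split; auto. intros k Hk.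
    destruct (H4 k Hk) as [_ H6]. rewrite agent_cell in H6 by auto.
    cbn [ag_trans cell_agent] in H6. apply in_trans in H6 as (i' & x' & Hi' & Ez' & H6). subst z.
    apply joint_inj in Ez' as [<- <-]; auto; [|subst; unfold code; lia].
    apply in_tbl in H6 as (q' & a' & Hq' & Ha' & Ex' & H6). subst x.
    apply code_inj in Ex' as [<- <-]; auto.
  - intros (H1 & H2 & i & q & a & Hi & Hq & Ha & H). split; auto. split; auto.
    exists (joint i (code q a)). split. apply joint_valid, code_lt; auto.
    intros k Hk. rewrite agent_cell by auto. cbn [ag_prot ag_trans cell_agent]. split.
    + apply valid_cell in H1 as [_ H1]. rewrite nth_repeat_lt by auto.
      apply in_seq. split; [lia|].
      pose proof (joint_valid i (code q a) (code_lt q a Hq Ha)) as HJ. apply valid_joint_cell in HJ as [_ HJ].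
      now apply HJ.
    + apply in_trans. exists i, (code q a). repeat split; auto. apply in_tbl. eauto 8.
Qed.

(* The global state of a configuration in state [q] with head at [h] and tape [f]. *)
Definition gcfg (q h : nat) (f : nat -> nat) : list nat :=
  map (fun k => lc (f k) (if k =? h then Some q else None)) (seq 0 n).

Lemma gcfg_nth q h f k : k < n -> nth k (gcfg q h f) 0 = lc (f k) (if k =? h then Some q else None).
Proof.
  intros. unfold gcfg.
  now apply (nth_map_seq (fun k => lc (f k) (if k =? h then Some q else None))).
Qed.

Lemma gcfg_length q h f : length (gcfg q h f) = n.
Proof. unfold gcfg. now rewrite length_map, length_seq. Qed.

Lemma gcfg_valid q h f : q < nq -> (forall j, f j < ns) -> valid_gstate cellIS (gcfg q h f).
Proof.
  intros Hq Hf. apply valid_cell. rewrite gcfg_length. split; auto. intros k Hk.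
  rewrite gcfg_nth by auto. apply lc_lt; auto. destruct (k =? h); simpl; auto.
Qed.

Lemma zeros_valid : valid_gstate cellIS (repeat 0 n).
Proof.
  apply valid_cell. rewrite repeat_length. split; auto. intros k Hk. rewrite nth_repeat.
  apply nloc_pos.
Qed.

Lemma gcfg_zeros q h f : h < n -> f h < ns -> gcfg q h f <> repeat 0 n.
Proof.
  intros Hh Hf E. apply (f_equal (fun l => nth h l 0)) in E.
  rewrite gcfg_nth, nth_repeat, Nat.eqb_refl in E by auto. pose proof ns_pos.
  unfold lc in E. nia.
Qed.

(** The acting cell needs a control state, and the local state 0 has none. *)
Lemma zeros_stuck g : 0 < n -> ~ tG cellIS (repeat 0 n) g.
Proof.
  intros Hn H. apply tG_cell in H as (_ & _ & i & q & a & Hi & Hq & Ha & H); auto.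
  specialize (H i Hi). rewrite nth_repeat in H. unfold pairs, kind in H. rewrite Nat.eqb_refl in H.
  destruct (q =? tm_reject Mc); [destruct H|]. pose proof ns_pos.
  destruct (i =? 0); destruct H as [E|[]]; inversion E as [[E1 E2]]; unfold lc in E1; nia.
Qed.

(* Only the cell under the head can play the head's part, so the joint action is determined. *)
Lemma gcfg_succ q h f g : h < n -> q < nq -> (forall j, f j < ns) -> tG cellIS (gcfg q h f) g ->
  q <> tm_reject Mc /\ forall k, k < n ->
    nth k g 0 = if k =? h then upS (kind h h) q (f h) else upN (kind k h) q (f h) (f k).
Proof.
  intros Hh Hq Hf H. apply tG_cell in H as (H1 & H2 & i & q' & a & Hi & Hq' & Ha & H); [|lia].
  assert (i = h /\ q' = q /\ a = f h /\ q <> tm_reject Mc) as (-> & -> & -> & Hr).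
  { pose proof (H i Hi) as H0. rewrite gcfg_nth in H0 by auto. unfold pairs, kind in H0.
    rewrite Nat.eqb_refl in H0. destruct (Nat.eqb_spec q' (tm_reject Mc)); [destruct H0|].
    assert (E : lc a (Some q') = lc (f i) (if i =? h then Some q else None)).
    { destruct (i =? 0); destruct H0 as [E|[]]; now inversion E. }
    apply lc_inj in E as [-> E]; auto. destruct (Nat.eqb_spec i h); inversion E; subst; auto. }
  split; auto. intros k Hk. specialize (H k Hk). rewrite gcfg_nth in H by auto. unfold pairs in H.
  rewrite (proj2 (Nat.eqb_neq _ _) Hr) in H.
  destruct (Nat.eq_dec k h) as [Ekh|Hkh]; [subst k; rewrite Nat.eqb_refl in *|rewrite (proj2 (Nat.eqb_neq _ _) Hkh) in *].
  - unfold kind in *. rewrite Nat.eqb_refl in *. destruct (h =? 0); destruct H as [E|[]]; now inversion E.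
  - assert (HK : kind k h <> AtLeftEnd /\ kind k h <> AtHead).
    { unfold kind. destruct (Nat.eqb_spec k h); [tauto|].
      destruct (k =? S h), (S k =? h); split; discriminate. }
    destruct (kind k h); try tauto; apply in_map_iff in H as (a' & E & _); inversion E as [[E1 E2]];
    simpl in E1; subst; auto.
Qed.

Lemma gcfg_succ_intro q h f g : h < n -> q < nq -> (forall j, f j < ns) -> q <> tm_reject Mc ->
  valid_gstate cellIS g ->
  (forall k, k < n ->
    nth k g 0 = if k =? h then upS (kind h h) q (f h) else upN (kind k h) q (f h) (f k)) ->
  tG cellIS (gcfg q h f) g.
Proof.
  intros Hh Hq Hf Hr Hg H. apply tG_cell; [lia|]. split. now apply gcfg_valid. split; auto.
  exists h, q, (f h). repeat split; auto. intros k Hk. rewrite gcfg_nth, H by auto. unfold pairs.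
  destruct (Nat.eqb_spec q (tm_reject Mc)); [contradiction|].
  destruct (Nat.eqb_spec k h) as [->|Hkh].
  - unfold kind. rewrite Nat.eqb_refl. destruct (h =? 0); now left.
  - assert (HK : kind k h <> AtLeftEnd /\ kind k h <> AtHead).
    { unfold kind. destruct (Nat.eqb_spec k h); [tauto|].
      destruct (k =? S h), (S k =? h); split; discriminate. }
    assert (HI : In (f k, upN (kind k h) q (f h) (f k)) (map (fun a' => (a', upN (kind k h) q (f h) a')) (seq 0 ns))).
    { apply in_map_iff. exists (f k). split; auto. apply in_seq. specialize (Hf k). lia. }
    destruct (kind k h); try tauto; exact HI.
Qed.

Lemma up_step q h f q' b mv k : q <> tm_accept Mc -> tm_delta Mc q (f h) = (q', b, mv) ->
  (if k =? h then upS (kind h h) q (f h) else upN (kind k h) q (f h) (f k)) =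
  lc (upd f h b k) (if k =? mvh mv h then Some q' else None).
Proof.
  intros Ha E. unfold upS, upN, upd, mvh. destruct (Nat.eqb_spec q (tm_accept Mc)); [tauto|].
  rewrite E. destruct (Nat.eqb_spec k h) as [->|Hkh].
  - unfold kind. rewrite Nat.eqb_refl. destruct mv.
    + destruct (Nat.eqb_spec h 0) as [->|]; simpl; auto.
      destruct (Nat.eqb_spec h (h - 1)); [lia|auto].
    + destruct (Nat.eqb_spec h (S h)); [lia|]. destruct (h =? 0); auto.
    + rewrite Nat.eqb_refl. destruct (h =? 0); auto.
  - unfold kind. destruct (Nat.eqb_spec k h); [tauto|]. destruct mv.
    + destruct (Nat.eqb_spec k (S h)).
      * destruct (Nat.eqb_spec k (h - 1)); [lia|auto].
      * destruct (Nat.eqb_spec (S k) h), (Nat.eqb_spec k (h - 1)); auto; lia.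
    + destruct (Nat.eqb_spec k (S h)); auto. destruct (S k =? h); auto.
    + destruct (Nat.eqb_spec k h); [tauto|]. destruct (k =? S h), (S k =? h); auto.
Qed.

Lemma gcfg_ext q h f g : length g = n ->
  (forall k, k < n -> nth k g 0 = lc (f k) (if k =? h then Some q else None)) -> g = gcfg q h f.
Proof.
  intros HL H. apply (nth_ext _ _ 0 0). now rewrite gcfg_length. intros k Hk.
  rewrite HL in Hk. now rewrite gcfg_nth, H.
Qed.

Lemma gcfg_step q h f q' b mv g : h < n -> q < nq -> (forall j, f j < ns) ->
  q <> tm_accept Mc -> q <> tm_reject Mc -> tm_delta Mc q (f h) = (q', b, mv) ->
  (tG cellIS (gcfg q h f) g <-> g = gcfg q' (mvh mv h) (upd f h b)).
Proof.
  intros Hh Hq Hf Ha Hr E. destruct (delta_ok _ _ _ _ _ Hq (Hf h) E) as [Hq' Hb].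
  split.
  - intros H. apply gcfg_ext.
    + apply valid_cell. apply H.
    + intros k Hk. apply gcfg_succ in H as [_ H]; auto. rewrite H by auto. now apply up_step.
  - intros ->. apply gcfg_succ_intro; auto.
    + apply gcfg_valid; auto. intros j. unfold upd. destruct (j =? h); auto.
    + intros k Hk. rewrite gcfg_nth by auto. symmetry. now apply up_step.
Qed.

Lemma gcfg_accept h f g : h < n -> (forall j, f j < ns) ->
  (tG cellIS (gcfg (tm_accept Mc) h f) g <-> g = repeat 0 n).
Proof.
  intros Hh Hf. destruct HM as (_ & _ & Hq & _ & Hne & _).
  assert (E : forall k, (if k =? h then upS (kind h h) (tm_accept Mc) (f h)
    else upN (kind k h) (tm_accept Mc) (f h) (f k)) = 0).
  { intros k. unfold upS, upN. rewrite Nat.eqb_refl. destruct (k =? h); auto. }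
  split.
  - intros H. assert (HL : length g = n) by (apply valid_cell, H).
    apply (nth_ext _ _ 0 0). now rewrite repeat_length. intros k Hk.
    apply gcfg_succ in H as [_ H]; auto. rewrite H, E, nth_repeat; auto. lia.
  - intros ->. apply gcfg_succ_intro; auto. apply zeros_valid.
    intros k Hk. now rewrite E, nth_repeat.
Qed.

Lemma init_cell : init_g cellIS = gcfg (tm_start Mc) 0 symw.
Proof.
  unfold init_g, cellIS, gcfg. simpl. rewrite map_map. reflexivity.
Qed.

Lemma symw_lt j : symw j < ns.
Proof.
  pose proof ns_pos. unfold symw. destruct (nth_in_or_default j (map sym_of_bool w) 0) as [H1| ->]; [|lia].
  apply in_map_iff in H1 as ([] & <- & _); simpl; lia.
Qed.

Lemma wf_cellIS : 0 < n -> wf_isrl cellIS.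
Proof.
  intros Hn. assert (Hst : tm_start Mc < nq) by apply HM. split; [|split].
  - simpl. destruct n; [lia|discriminate].
  - simpl. apply Forall_forall. intros ag H. apply in_map_iff in H as (k & <- & Hk).
    split; [|split; [|split]]; simpl.
    + unfold cell_init. apply lc_lt. apply symw_lt. destruct (k =? 0); simpl; auto.
    + apply repeat_length.
    + apply Forall_forall. intros l Hl. apply repeat_spec in Hl. subst. apply Forall_forall.
      intros x Hx. change (In x (seq 0 cell_nact)) in Hx. apply in_seq in Hx. lia.
    + apply Forall_forall. intros [[l z] l'] H. apply in_trans in H as (i & x & Hi & -> & H).
      apply in_tbl in H as (q & a & Hq & Ha & -> & H). apply pairs_lt in H as [? ?]; auto.
      repeat split; auto. apply joint_valid, code_lt; auto.
  - simpl. constructor; auto. simpl. constructor; auto. apply zeros_valid.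
Qed.

Definition cell_fml : fml := FNeg (FK (n - 1) (FNeg (FVar 0))).

Lemma nth_gcfg_last q h f : S h < n -> f (n - 1) = 0 -> nth (n - 1) (gcfg q h f) 0 = 0.
Proof.
  intros Hh E. rewrite gcfg_nth, E by lia. destruct (Nat.eqb_spec (n - 1) h); [lia|reflexivity].
Qed.

Lemma interval_init IS : is_interval IS [[init_g IS]].
Proof.
  apply is_interval_cons. split; auto. apply is_mstate_chain. simpl. repeat split; auto. discriminate.
Qed.

(** An interval of length 1 is similar only to intervals of length 1, that is, to single reachable
    global states. The all-zero one is not excluded, as the last agent is in local state 0 initially
    too. *)
Lemma sat_cell : 1 < n -> nth (n - 1) (init_g cellIS) 0 = 0 ->
  (sat cellIS cell_fml [[init_g cellIS]] <-> reach cellIS (repeat 0 n)).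
Proof.
  intros Hn E0. rewrite sat_psat by apply interval_init.
  change (map gof [[init_g cellIS]]) with [init_g cellIS]. unfold cell_fml. cbn [psat nth cellIS is_lambda].
  split.
  - intros H. apply NNPP. intros HR. apply H. intros P' HP _ HL. inversion HL; subst.
    apply HR. apply HP.
  - intros HR H. apply (H [repeat 0 n]).
    + repeat split; auto. discriminate.
    + constructor; [|constructor]. rewrite E0. now rewrite nth_repeat.
    + constructor.
Qed.

(** * Reachable states and the run of the machine *)

Section Run.
Variable nh : nat.
Notation rn j := (run Mc (init_cfg Mc w) j).
Hypothesis Hhalt : halted Mc (rn nh).
Hypothesis Hspace : forall j, j <= nh -> cfg_space (rn j) < n.

Definition tape (c : config) (j : nat) : nat := nth j (rev (cf_left c) ++ cf_right c) 0.
Definition G (c : config) : list nat := gcfg (cf_state c) (length (cf_left c)) (tape c).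

Lemma rep_tape c : rep c (cf_state c) (length (cf_left c)) (tape c).
Proof. repeat split. Qed.

Lemma run_S j : rn (S j) = step Mc (rn j).
Proof. reflexivity. Qed.

(** Because the space bound is strict, the head stays off cell [n - 1]. *)
Lemma head_lt j : j <= nh -> S (length (cf_left (rn j))) < n.
Proof. intros H. specialize (Hspace j H). unfold cfg_space in Hspace. lia. Qed.

Lemma run_ok j : cf_state (rn j) < nq /\ forall i, tape (rn j) i < ns.
Proof.
  induction j as [|j [H1 H2]].
  - split. apply HM. intros i. apply symw_lt.
  - rewrite run_S.
    destruct (Nat.eq_dec (cf_state (rn j)) (tm_accept Mc)) as [Ea|Ea].
    { unfold step. rewrite Ea, Nat.eqb_refl. simpl. rewrite Ea in H1. rewrite Ea. auto. }
    destruct (Nat.eq_dec (cf_state (rn j)) (tm_reject Mc)) as [Er|Er].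
    { unfold step. rewrite Er, Nat.eqb_refl, orb_true_r. simpl. rewrite Er in H1. rewrite Er. auto. }
    destruct (tm_delta Mc (cf_state (rn j)) (tape (rn j) (length (cf_left (rn j))))) as [[q' b] mv] eqn:E.
    destruct (step_gen Mc _ _ _ _ _ _ _ (rep_tape (rn j)) Ea Er E) as [(R1 & R2 & R3) _].
    destruct (delta_ok _ _ _ _ _ H1 (H2 _) E) as [Hq' Hb]. rewrite R1. split; auto.
    intros i. unfold tape at 1. rewrite R3. unfold upd. destruct (i =? _); auto.
Qed.

Lemma G_step j g : j < nh -> ~ halted Mc (rn j) -> (tG cellIS (G (rn j)) g <-> g = G (rn (S j))).
Proof.
  intros Hj Hh. destruct (run_ok j) as [H1 H2].
  assert (Ea : cf_state (rn j) <> tm_accept Mc) by (intros E; apply Hh; now left).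
  assert (Er : cf_state (rn j) <> tm_reject Mc) by (intros E; apply Hh; now right).
  destruct (tm_delta Mc (cf_state (rn j)) (tape (rn j) (length (cf_left (rn j))))) as [[q' b] mv] eqn:E.
  destruct (step_gen Mc _ _ _ _ _ _ _ (rep_tape (rn j)) Ea Er E) as [(R1 & R2 & R3) _].
  assert (Hl : length (cf_left (rn j)) < n) by (pose proof (head_lt j ltac:(lia)); lia).
  unfold G at 1. rewrite (gcfg_step _ _ _ _ _ _ g Hl H1 H2 Ea Er E).
  assert (EG : gcfg q' (mvh mv (length (cf_left (rn j)))) (upd (tape (rn j)) (length (cf_left (rn j))) b) = G (rn (S j))).
  { rewrite run_S. unfold G. rewrite R1, R2. apply gcfg_ext. apply gcfg_length.
    intros k Hk. rewrite gcfg_nth by auto. unfold tape at 2. now rewrite R3. }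
  rewrite EG. reflexivity.
Qed.

Lemma halted_stable j : halted Mc (rn j) -> forall i, j <= i -> rn i = rn j.
Proof.
  intros H i Hi. induction Hi as [|i Hi IH]; auto. rewrite run_S, IH. unfold step.
  destruct H as [-> | ->]; rewrite Nat.eqb_refl, ?orb_true_r; reflexivity.
Qed.

(** The system is deterministic along the run: a running configuration has one successor, a
    rejecting one none, and an accepting one leads only to the stuck all-zero state. *)
Lemma reach_inv g : reach cellIS g ->
  (exists j, j <= nh /\ g = G (rn j)) \/ (g = repeat 0 n /\ cf_state (rn nh) = tm_accept Mc).
Proof.
  assert (B : exists j, j <= nh /\ init_g cellIS = G (rn 0)).
  { exists 0. split. lia. exact init_cell. }
  destruct B as (_ & _ & B).
  assert (Hn : 0 < n) by (pose proof (head_lt 0 ltac:(lia)); lia).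
  assert (ST : forall g g', ((exists j, j <= nh /\ g = G (rn j)) \/ (g = repeat 0 n /\ cf_state (rn nh) = tm_accept Mc)) ->
     tG cellIS g g' -> (exists j, j <= nh /\ g' = G (rn j)) \/ (g' = repeat 0 n /\ cf_state (rn nh) = tm_accept Mc)).
  { intros g1 g2 [(j & Hj & ->)|[-> _]] H; [|now apply zeros_stuck in H].
    destruct (classic (halted Mc (rn j))) as [Hh|Hh].
    (* A halted configuration persists, so the verdict at time [j] is the one at time [nh]. *)
    - right. pose proof (halted_stable j Hh nh Hj) as Es. rewrite Es.
      pose proof (head_lt j Hj). destruct (run_ok j) as [H1 H2]. destruct Hh as [Hh|Hh].
      + split; auto. unfold G in H. rewrite Hh in H. apply gcfg_accept in H; auto. lia.
      + exfalso. unfold G in H. apply gcfg_succ in H as [H _]; auto; lia.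
    - assert (j <> nh) by (intros ->; tauto). left. exists (S j). split. lia.
      apply G_step in H; auto. lia. }
  intros [<-|H].
  - left. exists 0. split. lia. exact B.
  - apply clos_trans_tn1 in H. induction H as [g H|g g' H _ IH]; [|exact (ST _ _ IH H)].
    refine (ST _ _ _ H). left. exists 0. split. lia. exact B.
Qed.

Lemma reach_run j : j <= nh -> reach cellIS (G (rn j)).
Proof.
  induction j as [|j IH]; intros Hj.
  - left. exact init_cell.
  - specialize (IH ltac:(lia)). destruct (classic (halted Mc (rn j))) as [Hh|Hh].
    + rewrite (halted_stable j Hh (S j)) by lia. exact IH.
    + assert (T : tG cellIS (G (rn j)) (G (rn (S j)))) by (apply G_step; auto).
      right. destruct IH as [->|IH]. now apply t_step. eapply t_trans; [exact IH|now apply t_step].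
Qed.

Lemma cells_accept : sat cellIS cell_fml [[init_g cellIS]] <-> cf_state (rn nh) = tm_accept Mc.
Proof.
  pose proof (head_lt 0 ltac:(lia)) as H0.
  assert (E0 : nth (n - 1) (init_g cellIS) 0 = 0).
  { rewrite init_cell. apply nth_gcfg_last. simpl in H0. lia.
    unfold symw. apply nth_overflow. specialize (Hspace 0 ltac:(lia)). unfold cfg_space in Hspace.
    simpl in Hspace. lia. }
  rewrite sat_cell; [|lia|exact E0]. split.
  - intros H. apply reach_inv in H as [(j & Hj & E)|[_ H]]; auto.
    exfalso. symmetry in E. revert E. apply gcfg_zeros. pose proof (head_lt j Hj). lia.
    apply run_ok.
  - intros H. pose proof (reach_run nh (le_n _)) as HR.
    assert (T : tG cellIS (G (rn nh)) (repeat 0 n)).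
    { unfold G. rewrite H. apply gcfg_accept; auto. pose proof (head_lt nh (le_n _)). lia. apply run_ok. }
    right. destruct HR as [->|HR]. now apply t_step. eapply t_trans; [exact HR|now apply t_step].
Qed.

Lemma cells_MC : MC_BDE (true :: enc (tInst cellIS cell_fml [[init_g cellIS]])) <->
  cf_state (rn nh) = tm_accept Mc.
Proof.
  rewrite <- cells_accept, MC_BDE_Good. pose proof (head_lt 0 ltac:(lia)) as H0.
  split.
  - intros (T & E & IS & f & I & -> & _ & _ & _ & H). apply (f_equal (@tl bool)) in E. apply (enc_inj (tInst _ _ _)) in E as E'.
    apply tInst_inj in E' as (<- & <- & <-). exact H.
  - intros H. eexists. split; [reflexivity|]. exists cellIS, cell_fml, [[init_g cellIS]].
    split; auto. split. apply wf_cellIS; lia. split; [|split; auto using interval_init].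
    unfold cell_fml. cbn [wf_fml is_lambda cellIS length is_agents]. rewrite length_map, length_seq. lia.
Qed.
End Run.
End Cells.

(** * Computing the reduction *)

Definition subT (x y : tree) : tree := foldT (fun p => tl' (tl' (tl' p))) Lf y x.

Lemma FP_subT f g : FP f -> FP g -> FP (fun x => subT (f x) (g x)).
Proof.
  intros. apply FP_foldT; fp. exists (fun _ => 0). split; [pbs|]. split; [monos|].
  intros e a acc. destruct acc; simpl; lia.
Qed.

Lemma subT_sz x y : sz (subT x y) <= sz x.
Proof.
  unfold subT. revert x. induction y as [|a _ y IH]; intros x; simpl; auto.
  etransitivity. apply IH. destruct x; simpl; lia.
Qed.

Lemma subT_tL {A} (f : A -> tree) n : forall l, subT (tL f l) (tN n) = tL f (skipn n l).
Proof.
  unfold subT. induction n as [|n IH]; intros l; auto. simpl. destruct l as [|a l]; simpl.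
  - specialize (IH []). now rewrite skipn_nil in IH.
  - apply IH.
Qed.

Lemma skipn_repeat {A} (a : A) n : forall m, skipn m (repeat a n) = repeat a (n - m).
Proof. induction n as [|n IH]; intros [|m]; simpl; auto. Qed.

Lemma subT_tN n m : subT (tN n) (tN m) = tN (n - m).
Proof. rewrite (tN_tL n), (tN_tL (n - m)), subT_tL, skipn_repeat. reflexivity. Qed.

Definition eqT (x y : tree) : tree := tif (subT x y) Lf (tif (subT y x) Lf rT).

Lemma FP_eqT f g : FP f -> FP g -> FP (fun x => eqT (f x) (g x)).
Proof.
  intros. unfold eqT. fp; try apply FP_subT; auto.
Qed.

Lemma eqT_tN n m : eqT (tN n) (tN m) = if n =? m then rT else Lf.
Proof.
  unfold eqT. rewrite !subT_tN. destruct (Nat.eqb_spec n m) as [->|H].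
  - now rewrite Nat.sub_diag.
  - destruct (n - m) eqn:E1; [|reflexivity]. destruct (m - n) eqn:E2; [lia|reflexivity].
Qed.


Lemma tif_rT (b : bool) x y : tif (if b then rT else Lf) x y = if b then x else y.
Proof. destruct b; reflexivity. Qed.

(* Truncating the length of the accumulator to the environment keeps the growth of a fold step
   polynomial in its other arguments. *)
Definition iof (p : tree) : tree :=
  let e := hd' p in let acc := tl' (tl' p) in subT e (subT e (unary acc)) # acc.
Definition iotaT (m : tree) : tree := foldT consf Lf (foldT iof m m Lf) Lf.

Lemma iof_seq m : forall j i, i + j <= m ->
  foldT iof (tN m) (tN j) (tL tN (rev (seq 0 i))) = tL tN (rev (seq 0 (i + j))).
Proof.
  induction j as [|j IH]; intros i Hi.
  - now rewrite Nat.add_0_r.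
  - simpl. unfold iof at 2. cbn [hd' tl']. rewrite unary_tL, length_rev, length_seq, !subT_tN.
    replace (m - (m - i)) with i by lia.
    replace (i + S j) with (S i + j) by lia. rewrite <- IH by lia. f_equal.
    rewrite seq_S, rev_app_distr. reflexivity.
Qed.

Lemma consf_rev {A} (f : A -> tree) l : forall r, foldT consf Lf (tL f l) (tL f r) = tL f (rev l ++ r).
Proof.
  induction l as [|a l IH]; intros r; auto. simpl. rewrite <- app_assoc. apply (IH (a :: r)).
Qed.

Lemma iotaT_tN m : iotaT (tN m) = tL tN (seq 0 m).
Proof.
  unfold iotaT. change Lf with (tL tN (rev (seq 0 0))) at 2. rewrite iof_seq by lia.
  change Lf with (tL tN []) at 2. rewrite consf_rev, rev_involutive, app_nil_r. reflexivity.
Qed.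

Lemma FP_iotaT f : FP f -> FP (fun x => iotaT (f x)).
Proof.
  intros. apply FP_foldT; fp.
  - exact FP_consf.
  - exists (fun n => n + 1). split; [pbs|]. split; [monos|]. intros. simpl. lia.
  - apply FP_foldT; fp.
    + unfold iof; cbv zeta; fp. apply FP_subT; fp. apply FP_subT; fp. apply FP_unary; fp.
    + exists (fun n => n + 1). split; [pbs|]. split; [monos|]. intros e a acc. unfold iof; cbn [hd' tl' sz].
      pose proof (subT_sz e (subT e (unary acc))). lia.
Qed.

Definition nthT (l k : tree) : tree := hd' (subT l k).

Lemma nthT_tL s k : nthT (tL tN s) (tN k) = tN (nth k s 0).
Proof.
  unfold nthT. rewrite subT_tL. revert s. induction k as [|k IH]; intros [|a s]; simpl; auto.
Qed.

Ltac fpx := repeat first [ fp_base | lazymatch goal with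
  | |- FP (fun x => subT (@?f x) (@?g x)) => apply (FP_subT f g)
  | |- FP (fun x => eqT (@?f x) (@?g x)) => apply (FP_eqT f g)
  | |- FP (fun x => appT (@?f x) (@?g x)) => apply (FP_appT f g)
  | |- FP (fun x => mulT (@?f x) (@?g x)) => apply (FP_mulT f g)
  | |- FP (fun x => unary (@?f x)) => apply (FP_unary f)
  | |- FP (fun x => iotaT (@?f x)) => apply (FP_iotaT f)
  | |- FP (fun x => mapT ?h (@?f x) (@?g x)) => apply (FP_mapT h f g)
  | |- FP (fun x => flatT ?h (@?f x) (@?g x)) => apply (FP_flatT h f g)
  end ].

(** * The reduction as a polynomial-time tree function *)

Section Reduction.
Variables (Mc : TM) (c k : nat).
Hypothesis HM : wf_TM Mc.

Fixpoint powT (x : tree) (j : nat) : tree :=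
  match j with 0 => tN 1 | S j => mulT (unary x) (powT x j) end.

Definition cells (m : nat) : nat := S (poly c k m).
Definition cellsT (x : tree) : tree := Lf # appT (mulT (tN c) (powT x k)) (tN c).

Lemma cellsT_tbits w : cellsT (tbits w) = tN (cells (length w)).
Proof.
  unfold cellsT, cells, poly. simpl tN. f_equal.
  assert (E : forall j, powT (tbits w) j = tN (length w ^ j)).
  { induction j as [|j IH]; simpl; auto. rewrite IH. unfold tbits. rewrite unary_tL. apply mulT_tN. }
  now rewrite E, mulT_tN, appT_tN.
Qed.

Lemma FP_cellsT : FP cellsT.
Proof.
  unfold cellsT. assert (H : forall j, FP (fun x => powT x j)).
  { induction j; simpl; fpx. }
  specialize (H k). fpx.
Qed.

Definition symsT (x : tree) : tree := mapT (fun p => tif (tl' p) (tN 2) (tN 1)) Lf x.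

Lemma symsT_tbits w : symsT (tbits w) = tL tN (map sym_of_bool w).
Proof.
  unfold symsT, tbits. rewrite mapT_tL, tL_map. apply tL_ext. intros [] _; reflexivity.
Qed.

Definition initT (s j : tree) : tree :=
  tif j (nthT s j) (appT (tN (tm_nsym Mc * S (tm_start Mc))) (nthT s j)).

Lemma initT_tN w j : initT (tL tN (map sym_of_bool w)) (tN j) = tN (cell_init Mc w j).
Proof.
  unfold initT. rewrite nthT_tL. unfold cell_init, symw, lc. destruct j; cbn [tN tif Nat.eqb].
  - apply appT_tN.
  - reflexivity.
Qed.

Definition tTri (t : nat * nat * nat) : tree := tN (fst (fst t)) # tN (snd (fst t)) # tN (snd t).
(** The transition tables depend on the machine alone and enter as constant trees; the input merely
    determines which table a pair of cells uses. *)
Definition tblT (p : place) : tree := tL tTri (tbl Mc p).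

Definition kindT (j i : tree) : tree :=
  tif (eqT j i) (tif i (tblT AtHead) (tblT AtLeftEnd))
    (tif (eqT j (Lf # i)) (tblT RightOf) (tif (eqT (Lf # j) i) (tblT LeftOf) (tblT Far))).

Lemma kindT_tN j i : kindT (tN j) (tN i) = tblT (kind j i).
Proof.
  unfold kindT, kind. change (Lf # tN i) with (tN (S i)). change (Lf # tN j) with (tN (S j)).
  rewrite !eqT_tN, !tif_rT. destruct (j =? i); [destruct i; reflexivity|].
  destruct (j =? S i); [reflexivity|]. destruct (S j =? i); reflexivity.
Qed.

Definition jointT (io i x : tree) : tree :=
  mapT (fun p => tif (eqT (tl' p) (hd' (hd' p))) (tl' (hd' p)) Lf) (i # x) io.

Lemma jointT_tN n i x : jointT (tL tN (seq 0 n)) (tN i) (tN x) = tV (joint n i x).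
Proof.
  unfold jointT, joint. rewrite mapT_tL. unfold tV. rewrite tL_map. apply tL_ext. intros j _.
  cbn [hd' tl']. rewrite eqT_tN, tif_rT. destruct (j =? i); reflexivity.
Qed.

Definition rowT (q : tree) : tree :=
  let i := hd' (hd' q) in let io := tl' (hd' q) in let t := tl' q in
  hd' (tl' t) # jointT io i (hd' t) # tl' (tl' t) # Lf.
Definition blockT (p : tree) : tree :=
  let j := hd' (hd' p) in let io := tl' (hd' p) in let i := tl' p in
  mapT rowT (i # io) (kindT j i).
Definition transT (io j : tree) : tree := flatT blockT (j # io) io.

Lemma transT_tN n j : transT (tL tN (seq 0 n)) (tN j) = tL tTr (trans Mc n j).
Proof.
  unfold transT, trans. apply flatT_tL. intros i _. unfold blockT. cbn [hd' tl'].
  rewrite kindT_tN. unfold tblT. rewrite mapT_tL, tL_map. apply tL_ext. intros [[x l] l'] _.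
  unfold rowT. cbn [hd' tl' tTri fst snd tTr]. now rewrite jointT_tN.
Qed.

Definition agentT (p : tree) : tree :=
  let s := hd' (hd' p) in let io := tl' (hd' p) in let j := tl' p in
  tN (cell_nloc Mc) # initT s j # tN (cell_nact Mc) # tL tV (repeat (seq 0 (cell_nact Mc)) (cell_nloc Mc)) #
  transT io j # Lf.

(** The numeral [m] is also the code of the all-zero global state, since [n] zeros and the numeral
    [n] have the same tree. [tl' m] names the last agent. *)
Definition redT (x : tree) : tree :=
  let m := cellsT x in let io := iotaT m in let s := symsT x in
  (mapT agentT (s # io) io # ((tN 2 # m # Lf) # Lf) # Lf) #
  (tN 2 # (tN 4 # tl' m # tF (FNeg (FVar 0)) # Lf) # Lf) #
  (((mapT (fun p => initT (hd' p) (tl' p)) s io) # Lf) # Lf) # Lf.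

Lemma redT_tbits w : let n := cells (length w) in
  redT (tbits w) = tInst (cellIS Mc n w) (cell_fml n) [[init_g (cellIS Mc n w)]].
Proof.
  intros n. unfold redT. cbv zeta. rewrite cellsT_tbits. fold n. rewrite iotaT_tN, symsT_tbits.
  assert (E1 : mapT agentT (tL tN (map sym_of_bool w) # tL tN (seq 0 n)) (tL tN (seq 0 n)) =
    tL tAg (map (cell_agent Mc n w) (seq 0 n))).
  { rewrite mapT_tL, (tL_map tAg (cell_agent Mc n w)). apply tL_ext. intros j _. unfold agentT. cbn [hd' tl'].
    rewrite initT_tN, transT_tN. reflexivity. }
  assert (E2 : mapT (fun p => initT (hd' p) (tl' p)) (tL tN (map sym_of_bool w)) (tL tN (seq 0 n)) =
    tV (init_g (cellIS Mc n w))).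
  { unfold init_g, cellIS; cbn [is_agents]. rewrite mapT_tL, map_map. unfold tV.
    rewrite (tL_map tN (fun j => ag_init (cell_agent Mc n w j))).
    apply tL_ext. intros j _. cbn [hd' tl']. apply initT_tN. }
  assert (E3 : tV (repeat 0 n) = tN n).
  { generalize n. clear. intros n. induction n; simpl; [reflexivity|]. f_equal. exact IHn. }
  rewrite E1, E2. unfold tInst, tIS, cellIS, cell_fml. cbn [is_agents is_lambda].
  cbn [tL fold_right tRe tF tnode]. rewrite E3.
  unfold n, cells. simpl. now rewrite Nat.sub_0_r.
Qed.

Lemma FP_redT : FP redT.
Proof.
  assert (HJ : FP (fun q => jointT (tl' (hd' q)) (hd' (hd' q)) (hd' (tl' q)))) by (unfold jointT; fpx).
  assert (HR : FP rowT) by (unfold rowT; cbv zeta; fpx).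
  assert (HB : FP blockT) by (unfold blockT, kindT; cbv zeta; fpx).
  assert (HT : FP (fun p => transT (tl' (hd' p)) (tl' p))) by (unfold transT; fpx).
  assert (HA : FP agentT) by (unfold agentT, initT, nthT; cbv zeta; fpx).
  pose proof FP_cellsT as HC.
  unfold redT, symsT, initT, nthT; cbv zeta. fpx.
Qed.

End Reduction.

Theorem MC_BDE_hard : PSPACE_hard MC_BDE.
Proof.
  intros L (Mc & c & k & HM & HD).
  exists (fun w => true :: enc (redT Mc c k (tbits w))). split.
  - destruct (FP_redT Mc c k) as (cm & P & HP & HPm & HC).
    apply poly_time_intro with cm (fun n => P (4 * n + 1)). pbs.
    intros w. destruct (HC (tbits w) []) as (t & Ht & E). rewrite !app_nil_r in E.
    pose proof (HPm _ _ (proj2 (tbits_sz w))). exists t. split. lia.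
    eapply exec_le. exact E. simpl length. cbv beta. lia.
  - intros w. rewrite redT_tbits. destruct (HD w) as (nh & Hh & Ha & Hs).
    rewrite (cells_MC Mc HM (cells c k (length w)) w nh Hh); [symmetry; exact Ha|].
    intros j Hj. unfold cells. specialize (Hs j Hj). lia.
Qed.

Theorem theorem2 : PSPACE_complete MC_BDE.
Proof. split; [exact MC_BDE_in_PSPACE|exact MC_BDE_hard]. Qed.
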